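(* Let $D,D'\subset\mathbb C^n$ be bounded, complete hyperbolic domains, and assume that $\overline D$ has a Stein neighborhood basis and that $D'$ has the visibility property. Suppose there exists $p\in\partial D$ such that $\partial D$ is $\mathcal C^3$-smooth and strongly pseudoconvex at $p$. If $F:D\to D'$ is a biholomorphism, then $F$ admits a non-tangential limit at $p$; that is, there is a point $q$ such that $F(z_k)\to q$ for every sequence $\{z_k\}\subset D$ converging non-tangentially to $p$.
   Context: For a domain $D\subset\mathbb C^n$, $k_D$ denotes the Kobayashi (pseudo)distance (the integrated form of the Kobayashi–Royden metric). $D$ is complete hyperbolic if $k_D$ is a complete distance. A geodesic is a curve $\sigma:I\to D$ on an interval $I\subset\mathbb R$ with $k_D(\sigma(s),\sigma(t))=|s-t|$ for all $s,t\in I$. Visibility: let $D$ be complete hyperbolic and $p,q\in\partial D$, $p\ne q$. The pair $\{p,q\}$ has visible geodesics if there are neighborhoods $U,V$ of $p,q$ respectively with $\overline U\cap\overline V=\emptyset$ and a compact set $K\subset D$ such that every geodesic $\gamma:[0,L]\to D$ with $\gamma(0)\in U$, $\gamma(L)\in V$ satisfies $\gamma([0,L])\cap K\ne\emptyset$. $D$ has the visibility property if every pair of distinct boundary points has visible geodesics. $\overline D$ has a Stein neighborhood basis if every open neighborhood of $\overline D$ contains a Stein (pseudoconvex) open neighborhood of $\overline D$. A sequence $\{z_k\}\subset D$ converges non-tangentially to $p$ if $z_k\to p$ and there is $C>0$ with $\|z_k-p\|\le C\,\delta_D(z_k)$ for all $k$, where $\delta_D(z)=\inf\{\|z-w\|:w\in\mathbb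 C^n\setminus D\}$. *)

(* Defs.v *)
(* C is R[i] for R : realType, and C^n is 'rV[R[i]]_n. *)
From HB Require Import structures.
From mathcomp Require Import all_boot all_order all_algebra.
From mathcomp Require Import complex.
From mathcomp Require Import all_classical all_reals all_analysis.

Set Implicit Arguments.
Unset Strict Implicit.
Unset Printing Implicit Defensive.

Import Order.TTheory GRing.Theory Num.Theory numFieldNormedType.Exports.
Import ComplexField.Normc.

Local Open Scope classical_set_scope.
Local Open Scope ring_scope.
Local Open Scope complex_scope.

(* R[i] with the topology of its absolute value, so that [differentiable] on
   'rV[R[i]]_n is complex (Frechet) differentiability.  The library norm on
   'rV[R[i]]_n is the sup norm; it is used only through its topology and
   [bounded_set]. *)
#[warnings="-redundant-canonical-projection"]
HB.instance Definition _ (R : realType) := NormedModule.copy R[i] R[i]^o.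

Section Basics.
Context {R : realType}.

Definition enorm n (z : 'rV[R[i]]_n) : R :=
  Num.sqrt (\sum_j normc (z 0 j) ^+ 2).

Definition domain n (D : set 'rV[R[i]]_n) :=
  [/\ open D, connected D & D !=set0].

Definition boundary n (D : set 'rV[R[i]]_n) := closure D `\` D°.

Definition dist_compl n (D : set 'rV[R[i]]_n) (z : 'rV[R[i]]_n) : R :=
  inf [set enorm (z - w) | w in ~` D].

Definition holomorphic_on (V W : normedModType R[i]) (D : set V) (f : V -> W) :=
  forall z, D z -> differentiable f z.

Definition biholomorphism n (D D' : set 'rV[R[i]]_n)
    (F : 'rV[R[i]]_n -> 'rV[R[i]]_n) :=
  exists G : 'rV[R[i]]_n -> 'rV[R[i]]_n,
    [/\ holomorphic_on D F, holomorphic_on D' G,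
        forall z, D z -> D' (F z) /\ G (F z) = z
      & forall w, D' w -> D (G w) /\ F (G w) = w].

End Basics.

Section Kobayashi.
Context {R : realType}.

Definition unit_disc : set R[i] := [set x | normc x < 1].

Definition kobayashi_royden n (D : set 'rV[R[i]]_n) (z v : 'rV[R[i]]_n)
    : \bar R :=
  ereal_inf [set (normc xi)%:E | xi in [set xi : R[i] |
    exists phi : R[i] -> 'rV[R[i]]_n,
      [/\ holomorphic_on unit_disc phi,
          forall x, unit_disc x -> D (phi x),
          phi 0 = z
        & 'd phi (0 : R[i]) xi = v]]].

(* Derivatives in a real variable are taken on real and imaginary parts, since
   R[i] carries no normed R-module structure here. *)
Definition real_derivable (f : R -> R[i]) (t : R) :=
  derivable (fun s => complex.Re (f s)) t 1 /\
  derivable (fun s => complex.Im (f s)) t 1.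

Definition real_derive1 (f : R -> R[i]) (t : R) : R[i] :=
  derive1 (fun s => complex.Re (f s)) t +i* derive1 (fun s => complex.Im (f s)) t.

Definition velocity n (g : R -> 'rV[R[i]]_n) (t : R) : 'rV[R[i]]_n :=
  \row_j real_derive1 (fun s => g s 0 j) t.

(* C^1 on the closed interval [a, b], as the restriction of a C^1 curve on the
   line; values of [g] outside [a, b] are irrelevant. *)
Definition C1_curve n (a b : R) (g : R -> 'rV[R[i]]_n) :=
  exists h : R -> 'rV[R[i]]_n,
    [/\ forall t j, real_derivable (fun s => h s 0 j) t,
        continuous (velocity h)
      & forall t, a <= t <= b -> g t = h t].

Definition piecewise_C1_curve n (g : R -> 'rV[R[i]]_n) :=
  exists s : seq R,
    [/\ path <%R 0 s, last 0 s = 1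
      & forall i, (i < size s)%N ->
          C1_curve (nth 0 (0 :: s) i) (nth 0 s i) g].

(* [velocity g] is meaningless at the finitely many break points and at the
   endpoints, a null set. *)
Definition kobayashi_length n (D : set 'rV[R[i]]_n) (g : R -> 'rV[R[i]]_n)
    : \bar R :=
  (\int[lebesgue_measure]_(t in `[0%R, 1%R])
     kobayashi_royden D (g t) (velocity g t))%E.

Definition kobayashi_dist n (D : set 'rV[R[i]]_n) (z w : 'rV[R[i]]_n)
    : \bar R :=
  ereal_inf [set kobayashi_length D g | g in [set g : R -> 'rV[R[i]]_n |
    [/\ piecewise_C1_curve g, forall t, 0 <= t <= 1 -> D (g t),
        g 0 = z & g 1 = w]]].

(* Symmetry and the triangle inequality hold for every domain, so only
   separation and completeness are required. *)
Definition complete_hyperbolic n (D : set 'rV[R[i]]_n) :=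
  (forall z w, D z -> D w -> kobayashi_dist D z w = 0%E -> z = w) /\
  (forall u : nat -> 'rV[R[i]]_n, (forall k, D (u k)) ->
     (forall e : R, 0 < e -> exists N : nat, forall k l : nat,
        (N <= k)%N -> (N <= l)%N -> (kobayashi_dist D (u k) (u l) < e%:E)%E) ->
     exists2 z, D z &
       (fun k => kobayashi_dist D (u k) z) @ \oo --> (0 : \bar R)%E).

Definition geodesic n (D : set 'rV[R[i]]_n) (I : set R)
    (g : R -> 'rV[R[i]]_n) :=
  (forall t, I t -> D (g t)) /\
  (forall s t, I s -> I t -> kobayashi_dist D (g s) (g t) = `|s - t|%:E).

Definition visible_geodesics n (D : set 'rV[R[i]]_n) (p q : 'rV[R[i]]_n) :=
  exists U V K : set 'rV[R[i]]_n,
    [/\ nbhs p U, nbhs q V, closure U `&` closure V = set0,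
        compact K /\ K `<=` D
      & forall (L : R) (g : R -> 'rV[R[i]]_n), 0 <= L ->
          geodesic D `[0, L] g -> U (g 0) -> V (g L) ->
          exists2 t, 0 <= t <= L & K (g t)].

Definition visibility n (D : set 'rV[R[i]]_n) :=
  forall p q, boundary D p -> boundary D q -> p <> q -> visible_geodesics D p q.

End Kobayashi.

Section Stein.
Context {R : realType}.

(* |f z| <= sup_K |f|, written with upper bounds so that the hull of the empty
   set is empty. *)
Definition holomorphic_hull n (Omega K : set 'rV[R[i]]_n)
    : set 'rV[R[i]]_n :=
  [set z | Omega z /\ forall f : 'rV[R[i]]_n -> R[i], holomorphic_on Omega f ->
     forall M : R, (forall w, K w -> normc (f w) <= M) -> normc (f z) <= M].

Definition stein_open n (Omega : set 'rV[R[i]]_n) :=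
  [/\ open Omega,
      forall K, compact K -> K `<=` Omega -> compact (holomorphic_hull Omega K)
    & forall z w, Omega z -> Omega w -> z <> w ->
        exists2 f : 'rV[R[i]]_n -> R[i], holomorphic_on Omega f & f z <> f w].

Definition stein_neighborhood_basis n (A : set 'rV[R[i]]_n) :=
  forall W : set 'rV[R[i]]_n, open W -> A `<=` W ->
    exists Omega, [/\ stein_open Omega, A `<=` Omega & Omega `<=` W].

End Stein.

Section StronglyPseudoconvex.
Context {R : realType}.

(* Real directional derivatives on C^n = R^(2n). *)
Definition dir_derivable n (v : 'rV[R[i]]_n) (rho : 'rV[R[i]]_n -> R) z :=
  derivable (fun t : R => rho (z + t%:C *: v)) 0 1.

Definition dir_derive n (v : 'rV[R[i]]_n) (rho : 'rV[R[i]]_n -> R) z : R :=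
  derive1 (fun t : R => rho (z + t%:C *: v)) 0.

Fixpoint Ck_on n (k : nat) (U : set 'rV[R[i]]_n) (rho : 'rV[R[i]]_n -> R)
    : Prop :=
  (forall z, U z -> {for z, continuous rho}) /\
  if k is k'.+1 then
    forall v, (forall z, U z -> dir_derivable v rho z) /\
              Ck_on k' U (dir_derive v rho)
  else True.

Definition dir_derivec n (v : 'rV[R[i]]_n) (f : 'rV[R[i]]_n -> R[i]) z : R[i] :=
  dir_derive v (fun w => complex.Re (f w)) z +i*
  dir_derive v (fun w => complex.Im (f w)) z.

(* Wirtinger derivatives d/dz_j = (d/dx_j - i d/dy_j) / 2 and
   d/dzbar_j = (d/dx_j + i d/dy_j) / 2. *)
Definition dz n (j : 'I_n) (f : 'rV[R[i]]_n -> R[i]) z : R[i] :=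
  (dir_derivec (delta_mx 0 j) f z
   - 'i * dir_derivec ('i *: delta_mx 0 j) f z) / 2.

Definition dzbar n (j : 'I_n) (f : 'rV[R[i]]_n -> R[i]) z : R[i] :=
  (dir_derivec (delta_mx 0 j) f z
   + 'i * dir_derivec ('i *: delta_mx 0 j) f z) / 2.

Definition complex_tangent n (rho : 'rV[R[i]]_n -> R) (p v : 'rV[R[i]]_n) :=
  \sum_j dz j (fun z => (rho z)%:C) p * v 0 j = 0.

Definition levi_form n (rho : 'rV[R[i]]_n -> R) (p v : 'rV[R[i]]_n) : R[i] :=
  \sum_j \sum_k
    dz j (dzbar k (fun z => (rho z)%:C)) p * v 0 j * (v 0 k)^*%C.

Definition C3_strongly_pseudoconvex_at n (D : set 'rV[R[i]]_n)
    (p : 'rV[R[i]]_n) :=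
  exists (U : set 'rV[R[i]]_n) (rho : 'rV[R[i]]_n -> R),
    [/\ open U /\ U p,
        Ck_on 3 U rho,
        forall z, U z -> exists v, dir_derive v rho z <> 0,
        D `&` U = [set z | U z /\ rho z < 0]
      & forall v, v <> 0 -> complex_tangent rho p v -> 0 < levi_form rho p v].

Definition cvg_nontangential n (D : set 'rV[R[i]]_n)
    (z : nat -> 'rV[R[i]]_n) (p : 'rV[R[i]]_n) :=
  [/\ forall k, D (z k), z @ \oo --> p
    & exists2 c : R, 0 < c & forall k, enorm (z k - p) <= c * dist_compl D (z k)].

End StronglyPseudoconvex.

(* Main.v *)
(** A peak function [H] at the strongly pseudoconvex point [p], polynomial and thus
    holomorphic on all of C^n, bounds the discs of [D] through points near [p], and
    integrating this bound gives [k_D(z,y) >= 1/2 log (1/|z - p|) - C] for [z] near [p]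
    and [y] away from [p]. If [z] and [w] tend to [p] non-tangentially, paths in the
    internally tangent discs give the matching upper bound
    [k_D(z,w) <= 1/2 |log (|z - p|/|w - p|)| + C]. Were there two cluster values of [F]
    along non-tangential sequences, visibility of [D'] would supply geodesics joining
    [F z] to [F w] through a fixed compact set, hence
    [k_D(z,w) >= 1/2 log (1/|z - p|) + 1/2 log (1/|w - p|) - C], which contradicts the
    upper bound. *)

(* The factor 1/2 in the lower bound has to be sharp. With A = log 1/|z - p| and B = log 1/|w - p|,
   the two estimates differ by (A + B)/2 - |A - B|/2 = min(A, B), up to a constant; a smaller factor
   would fail when the two sequences approach [p] at unrelated speeds. The obstacle is that the peak
   function controls a disc only while it stays near [p]. A Cauchy estimate confines a fixed
   fraction of the radius and gives a bound with a worse factor; this bound confines all but a power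
   of |z - p| of the radius, and such a defect costs only an additive constant after integration.
   The lower bounds come from a C^1 potential whose differential is dominated by the metric.
   Measurability of the metric along curves is never established, so lengths are handled as suprema
   over measurable minorants. Completeness of [D'] enters through Hopf-Rinow, which provides the
   geodesics that visibility speaks about. *)
Require Import Defs.
From HB Require Import structures.
From mathcomp Require Import all_boot all_order all_algebra.
From mathcomp Require Import complex.
From mathcomp Require Import all_classical all_reals all_analysis.
From mathcomp Require Import measurable_realfun.
From mathcomp Require Import ring lra.

Set Implicit Arguments.
Unset Strict Implicit.
Unset Printing Implicit Defensive.

Import Order.TTheory GRing.Theory Num.Theory numFieldNormedType.Exports.
Import ComplexField.Normc.

Local Open Scope classical_set_scope.
Local Open Scope ring_scope.
Local Open Scope complex_scope.

(** * Moduli and real-valued norms *)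

Section ComplexNorm.
Context {R : realType}.
Implicit Types z w : R[i].

Lemma normcC z : `|z| = (normc z)%:C.
Proof. by case: z => a b; rewrite normc_def. Qed.

Lemma normc_ge0 z : 0 <= normc z.
Proof. by rewrite -lecR -normcC normr_ge0. Qed.

Lemma normc_real (a : R) : normc a%:C = `|a|.
Proof. by rewrite /= expr0n addr0 sqrtr_sqr. Qed.

Lemma normc_Re z : `|complex.Re z| <= normc z.
Proof. by rewrite -lecR -normcC normc_ge_Re. Qed.

Lemma normci : normc ('i : R[i]) = 1.
Proof. by rewrite /= expr0n add0r expr1n sqrtr1. Qed.

Lemma normc_Im z : `|complex.Im z| <= normc z.
Proof.
have := normc_Re (z * 'i); rewrite normcM normci mulr1.
by case: z => a b /=; rewrite mulr0 mulr1 sub0r normrN.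
Qed.

Lemma normc_le_ReIm z : normc z <= `|complex.Re z| + `|complex.Im z|.
Proof.
case: z => a b /=; rewrite -[leRHS]ger0_norm ?addr_ge0// -sqrtr_sqr ler_sqrt.
  by rewrite sqrrD !real_normK ?num_real// -addrA lerD2l lerDr mulrn_wge0 // mulr_ge0.
by rewrite sqr_ge0.
Qed.

Lemma normc_sqr z : normc z ^+ 2 = complex.Re z ^+ 2 + complex.Im z ^+ 2.
Proof. by case: z => a b /=; rewrite sqr_sqrtr // addr_ge0 // sqr_ge0. Qed.

Lemma le_normcB z w : normc z - normc w <= normc (z - w).
Proof. by rewrite lerBlDr; apply: le_trans (le_normcD _ _); rewrite subrK. Qed.

Lemma normc_eq0 z : (normc z == 0) = (z == 0).
Proof.
apply/eqP/eqP => [|->]; first exact: eq0_normc.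
by rewrite normc0.
Qed.

Lemma normc_gt0 z : (0 < normc z) = (z != 0).
Proof. by rewrite lt_neqAle normc_ge0 andbT eq_sym normc_eq0. Qed.

Lemma normcB z w : normc (z - w) = normc (w - z).
Proof. by rewrite -normcN opprB. Qed.

Lemma normcX z k : normc (z ^+ k) = normc z ^+ k.
Proof.
elim: k => [|k IH]; first by rewrite !expr0 -[1]/(1%:C) normc_real normr1.
by rewrite !exprS normcM IH.
Qed.

Lemma ReD z w : complex.Re (z + w) = complex.Re z + complex.Re w.
Proof. by case: z => a b; case: w => c d. Qed.

Lemma ImD z w : complex.Im (z + w) = complex.Im z + complex.Im w.
Proof. by case: z => a b; case: w => c d. Qed.

Lemma ReN z : complex.Re (- z) = - complex.Re z.
Proof. by case: z. Qed.

Lemma ImN z : complex.Im (- z) = - complex.Im z.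
Proof. by case: z. Qed.

End ComplexNorm.

Section RealNorm.
Context {R : realType} {V : normedModType R[i]}.
Implicit Types v w : V.

(** Norms of modules over [R[i]] take values in [R[i]], where the order is only partial; [nr] reads
    the same number in [R], so that real arithmetic applies. *)
Definition nr v : R := complex.Re `|v|.

Lemma nrC v : `|v| = (nr v)%:C.
Proof.
rewrite /nr; move: (normr_ge0 v); case: (`|v|) => a b /=.
by rewrite lecE /= => /andP[/eqP -> _].
Qed.

Lemma nr_ge0 v : 0 <= nr v.
Proof. by rewrite -lecR -nrC normr_ge0. Qed.

Lemma nr0 : nr 0 = 0.
Proof. by rewrite /nr normr0. Qed.

Lemma nr_eq0 v : (nr v == 0) = (v == 0).
Proof. by rewrite -[in RHS]normr_eq0 nrC; apply/eqP/eqP => [->//|[]]. Qed.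

Lemma nr_gt0 v : (0 < nr v) = (v != 0).
Proof. by rewrite lt_neqAle nr_ge0 andbT eq_sym nr_eq0. Qed.

Lemma nrD v w : nr (v + w) <= nr v + nr w.
Proof. by rewrite -lecR rmorphD /= -!nrC ler_normD. Qed.

Lemma nrN v : nr (- v) = nr v.
Proof. by rewrite /nr normrN. Qed.

Lemma nrB v w : nr (v - w) = nr (w - v).
Proof. by rewrite -nrN opprB. Qed.

Lemma nr_triangle u v w : nr (v - w) <= nr (v - u) + nr (u - w).
Proof. by apply: le_trans (nrD _ _); rewrite subrKA. Qed.

Lemma nrZ (a : R[i]) v : nr (a *: v) = normc a * nr v.
Proof. by apply: complexI; rewrite rmorphM /= -!nrC -normcC normrZ. Qed.

Lemma le_nrB v w : nr v - nr w <= nr (v - w).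
Proof. by rewrite lerBlDr; apply: le_trans (nrD _ _); rewrite subrK. Qed.

Lemma nbhs_nrP v (U : set V) :
  nbhs v U <-> exists2 e : R, 0 < e & forall w, nr (w - v) < e -> U w.
Proof.
split=> [/nbhs_ballP[e /= e0 eU]|[e e0 eU]]; last apply/nbhs_ballP.
  have ere : e = (complex.Re e)%:C by rewrite RRe_real // gtr0_real.
  exists (complex.Re e); first by rewrite -ltcR -ere.
  move=> w we; apply: eU; rewrite -ball_normE /ball_ /= distrC nrC ere.
  by rewrite ltcR.
exists e%:C; first by rewrite /= ltcR.
move=> w; rewrite -ball_normE /ball_ /= distrC nrC ltcR; exact: eU.
Qed.

Lemma nr_near v (e : R) : 0 < e -> \forall w \near v, nr (w - v) < e.
Proof. by move=> e0; apply/nbhs_nrP; exists e. Qed.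

Lemma open_nrP (U : set V) :
  open U <-> forall v, U v -> exists2 e : R, 0 < e & forall w, nr (w - v) < e -> U w.
Proof.
rewrite openE; split=> H v /H; first by move/nbhs_nrP.
by move=> ?; apply/nbhs_nrP.
Qed.

Lemma closure_nrP (A : set V) v :
  closure A v <-> forall e : R, 0 < e -> exists2 w, A w & nr (w - v) < e.
Proof.
split=> [cA e e0|H B /nbhs_nrP[e e0 eB]].
  by have [w [Aw we]] := cA _ (nr_near v e0); exists w.
by have [w Aw we] := H _ e0; exists w; split => //; exact: eB.
Qed.

Lemma cvg_nrP (T : Type) (F : set_system T) (FF : Filter F) (f : T -> V) v :
  f @ F --> v <-> forall e : R, 0 < e -> \forall x \near F, nr (f x - v) < e.
Proof.
split=> [fv e e0|H U /nbhs_nrP[e e0 eU]]; first exact: (fv _ (nr_near v e0)).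
by apply: filterS (H _ e0) => x; exact: eU.
Qed.

Lemma bounded_nrP (A : set V) :
  bounded_set A <-> exists2 M : R, 0 < M & forall v, A v -> nr v <= M.
Proof.
split=> [[M [Mr MA]]|[M M0 MA]].
  have MM : M = (complex.Re M)%:C by rewrite RRe_real.
  exists (`|complex.Re M| + 1); first by rewrite ltr_wpDl.
  move=> v Av; rewrite -lecR -nrC; apply: MA => //; rewrite MM ltcR.
  by rewrite (le_lt_trans (ler_norm _)) // ltrDl.
exists M%:C; split; first by rewrite complex_real.
by move=> x Mx v /MA vM /=; rewrite nrC; apply: le_trans (ltW Mx); rewrite lecR.
Qed.

End RealNorm.

Lemma nr_normc {R : realType} (z : R[i]) : nr z = normc z.
Proof. by rewrite /nr normcC. Qed.

Section RowNorm.
Context {R : realType} {n : nat}.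
Implicit Types v w : 'rV[R[i]]_n.

Lemma normc_le_nr v j : normc (v 0 j) <= nr v.
Proof.
rewrite -lecR -normcC -nrC [leRHS]/Num.norm /=.
rewrite mx_normE -[leLHS]nngE num_le.
exact: (le_bigmax _ _ (0, j)).
Qed.

Lemma nr_le v (c : R) : 0 <= c -> (forall j, normc (v 0 j) <= c) -> nr v <= c.
Proof.
move=> c0 H; have [->|v0] := eqVneq v 0; first by rewrite nr0.
have : mx_norm v != 0.
  by apply: contra v0 => /eqP /mx_norm_eq0 ->.
move=> /mx_norm_neq0[[i j]]; rewrite ord1 /= => E.
by rewrite -lecR -nrC [leLHS]E normcC lecR.
Qed.

Lemma nr_le_enorm v : nr v <= enorm v.
Proof.
apply: nr_le => [|j]; first exact: sqrtr_ge0.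
rewrite -[leLHS]ger0_norm ?normc_ge0// -sqrtr_sqr ler_sqrt ?sumr_ge0 // => [|i _].
  by rewrite (bigD1 j) //= lerDl sumr_ge0 // => i _; rewrite sqr_ge0.
by rewrite sqr_ge0.
Qed.

Lemma enorm_le_nr v : enorm v <= n%:R * nr v.
Proof.
rewrite -[leRHS]ger0_norm ?mulr_ge0 ?nr_ge0 ?ler0n// -sqrtr_sqr ler_sqrt ?sqr_ge0 //.
apply: (@le_trans _ _ (n%:R * nr v ^+ 2)).
  apply: (@le_trans _ _ (\sum_(j < n) nr v ^+ 2)).
    apply: ler_sum => j _; rewrite lerXn2r ?nnegrE ?normc_ge0 ?nr_ge0 //.
    exact: normc_le_nr.
  by rewrite sumr_const card_ord mulr_natl.
rewrite exprMn ler_wpM2r ?sqr_ge0// -natrX ler_nat.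
by case: (n) => // m; rewrite expnS expn1 leq_pmulr.
Qed.

End RowNorm.

(** * Compactness of closed bounded sets *)

Section ComplexCompact.
Context {R : realType}.

Lemma Re_continuous : continuous (@complex.Re R).
Proof.
move=> z; apply/(@cvgrPdist_lt _ _ _ _ (nbhs_filter z)) => e e0.
apply: filterS (@nr_near R R[i] z e e0) => w.
by rewrite nr_normc; apply: le_lt_trans; rewrite normcB -ReN -ReD normc_Re.
Qed.

Lemma Im_continuous : continuous (@complex.Im R).
Proof.
move=> z; apply/(@cvgrPdist_lt _ _ _ _ (nbhs_filter z)) => e e0.
apply: filterS (@nr_near R R[i] z e e0) => w.
by rewrite nr_normc; apply: le_lt_trans; rewrite normcB -ImN -ImD normc_Im.
Qed.

Lemma compact_csquare (M : R) :
  compact [set z : R[i] | `|complex.Re z| <= M /\ `|complex.Im z| <= M].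
Proof.
rewrite (_ : mkset _ = (fun q : R * R => q.1 +i* q.2) @`
    (`[(- M), M]%classic `*` `[(- M), M]%classic)); last first.
  apply/seteqP; split=> [[a b] /= [aM bM]|_ [[a b] /= [aM bM] <-] /=].
    by exists (a, b) => //; split; rewrite /= in_itv /= -ler_norml.
  by move: aM bM; rewrite !in_itv /= !ler_norml.
apply: continuous_compact; last by apply: compact_setX; exact: segment_compact.
apply: continuous_subspaceT => -[a b]; apply/(@cvg_nrP R R[i]) => e e0.
have [e2 e20] : exists2 e2 : R, 0 < e2 & e2 + e2 = e by exists (e/2); lra.
move=> <-; near=> q; rewrite nr_normc.
apply: (le_lt_trans (normc_le_ReIm _)); rewrite /= ltrD // -normrN opprB.
  near: q; have : (fun q : R * R => q.1) @ (a, b) --> a by exact: cvg_fst.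
  by move/cvgrPdist_lt; apply.
near: q; have : (fun q : R * R => q.2) @ (a, b) --> b by exact: cvg_snd.
by move/cvgrPdist_lt; apply.
Unshelve. all: by end_near. Qed.

Lemma closed_bounded_compact n (A : set 'rV[R[i]]_n) :
  bounded_set A -> closed A -> compact A.
Proof.
move=> /bounded_nrP[M M0 MA] Acl.
apply: subclosed_compact Acl
  (@rV_compact R[i] n (fun=> [set z | `|complex.Re z| <= M /\ `|complex.Im z| <= M]) _) _.
  by move=> _; exact: compact_csquare.
move=> v /MA vM j /=; split.
  by rewrite (le_trans (normc_Re _)) // (le_trans (normc_le_nr _ _)).
by rewrite (le_trans (normc_Im _)) // (le_trans (normc_le_nr _ _)).
Qed.

End ComplexCompact.

(** * Cauchy's theorem on triangles through trapezoid sums *)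

Section Trapezoid.
Context {R : realType}.
Local Notation C := (R[i]).
Implicit Types (f g : C -> C) (a b c z w : C) (S : set C).

Definition cmid a b : C := (a + b) / 2.

Lemma cmidC a b : cmid a b = cmid b a.
Proof. by rewrite /cmid addrC. Qed.

(** The trapezoid sum on 2^N equal pieces, a stand-in for the line integral. Recursive halving makes
    the sum split exactly at the midpoint of the segment. *)
Fixpoint edge f (N : nat) a b : C :=
  if N is N'.+1 then edge f N' a (cmid a b) + edge f N' (cmid a b) b
  else (f a + f b) / 2 * (b - a).

Definition tri f N a b c : C := edge f N a b + edge f N b c + edge f N c a.

Lemma edge_rev f N a b : edge f N b a = - edge f N a b.
Proof.
elim: N a b => [|N IH] a b /=; first by rewrite (addrC (f b)) -mulrN opprB.
by rewrite (cmidC b a) (IH a) (IH _ b) opprD addrC.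
Qed.

(** Neighbouring quarter triangles run through their common edge in opposite directions, and
    trapezoid sums change sign under reversal. The inner edges thus cancel exactly at every finite
    level, which is what bisection requires. *)
Lemma triS f N a b c : tri f N.+1 a b c =
  tri f N a (cmid a b) (cmid c a) + tri f N b (cmid b c) (cmid a b)
  + tri f N c (cmid c a) (cmid b c) + tri f N (cmid a b) (cmid b c) (cmid c a).
Proof.
rewrite /tri /= (edge_rev f N (cmid a b) (cmid c a)).
rewrite (edge_rev f N (cmid b c) (cmid c a)) (edge_rev f N (cmid a b) (cmid b c)).
ring.
Qed.

Lemma edgeB f g N a b : edge (fun z => f z - g z) N a b = edge f N a b - edge g N a b.
Proof. by elim: N a b => [|N IH] a b /=; [|rewrite !IH]; ring. Qed.

Lemma edgeZ (k : C) f N a b : edge (fun z => k * f z) N a b = k * edge f N a b.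
Proof. by elim: N a b => [|N IH] a b /=; [|rewrite !IH]; ring. Qed.

Lemma triB f g N a b c : tri (fun z => f z - g z) N a b c = tri f N a b c - tri g N a b c.
Proof. by rewrite /tri !edgeB; ring. Qed.

Lemma triZ (k : C) f N a b c : tri (fun z => k * f z) N a b c = k * tri f N a b c.
Proof. by rewrite /tri !edgeZ; ring. Qed.

(** The trapezoid rule is exact on affine functions. Hence subtracting a tangent line from [f]
    leaves its closed sums unchanged. *)
Lemma edge_affine (p q : C) N a b :
  edge (fun z => p + q * z) N a b = (p * b + q * b ^+ 2 / 2) - (p * a + q * a ^+ 2 / 2).
Proof.
elim: N a b => [|N IH] a b /=; last by rewrite !IH; ring.
by field.
Qed.

Lemma tri_affine (p q : C) N a b c : tri (fun z => p + q * z) N a b c = 0.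
Proof. by rewrite /tri !edge_affine; ring. Qed.

(** Takes the place of convexity: bisection visits only points obtained by repeated midpoints. *)
Definition mid_closed S := forall a b, S a -> S b -> S (cmid a b).

Lemma cmidBl a b : cmid a b - a = (b - a) / 2.
Proof. by rewrite /cmid; field. Qed.

Lemma cmidBr a b : b - cmid a b = (b - a) / 2.
Proof. by rewrite /cmid; field. Qed.

Lemma normc2 : normc (2 : C) = 2.
Proof.
by rewrite (_ : (2 : C) = (2 : R)%:C) ?normc_real ?ger0_norm// rmorph_nat.
Qed.

Lemma normc_half z : normc (z / 2) = normc z / 2.
Proof. by rewrite normcM normcV normc2. Qed.

Lemma edge_bound f S (M : R) N a b : mid_closed S -> S a -> S b ->
  (forall z, S z -> normc (f z) <= M) -> normc (edge f N a b) <= M * normc (b - a).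
Proof.
move=> Sm + + fM; elim: N a b => [|N IH] a b Sa Sb /=.
  rewrite normcM normc_half ler_wpM2r ?normc_ge0 // ler_pdivrMr //.
  by rewrite (le_trans (le_normcD _ _)) // mulr_natr mulr2n lerD // fM.
have Sc := Sm _ _ Sa Sb.
rewrite (le_trans (le_normcD _ _)) //.
rewrite (le_trans (lerD (IH _ _ Sa Sc) (IH _ _ Sc Sb))) //.
by rewrite cmidBl cmidBr normc_half -mulrDr -splitr.
Qed.

Definition perim a b c : R := normc (b - a) + normc (c - b) + normc (a - c).

Lemma tri_bound f S (M : R) N a b c : mid_closed S -> S a -> S b -> S c ->
  (forall z, S z -> normc (f z) <= M) -> normc (tri f N a b c) <= M * perim a b c.
Proof.
move=> Sm Sa Sb Sc fM; rewrite /tri /perim !mulrDr.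
rewrite (le_trans (le_normcD _ _)) // lerD //; last exact: edge_bound fM.
by rewrite (le_trans (le_normcD _ _)) // lerD //; exact: edge_bound fM.
Qed.

(** Plays the role of the bound [e] on the modulus of the contour integral, phrased for all
    sufficiently fine sums without passing to a limit. *)
Definition eventually_le f (e : R) a b c :=
  exists N0, forall N, (N0 <= N)%N -> normc (tri f N a b c) <= e.

Lemma eventually_le_split f (e1 e2 e3 e4 : R) a b c :
  eventually_le f e1 a (cmid a b) (cmid c a) ->
  eventually_le f e2 b (cmid b c) (cmid a b) ->
  eventually_le f e3 c (cmid c a) (cmid b c) ->
  eventually_le f e4 (cmid a b) (cmid b c) (cmid c a) ->
  eventually_le f (e1 + e2 + e3 + e4) a b c.
Proof.
move=> [N1 H1] [N2 H2] [N3 H3] [N4 H4]; exists (maxn N1 (maxn N2 (maxn N3 N4))).+1.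
case=> // N; rewrite ltnS !geq_max => /and4P[/H1 {}H1 /H2 {}H2 /H3 {}H3 /H4 {}H4].
rewrite triS (le_trans (le_normcD _ _)) // lerD //.
by rewrite (le_trans (le_normcD _ _)) // lerD // (le_trans (le_normcD _ _)) // lerD.
Qed.

Definition cder_at S f z := exists d : C, forall e : R, 0 < e ->
  exists2 r : R, 0 < r & forall w, S w -> normc (w - z) <= r ->
    normc (f w - f z - d * (w - z)) <= e * normc (w - z).

(** The intervals [[lo j, hi j]] are nested because the steps k 2^-i from i = j on sum to 2 k 2^-j.
    The supremum of the left ends lies in all of them. *)
Lemma real_geometric_limit (x : nat -> R) (k : R) :
  (forall j, `|x j.+1 - x j| <= k * 2^-1 ^+ j) ->
  exists y, forall j, `|x j - y| <= 2 * k * 2^-1 ^+ j.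
Proof.
move=> H; pose lo j := x j - 2 * k * 2^-1 ^+ j; pose hi j := x j + 2 * k * 2^-1 ^+ j.
have k0 : 0 <= k by have := H 0%N; rewrite expr0 mulr1; apply: le_trans.
have p0 j : 0 <= k * 2^-1 ^+ j by rewrite mulr_ge0 // exprn_ge0.
have lo1 j : lo j <= lo j.+1.
  by rewrite /lo exprS; move: (H j); rewrite ler_norml => /andP[]; lra.
have hi1 j : hi j.+1 <= hi j.
  by rewrite /hi exprS; move: (H j); rewrite ler_norml => /andP[]; lra.
have loh j : lo j <= hi j by rewrite /lo /hi; move: (p0 j); lra.
have lom i j : (i <= j)%N -> lo i <= lo j.
  by move=> /subnK <-; elim: (_ - _)%N => // m; rewrite addSn => /le_trans -> //.
have him i j : (i <= j)%N -> hi j <= hi i.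
  by move=> /subnK <-; elim: (_ - _)%N => // m; rewrite addSn; apply: le_trans.
have lohi i j : lo i <= hi j.
  have [ij|/ltnW ji] := leqP i j; first exact: le_trans (lom _ _ ij) (loh _).
  exact: le_trans (loh _) (him _ _ ji).
exists (sup (range lo)) => j; rewrite ler_norml; apply/andP; split.
  rewrite lerBrDr addrC -lerBrDr opprK; apply: ge_sup; first by exists (lo 0), 0%N.
  by move=> _ [i _ <-]; exact: lohi.
rewrite lerBlDr addrC -lerBlDr; apply: ub_le_sup; last by exists j.
by exists (hi 0) => _ [i _ <-]; exact: lohi.
Qed.

Lemma geometric_limit (x : nat -> C) (k : R) :
  (forall j, normc (x j.+1 - x j) <= k * 2^-1 ^+ j) ->
  exists z, forall j, normc (x j - z) <= 4 * k * 2^-1 ^+ j.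
Proof.
move=> H.
have [u Hu] := @real_geometric_limit (fun j => complex.Re (x j)) k (fun j =>
  le_trans (le_trans (eq_ind _ (fun y => `|y| <= _) (normc_Re _) _
    (etrans (ReD _ _) (congr1 _ (ReN _)))) (lexx _)) (H j)).
have [v Hv] := @real_geometric_limit (fun j => complex.Im (x j)) k (fun j =>
  le_trans (le_trans (eq_ind _ (fun y => `|y| <= _) (normc_Im _) _
    (etrans (ImD _ _) (congr1 _ (ImN _)))) (lexx _)) (H j)).
exists (u +i* v) => j; rewrite (le_trans (normc_le_ReIm _)) //.
rewrite ReD ImD ReN ImN /=; move: (Hu j) (Hv j); lra.
Qed.

Lemma perim_ge a b c : [/\ 0 <= perim a b c, normc (b - a) <= perim a b c,
  normc (c - a) <= perim a b c & normc (c - b) <= perim a b c].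
Proof.
rewrite /perim (normcB a c).
by split; move: (normc_ge0 (b - a)) (normc_ge0 (c - b)) (normc_ge0 (c - a)); lra.
Qed.

Lemma perim_corner a b c : perim a (cmid a b) (cmid c a) = perim a b c / 2.
Proof.
rewrite /perim cmidBl (_ : cmid c a - cmid a b = (c - b) / 2); last first.
  by rewrite /cmid; field.
rewrite (_ : a - cmid c a = (a - c) / 2) ?normc_half; last by rewrite cmidBr.
by rewrite -!mulrDl.
Qed.

Lemma perim_cycle a b c : perim b c a = perim a b c.
Proof. by rewrite /perim addrC addrA. Qed.

Lemma perim_medial a b c : perim (cmid a b) (cmid b c) (cmid c a) = perim a b c / 2.
Proof.
rewrite /perim (_ : cmid b c - cmid a b = - ((a - c) / 2)); last first.
  by rewrite /cmid; field.
rewrite (_ : cmid c a - cmid b c = - ((b - a) / 2)); last first.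
  by rewrite /cmid; field.
rewrite (_ : cmid a b - cmid c a = - ((c - b) / 2)); last first.
  by rewrite /cmid; field.
by rewrite !normcN !normc_half -!mulrDl; congr (_ / _); ring.
Qed.

(* Goursat's bisection, carried out on trapezoid sums instead of contour integrals. *)
Lemma goursat f S a b c : mid_closed S ->
  (forall z, (forall e : R, 0 < e -> exists2 w, S w & normc (w - z) < e) -> S z) ->
  (forall z, S z -> cder_at S f z) -> S a -> S b -> S c ->
  forall e : R, 0 < e -> eventually_le f e a b c.
Proof.
move=> Sm Scl fS Sa Sb Sc e e0; apply: contrapT => bad0.
pose bad (e : R) (t : C * C * C) :=
  [/\ S t.1.1, S t.1.2, S t.2 & ~ eventually_le f e t.1.1 t.1.2 t.2].
pose pr (t : C * C * C) := perim t.1.1 t.1.2 t.2.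
(* One of the four quarter triangles must be bad for a quarter of the tolerance; otherwise the four
   bounds would add up to a bound for the whole triangle. *)
have step (u : R * (C * C * C)) : {v : R * (C * C * C) | bad u.1 u.2 ->
    [/\ bad v.1 v.2, v.1 = u.1 / 4, pr v.2 = pr u.2 / 2 &
      normc (v.2.1.1 - u.2.1.1) <= pr u.2]}.
  apply: cid; case: u => d [[x y] z] /=.
  have [B|] := pselect (bad d (x, y, z)); last by exists (d, (x, y, z)).
  have [/= Sx Sy Sz nB] := B.
  have Sxy := Sm _ _ Sx Sy; have Syz := Sm _ _ Sy Sz; have Szx := Sm _ _ Sz Sx.
  have [p0 p1 p2 p3] := perim_ge x y z.
  have [B1|/contrapT B1] := pselect (~ eventually_le f (d / 4) x (cmid x y) (cmid z x)).
    exists (d / 4, (x, cmid x y, cmid z x)) => _; split => //=.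
      exact: perim_corner.
    by rewrite subrr normc0.
  have [B2|/contrapT B2] := pselect (~ eventually_le f (d / 4) y (cmid y z) (cmid x y)).
    exists (d / 4, (y, cmid y z, cmid x y)) => _; split => //=.
    by rewrite /pr /= perim_corner perim_cycle.
  have [B3|/contrapT B3] := pselect (~ eventually_le f (d / 4) z (cmid z x) (cmid y z)).
    exists (d / 4, (z, cmid z x, cmid y z)) => _; split => //=.
    by rewrite /pr /= perim_corner 2!perim_cycle.
  exists (d / 4, (cmid x y, cmid y z, cmid z x)) => _; split => //=.
  - split => //= B4; apply: nB.
    rewrite (_ : d = d / 4 + d / 4 + d / 4 + d / 4); last by lra.
    exact: eventually_le_split.
  - exact: perim_medial.
  - by rewrite cmidBl normc_half /pr /=; move: p1; lra.
have [T [T0 TS]] := dependent_choice step (e, (a, b, c)).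
have HT k : [/\ bad (T k).1 (T k).2, (T k).1 = e * 4^-1 ^+ k &
    pr (T k).2 = perim a b c * 2^-1 ^+ k].
  elim: k => [|k [IH1 IH2 IH3]]; first by rewrite T0 !expr0 !mulr1.
  have [? E1 E2 _] := TS k IH1; split=> //; first by rewrite E1 IH2 exprSr mulrA.
  by rewrite E2 IH3 exprSr mulrA.
pose p := perim a b c.
have [z Hz] : exists z, forall j, normc ((T j).2.1.1 - z) <= 4 * p * 2^-1 ^+ j.
  apply: geometric_limit => j; have [B _ E] := HT j.
  by have [_ _ _] := TS j B; rewrite E.
have p0 : 0 <= p by have [] := perim_ge a b c.
have small (d : R) : 0 < d -> exists k, 5 * p * 2^-1 ^+ k <= d.
  move=> d0; have [k Hk] : exists k : nat, 5 * p / d <= k%:R.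
    by exists (Num.bound (5 * p / d)); apply/ltW/archi_boundP; rewrite divr_ge0 ?mulr_ge0 // ltW.
  exists k; rewrite exprVn ler_pdivrMr ?exprn_gt0 // [leRHS]mulrC -ler_pdivrMr //.
  by apply: le_trans Hk _; rewrite -natrX ler_nat ltnW // ltn_expl.
have Sz : S z.
  apply: Scl => d d0; have [k Hk] := small (d / 2) (divr_gt0 d0 (ltr0Sn _ _)).
  exists (T k).2.1.1; first by have [[]] := HT k.
  have : 0 <= p * 2^-1 ^+ k by rewrite mulr_ge0 // exprn_ge0.
  by move: (Hz k) Hk; lra.
have [d Hd] := fS _ Sz.
(* At stage k, with s = 2^-k, the triangle lies within 5 p s of [z] (4 p s from the limit, p s from
   its own size) and has perimeter p s. The error e1 (5 p s) (p s) must stay below the tolerance e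
   s^2; the summand 1 covers p = 0. *)
pose e1 := e / (5 * p ^+ 2 + 1).
have q0 : 0 < 5 * p ^+ 2 + 1 by rewrite ltr_wpDl // mulr_ge0 // sqr_ge0.
have [r r0 Hr] := Hd e1 (divr_gt0 e0 q0).
have [k Hk] := small r r0; have [[Sx Sy Sw nB] Ek Ep] := HT k; apply: nB.
move: Ek Ep (Hz k) Sx Sy Sw; case: (T k) => ek [[x y] w] /= -> Ep xz Sx Sy Sw.
exists 0%N => N _; set s := 2^-1 ^+ k in Ep xz Hk.
have s0 : 0 <= s by rewrite exprn_ge0.
have [_ xy xw _] := perim_ge x y w.
pose S' := [set v | S v /\ normc (v - z) <= 5 * p * s].
have S'm : mid_closed S'.
  move=> u v [Su uz] [Sv vz]; split; first exact: Sm.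
  rewrite (_ : cmid u v - z = (u - z + (v - z)) / 2); last first.
    by rewrite /cmid; field.
  rewrite normc_half; move: (le_normcD (u - z) (v - z)); lra.
rewrite /pr /= -/p in Ep.
have S'x : S' x by split=> //; move: xz (mulr_ge0 p0 s0); lra.
have near_x v : normc (v - x) <= p * s -> normc (v - z) <= 5 * p * s.
  move=> vx; rewrite -(subrKA x) (le_trans (le_normcD _ _)) //; move: vx xz; lra.
have S'y : S' y by split=> //; apply: near_x; rewrite -Ep.
have S'w : S' w by split=> //; apply: near_x; rewrite -Ep.
have E : tri f N x y w = tri (fun v => f v - ((f z - d * z) + d * v)) N x y w.
  by rewrite triB tri_affine subr0.
rewrite E (le_trans (@tri_bound _ S' (e1 * (5 * p * s)) N _ _ _ S'm S'x S'y S'w _)) //.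
  move=> v [Sv vz]; rewrite (_ : _ - _ = f v - f z - d * (v - z)); last by ring.
  rewrite (le_trans (Hr _ Sv (le_trans vz Hk))) // ler_wpM2l //.
  by rewrite divr_ge0 // ltW.
rewrite Ep (_ : _ * _ = e1 * (5 * p ^+ 2) * (s ^+ 2)); last by ring.
rewrite (_ : s ^+ 2 = 4^-1 ^+ k); last first.
  by rewrite /s exprAC; congr (_ ^+ _); field.
rewrite ler_wpM2r ?exprn_ge0 // /e1 mulrAC ler_pdivrMr // ler_pM2l //; lra.
Qed.
End Trapezoid.

(** * Cauchy estimates and the Schwarz lemma in one variable *)

Section Cauchy.
Context {R : realType}.
Local Notation C := (R[i]).
Implicit Types (f g : C -> C) (a b c z w d : C).

Lemma is_derive_cder f z d : is_derive z 1 f d -> forall e : R, 0 < e ->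
  exists2 r : R, 0 < r & forall w, normc (w - z) <= r ->
    normc (f w - f z - d * (w - z)) <= e * normc (w - z).
Proof.
move=> [/[swap] <- /[swap] e /[swap] e0 df].
have /(@cvg_nrP R C) /(_ e e0) := df.
rewrite /dnbhs near_withinE => /nbhs_nrP[r r0 Hr].
exists (r / 2) => [|w wz]; first by rewrite divr_gt0.
have [->|wz0] := eqVneq w z; first by rewrite !subrr mulr0 subr0 normc0 mulr0.
have wz1 : w - z != 0 by rewrite subr_eq0.
have := Hr (w - z); rewrite subr0 nr_normc => /(_ _ wz1).
rewrite nr_normc /= [_%:A]mulr1 subrK => /(_ _)/ltW H.
rewrite -ler_pdivrMr ?normc_gt0 // -normcV -normcM mulrBl mulfK //.
rewrite mulrC; apply: H; lra.
Qed.

Lemma derivable_cder_at f S z : derivable f z 1 -> cder_at S f z.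
Proof.
move=> /derivableP/is_derive_cder H; exists ('D_1 f z) => e /H[r r0 Hr].
by exists r => // w _; exact: Hr.
Qed.

Lemma is_derive_comp_field (K : numFieldType) (f g : K -> K) (z a b : K) :
  is_derive z 1 f a -> is_derive (f z) 1 g b -> is_derive z 1 (g \o f) (b * a).
Proof.
move=> [/derivable1_diffP df <-] [/derivable1_diffP dg <-].
have dgf : differentiable (g \o f) z by exact: differentiable_comp.
apply: DeriveDef; first exact/derivable1_diffP.
have E := congr1 (fun h : K -> K => h 1) (diff_comp df dg).
have L (c : K) : 'd g (f z) c = 'd g (f z) 1 * c.
  by rewrite -[c in LHS]mulr1 -[c * 1]/(c *: (1 : K^o)) linearZ mulrC.
by rewrite (deriveE _ df) (deriveE _ dg); exact: etrans (deriveE _ dgf) (etrans E (L _)).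
Qed.

Lemma is_derive_compC f g z a b : is_derive z 1 f a -> is_derive (f z) 1 g b ->
  is_derive z 1 (g \o f) (b * a).
Proof. exact: is_derive_comp_field. Qed.

Lemma is_derive_scale (k z : C) : is_derive z 1 (fun w : C => k * w) k.
Proof.
have H := is_deriveM (is_derive_cst k z (1 : C)) (is_derive_id z (1 : C)).
by apply: is_derive_eq H _; rewrite -![_ *: _]/(_ * _) /= mulr1 mulr0 addr0.
Qed.

(** The determinant of [z] and [w] as plane vectors, that is, twice the signed area of the triangle
    with vertices 0, [z], [w]. *)
Definition cross z w : R := complex.Re z * complex.Im w - complex.Im z * complex.Re w.

Lemma crossE z w : cross z w = complex.Im (conjc z * w).
Proof. by case: z => x y; case: w => u v; rewrite /cross /=; ring. Qed.

Lemma cross_le z w : cross z w <= normc z * normc w.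
Proof.
rewrite crossE (le_trans (ler_norm _)) // (le_trans (normc_Im _)) // normcM.
by rewrite (_ : normc (conjc z) = normc z) //; case: z => x y /=; rewrite sqrrN.
Qed.

Lemma crossDl z1 z2 w : cross (z1 + z2) w = cross z1 w + cross z2 w.
Proof. by rewrite /cross ReD ImD; ring. Qed.

Lemma crossDr z w1 w2 : cross z (w1 + w2) = cross z w1 + cross z w2.
Proof. by rewrite /cross ReD ImD; ring. Qed.

Lemma crossNr z w : cross z (- w) = - cross z w.
Proof. by rewrite /cross ReN ImN; ring. Qed.

Lemma crossNl z w : cross (- z) w = - cross z w.
Proof. by rewrite /cross ReN ImN; ring. Qed.

Lemma crossC z w : cross z w = - cross w z.
Proof. by rewrite /cross; ring. Qed.

Lemma crosszz z : cross z z = 0.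
Proof. by rewrite /cross; ring. Qed.

Lemma halfE z : z / 2 = (2^-1 : R)%:C * z.
Proof. by rewrite mulrC fmorphV rmorph_nat. Qed.

Lemma Re_half z : complex.Re (z / 2) = complex.Re z / 2.
Proof. by rewrite halfE; case: z => x y /=; ring. Qed.

Lemma Im_half z : complex.Im (z / 2) = complex.Im z / 2.
Proof. by rewrite halfE; case: z => x y /=; ring. Qed.

Lemma cross_halfl z w : cross (z / 2) w = cross z w / 2.
Proof. by rewrite /cross Re_half Im_half; ring. Qed.

Lemma cross_halfr z w : cross z (w / 2) = cross z w / 2.
Proof. by rewrite /cross Re_half Im_half; ring. Qed.

Lemma mid_closed_disc_cross (r k : R) w :
  mid_closed [set z | normc z <= r /\ k <= cross z w].
Proof.
move=> a b [ar ak] [br bk]; split.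
  rewrite /cmid normc_half; move: (le_normcD a b); lra.
by rewrite /cmid cross_halfl crossDl; lra.
Qed.

Lemma cross_gt0_neq0 z w : 0 < cross z w -> z != 0.
Proof. by apply: contraTneq => ->; rewrite /cross !mul0r subrr ltxx. Qed.

Lemma Im_div z w : complex.Im (z / w) = cross w z / normc w ^+ 2.
Proof.
rewrite normc_sqr; case: z => x y; case: w => u v; rewrite /cross /=.
by rewrite [RHS]mulrBl; ring.
Qed.

(** A lower bound that replaces the value 2 pi i of the integral of 1/z around 0. A single trapezoid
    contributes (b/a - a/b)/2, whose imaginary part is the mean of [cross a b / normc x ^+ 2] over
    the two end points; [cross] is halved on each half of the edge, so the bound is additive under
    subdivision. *)
Lemma edge_inv_Im (r : R) N a b : 0 < cross a b -> normc a <= r -> normc b <= r ->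
  cross a b / r ^+ 2 <= complex.Im (edge (fun z => z^-1) N a b).
Proof.
elim: N a b => [|N IH] a b ab ar br /=.
  have a0 : a != 0 := cross_gt0_neq0 ab.
  have b0 : b != 0 by apply: (@cross_gt0_neq0 _ (- a)); rewrite crossNr crossC opprK.
  rewrite (_ : _ * _ = (b / a - a / b) / 2); last by field; rewrite a0 b0.
  rewrite Im_half ImD ImN !Im_div (crossC b a).
  have H x : x != 0 -> normc x <= r -> cross a b / r ^+ 2 <= cross a b / normc x ^+ 2.
    move=> x0 xr; rewrite ler_pM2l // lef_pV2 ?posrE ?exprn_gt0 ?normc_gt0 //.
      by rewrite lerXn2r ?nnegrE ?normc_ge0 // (le_trans _ xr) ?normc_ge0.
    by rewrite (lt_le_trans _ xr) // normc_gt0.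
  by move: (H a a0 ar) (H b b0 br); lra.
have E1 : cross a (cmid a b) = cross a b / 2.
  by rewrite /cmid cross_halfr crossDr crosszz add0r.
have E2 : cross (cmid a b) b = cross a b / 2.
  by rewrite /cmid cross_halfl crossDl crosszz addr0.
have mr : normc (cmid a b) <= r.
  rewrite /cmid normc_half; move: (le_normcD a b); lra.
have p1 : 0 < cross a (cmid a b) by rewrite E1 divr_gt0.
have p2 : 0 < cross (cmid a b) b by rewrite E2 divr_gt0.
by rewrite ImD; move: (IH _ _ p1 ar mr) (IH _ _ p2 mr br); rewrite E1 E2; lra.
Qed.

(** The condition on [z] describes the closed half-plane bounded by the line through [a] and [b]
    that misses 0, and [cross a b / normc (b - a)] is the distance from 0 to that line. *)
Lemma segment_far (a b z : C) : 0 < cross a b -> cross a b <= cross z (b - a) ->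
  cross a b <= normc z * normc (b - a) /\ 0 < normc z.
Proof.
move=> ab zab; have H := le_trans zab (cross_le _ _); split=> //.
by rewrite normc_gt0; apply: (@cross_gt0_neq0 _ (b - a)); exact: lt_le_trans zab.
Qed.

Lemma edge_away (r k m : R) g N a b : 0 < cross a b -> normc a <= r -> normc b <= r ->
  (forall z, 0 < normc z -> normc z <= r -> cross a b <= normc z * normc (b - a) ->
    normc (g z) <= m) ->
  normc (edge g N a b) <= m * normc (b - a).
Proof.
move=> ab ar br gm.
apply: (edge_bound (S := [set z | normc z <= r /\ cross a b <= cross z (b - a)])).
- exact: mid_closed_disc_cross.
- by split=> //; rewrite crossDr crossNr crosszz subr0.
- by split=> //; rewrite crossDr crossNr crosszz add0r -crossC.
- by move=> z [zr /(segment_far ab)[? ?]]; exact: gm.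
Qed.

Lemma cross_sum0 a b c : a + b + c = 0 -> cross b c = cross a b /\ cross c a = cross a b.
Proof.
move=> /eqP; rewrite addr_eq0 => /eqP/(congr1 -%R); rewrite opprK => <-.
rewrite crossNr crossNl crossDr crossDl !crosszz (crossC b a); split; ring.
Qed.

Lemma normcB_le2 a b (r : R) : normc a <= r -> normc b <= r -> normc (b - a) <= 2 * r.
Proof. by move=> ar br; have := le_normcD b (- a); rewrite normcN; lra. Qed.

(** On the edge |z| is at least the distance of its line from 0, so the bound [h] on |g(z)| |z|
    yields h |b - a|^2 / [cross a b]. Then |b - a| <= 2 r and the fatness [t] of the triangle give 4
    h / t. *)
Lemma central_edge (r t h : R) g N a b : 0 < r -> 0 < t -> normc a <= r -> normc b <= r ->
  t * r ^+ 2 <= cross a b ->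
  (forall z, z != 0 -> normc z <= r -> normc (g z) * normc z <= h) ->
  normc (edge g N a b) <= 4 * h / t.
Proof.
move=> r0 t0 ar br tr gh.
have tr0 : 0 < t * r ^+ 2 by rewrite mulr_gt0 // exprn_gt0.
have ab : 0 < cross a b by exact: lt_le_trans tr.
have l0 := normc_ge0 (b - a).
have l2 := normcB_le2 ar br.
have h0 : 0 <= h.
  have a0 : a != 0 := cross_gt0_neq0 ab.
  by apply: le_trans (gh _ a0 ar); rewrite mulr_ge0 ?normc_ge0.
apply: (@le_trans _ _ (h * normc (b - a) / cross a b * normc (b - a))).
  apply: edge_away ar br _ => // z z0 zr H; rewrite ler_pdivlMr //.
  have zn : z != 0 by rewrite -normc_gt0.
  apply: le_trans (ler_wpM2r l0 (gh _ zn zr)).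
  by rewrite -mulrA ler_wpM2l ?normc_ge0.
rewrite ler_pdivlMr // (_ : _ * t = h * (normc (b - a) * normc (b - a) * t) / cross a b); last by ring.
rewrite ler_pdivrMr // [leRHS](_ : _ = h * (4 * cross a b)); last by ring.
rewrite ler_wpM2l //; apply: (@le_trans _ _ ((2 * r) * (2 * r) * t)); last by lra.
by rewrite ler_pM2r //; apply: ler_pM.
Qed.

Lemma central_small (r t h : R) g N a b c : a + b + c = 0 -> 0 < r -> 0 < t ->
  normc a <= r -> normc b <= r -> normc c <= r -> t * r ^+ 2 <= cross a b ->
  (forall z, z != 0 -> normc z <= r -> normc (g z) * normc z <= h) ->
  normc (tri g N a b c) <= 12 * h / t.
Proof.
move=> abc r0 t0 ar br cr tr gh; have [Eb Ec] := cross_sum0 abc.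
have e1 := central_edge N r0 t0 ar br tr gh.
have e2 : normc (edge g N b c) <= 4 * h / t by apply: central_edge gh => //; rewrite Eb.
have e3 : normc (edge g N c a) <= 4 * h / t by apply: central_edge gh => //; rewrite Ec.
rewrite /tri (le_trans (le_normcD _ _)) // (_ : 12 * h / t = 4 * h / t + 4 * h / t + 4 * h / t).
  by rewrite lerD // (le_trans (le_normcD _ _)) // lerD.
by lra.
Qed.

(** When the centroid is 0, the corner triangle at [a] lies in a half-plane missing 0, so the
    singularity of the Cauchy kernel stays out of it. *)
Lemma cross_corner a b c : a + b + c = 0 -> 0 < cross a b ->
  [/\ cross a b / 2 <= cross a (b - c), cross a b / 2 <= cross (cmid a b) (b - c)
    & cross a b / 2 <= cross (cmid c a) (b - c)].
Proof.
move=> abc ab; have [Eb Ec] := cross_sum0 abc.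
rewrite /cmid !cross_halfl !crossDl !crossDr !crossNr !crosszz (crossC c b) (crossC a c) Eb Ec.
by split; lra.
Qed.

Lemma corner_goursat (r : R) g a b c : a + b + c = 0 -> 0 < cross a b ->
  normc a <= r -> normc b <= r -> normc c <= r ->
  (forall z, z != 0 -> normc z <= r -> derivable g z 1) ->
  forall e : R, 0 < e -> eventually_le g e a (cmid a b) (cmid c a).
Proof.
move=> abc ab ar br cr dg.
have [s1 s2 s3] := cross_corner abc ab.
have mr x y : normc x <= r -> normc y <= r -> normc (cmid x y) <= r.
  by rewrite /cmid normc_half => xr yr; have := le_normcD x y; lra.
apply: (goursat (S := [set z | normc z <= r /\ cross a b / 2 <= cross z (b - c)])).
- exact: mid_closed_disc_cross.
- move=> z H.
  pose L := normc (b - c) + 1; have L0 : 0 < L by rewrite ltr_wpDl ?normc_ge0.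
  split; apply/ler_addgt0Pr => e e0.
    have [w [wr _] wz] := H _ e0; have := le_normcD w (z - w).
    by rewrite addrC subrK normcB; lra.
  have [w [_ wr] wz] := H _ (divr_gt0 e0 L0).
  have := cross_le (w - z) (b - c); rewrite crossDl crossNl.
  have : normc (w - z) * normc (b - c) <= e.
    apply: (@le_trans _ _ (e / L * L)); last by rewrite divfK ?gt_eqF.
    by rewrite ler_pM ?normc_ge0 ?ltW // /L ltrDl.
  by move: wr; lra.
- move=> z [zr zc]; apply: derivable_cder_at; apply: dg => //.
  by apply: (@cross_gt0_neq0 _ (b - c)); apply: lt_le_trans zc; rewrite divr_gt0.
- by split.
- by split=> //; exact: mr.
- by split=> //; exact: mr.
Qed.

(** Bisection isolates the singularity at 0. The three corner triangles avoid it; the medial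
    triangle is the original one scaled by -1/2, hence again centred at 0 with the same fatness [t].
    After [k] rounds it is so small that the bound on |g(z)| |z| takes over. *)
Lemma central_goursat k (r t h : R) g a b c : a + b + c = 0 -> 0 < r -> 0 < t ->
  normc a <= r -> normc b <= r -> normc c <= r -> t * r ^+ 2 <= cross a b ->
  (forall z, z != 0 -> normc z <= r -> derivable g z 1) ->
  (forall z, z != 0 -> normc z <= r / 2 ^+ k -> normc (g z) * normc z <= h) ->
  forall e : R, 0 < e -> eventually_le g (12 * h / t + e) a b c.
Proof.
elim: k r a b c => [|k IH] r a b c abc r0 t0 ar br cr tr dg gh e e0.
  exists 0%N => N _; apply: (@le_trans _ _ (12 * h / t)); last by lra.
  by apply: central_small tr _ => // z z0; have := gh z z0; rewrite expr0 divr1.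
have ab : 0 < cross a b by apply: lt_le_trans tr; rewrite mulr_gt0 // exprn_gt0.
have e4 : 0 < e / 4 by rewrite divr_gt0.
have [Eb Ec] := cross_sum0 abc.
have bca : b + c + a = 0 by rewrite -abc; ring.
have cab : c + a + b = 0 by rewrite -abc; ring.
rewrite (_ : 12 * h / t + e = e / 4 + e / 4 + e / 4 + (12 * h / t + e / 4)); last by lra.
apply: eventually_le_split.
- exact: corner_goursat dg _ e4.
- by apply: corner_goursat bca _ br cr ar dg _ e4; rewrite Eb.
- by apply: corner_goursat cab _ cr ar br dg _ e4; rewrite Ec.
have half x y z : x + y + z = 0 -> cmid x y = - (z / 2).
  by move=> /eqP; rewrite addr_eq0 /cmid => /eqP ->; rewrite mulNr.
rewrite (half _ _ _ abc) (half _ _ _ bca) (half _ _ _ cab).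
have hr x : normc x <= r -> normc (- (x / 2)) <= r / 2.
  by rewrite normcN normc_half; lra.
apply: (IH (r / 2)) => //; try exact: hr.
- by rewrite -[RHS]oppr0 -(mul0r 2^-1) -abc; field.
- by rewrite divr_gt0.
- rewrite crossNl crossNr opprK cross_halfl cross_halfr Ec expr_div_n; lra.
- by move=> z z0 zr; apply: dg => //; lra.
- by move=> z z0 zr; apply: gh => //; rewrite exprS invfM mulrA.
Qed.

(** Cauchy's formula for the derivative at 0. For g = f/z^2 - d/z the product z g(z) tends to 0, so
    the closed sums of g become arbitrarily small and d times the sum of 1/z is close to the sum of
    f/z^2. The sum of 1/z has modulus at least 3/2, that of f/z^2 at most 192 M, and 192 / (3/2) =
    128. *)
Lemma cauchy_weak0 f d (M : R) : (forall z, normc z < 1 -> derivable f z 1) ->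
  (forall z, normc z < 1 -> normc (f z) <= M) -> is_derive (0 : C) 1 f d -> f 0 = 0 ->
  normc d <= 128 * M.
Proof.
move=> df fM d0 f00.
have M0 : 0 <= M by apply: le_trans (normc_ge0 _) (fM 0 _); rewrite normc0 ltr01.
pose s : R := 4^-1; have s4 : 4 * s = 1 by rewrite /s mulfV.
(* A triangle centred at 0 inside |z| <= 1/2 with [cross a b] equal to 1/8. Its edges have length at
   most 1, so they stay at distance at least 1/8 from 0 and 1/|z|^2 <= 64 on them. *)
pose a : C := (- s) +i* (- s); pose b : C := s +i* (- s); pose c : C := 0 +i* (2 * s).
have abc : a + b + c = 0 by apply/eqP; rewrite eq_complex /=; apply/andP; split; apply/eqP; ring.
have ab : cross a b = 8^-1 by rewrite /cross /a /b /s /=; field.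
have [Eb Ec] := cross_sum0 abc; rewrite ab in Eb Ec.
have nr_half (z : C) : complex.Re z ^+ 2 + complex.Im z ^+ 2 <= 2^-1 ^+ 2 -> normc z <= 2^-1.
  by rewrite -normc_sqr => H; rewrite -(@ler_pXn2r _ 2) ?nnegrE ?normc_ge0.
have ss : s ^+ 2 = 16^-1 by rewrite /s; lra.
have ar : normc a <= 2^-1 by apply: nr_half; rewrite /= sqrrN; lra.
have br : normc b <= 2^-1 by apply: nr_half; rewrite /= sqrrN; lra.
have cr : normc c <= 2^-1 by apply: nr_half; rewrite /= exprMn; lra.
pose g z := f z / z ^+ 2 - d * z^-1.
have gE z : z != 0 -> g z = (f z - d * z) / z ^+ 2 by move=> z0; rewrite /g; field.
have dg z : z != 0 -> normc z <= 2^-1 -> derivable g z 1.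
  move=> z0 zr; have dz : derivable (@id C) z 1 by exact: derivable_id.
  apply: derivableB; last first.
    by apply: derivableM; [exact: derivable_cst|exact: derivableV].
  apply: derivableM; first by apply: df; lra.
  apply: (@derivableV _ _ (fun z => z ^+ 2)); first by rewrite expf_neq0.
  exact: exprn_derivable.
have Mle e : 0 < e -> normc d * (3 / 2) <= 192 * M + e.
  (* With fatness t = 1/2 the bound 12 h / t of [central_goursat] equals e / 2. *)
  move=> e0; pose h := e / 48; have h0 : 0 < h by rewrite divr_gt0.
  have [r r0 Hr] := is_derive_cder d0 h0.
  have [k Hk] : exists k, 2^-1 / 2 ^+ k <= r.
    exists (Num.bound r^-1); rewrite ler_pdivrMr ?exprn_gt0 // mulrC -ler_pdivrMr //.
    apply: (@le_trans _ _ r^-1); first by rewrite ler_piMl ?invr_ge0 ?ltW //; lra.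
    have := @archi_boundP _ r^-1; rewrite invr_ge0 => /(_ (ltW r0))/ltW/le_trans; apply.
    by rewrite -natrX ler_nat ltnW // ltn_expl.
  have : eventually_le g (12 * h / 2^-1 + e / 2) a b c.
    apply: (@central_goursat k 2^-1) => //; first by rewrite ab; lra.
      move=> z z0 zr; rewrite gE // normcM normcV normcX.
      have := Hr z; rewrite subr0 f00 subr0 => /(_ (le_trans zr Hk)).
      have zp : 0 < normc z by rewrite normc_gt0.
      move=> H; rewrite expr2 invfM mulrA mulfVK ?gt_eqF //.
      by rewrite ler_pdivrMr.
    by rewrite divr_gt0.
  move=> [N0 /(_ N0 (leqnn _))]; rewrite (_ : 12 * h / _ + _ = e); last by rewrite /h; lra.
  rewrite /g triB (triZ d) => H.
  have l1 (x y : C) : normc x <= 2^-1 -> normc y <= 2^-1 -> normc (y - x) <= 1.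
    by move=> xr yr; have := normcB_le2 xr yr; lra.
  have T1 (x y : C) : normc x <= 2^-1 -> normc y <= 2^-1 -> cross x y = 8^-1 ->
      normc (edge (fun z => f z / z ^+ 2) N0 x y) <= 64 * M.
    move=> xr yr xy; apply: (@le_trans _ _ (64 * M * normc (y - x))).
      apply: (@edge_away 2^-1 1) => //; first by rewrite xy; lra.
      move=> z z0 zr; rewrite xy => H8; rewrite normcM normcV normcX.
      rewrite ler_pdivrMr ?exprn_gt0 //.
      have z8 : 8^-1 <= normc z.
        by apply: le_trans H8 _; rewrite ler_piMr ?normc_ge0 ?l1.
      apply: le_trans (fM z _) _; first lra.
      rewrite mulrAC ler_peMl //; have := @lerXn2r R 2 8^-1 (normc z).
      by rewrite !nnegrE => /(_ _ _ z8); rewrite ?normc_ge0; lra.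
    by rewrite ler_piMr ?l1 ?mulr_ge0.
  have T : normc (tri (fun z => f z / z ^+ 2) N0 a b c) <= 192 * M.
    rewrite /tri (le_trans (le_normcD _ _)) // (_ : 192 * M = 64 * M + 64 * M + 64 * M); last lra.
    by rewrite lerD ?T1 // (le_trans (le_normcD _ _)) // lerD ?T1.
  have I : 3 / 2 <= normc (tri (fun z => z^-1) N0 a b c).
    apply: le_trans (le_trans (ler_norm _) (normc_Im _)); rewrite /tri !ImD.
    have I1 (x y : C) : normc x <= 2^-1 -> normc y <= 2^-1 -> cross x y = 8^-1 ->
        2^-1 <= complex.Im (edge (fun z => z^-1) N0 x y).
      move=> xr yr xy; have := @edge_inv_Im 2^-1 N0 x y; rewrite xy.
      by move=> /(_ _ xr yr); lra.
    by move: (I1 _ _ ar br ab) (I1 _ _ br cr Eb) (I1 _ _ cr ar Ec); lra.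
  apply: (@le_trans _ _ (normc (d * tri (fun z => z^-1) N0 a b c))).
    by rewrite normcM ler_wpM2l ?normc_ge0.
  rewrite normcB in H; have := le_normcB (d * tri (fun z => z^-1) N0 a b c)
    (tri (fun z => f z / z ^+ 2) N0 a b c).
  by lra.
have : normc d * (3 / 2) <= 192 * M by apply/ler_addgt0Pr.
by lra.
Qed.

(** Subtracting the constant f(0) doubles the bound on [f], so 128 becomes 256. *)
Lemma cauchy_weak : exists2 K : R, 0 < K & forall f d (M : R),
  (forall z, normc z < 1 -> derivable f z 1) ->
  (forall z, normc z < 1 -> normc (f z) <= M) -> is_derive (0 : C) 1 f d ->
  normc d <= K * M.
Proof.
exists 256; first by rewrite ltr0n.
move=> f d M df fM d0.
have dc z : derivable (cst (f 0) : C -> C) z 1 by exact: derivable_cst.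
suff : normc d <= 128 * (2 * M) by lra.
apply: (@cauchy_weak0 (f \- cst (f 0))).
- by move=> z z1; apply: derivableB => //; exact: df.
- move=> z z1; rewrite /= (le_trans (le_normcD _ _)) // normcN.
  by have := fM z z1; have := fM 0; rewrite normc0 ltr01 => /(_ isT); lra.
- by rewrite -[d]subr0; apply: is_deriveB.
- by rewrite /= subrr.
Qed.

(* The constant in [cauchy_weak] disappears when it is applied to the iterates of [f]. *)
Lemma schwarz_derive f d : (forall z, normc z < 1 -> derivable f z 1) ->
  (forall z, normc z < 1 -> normc (f z) < 1) -> is_derive (0 : C) 1 f d -> f 0 = 0 ->
  normc d <= 1.
Proof.
move=> df f1 d0 f0.
have it1 k z : normc z < 1 -> normc (iter k f z) < 1.
  by move=> z1; elim: k => //= k; exact: f1.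
have it0 k : iter k f 0 = 0 by elim: k => //= k ->.
have dit k z : normc z < 1 -> derivable (iter k f) z 1.
  move=> z1; elim: k => [|k IH]; first exact: derivable_id.
  have /derivableP H1 := IH; have /derivableP H2 := df _ (it1 k z z1).
  by have [] := is_derive_compC H1 H2.
have d0it k : is_derive (0 : C) 1 (iter k f) (d ^+ k).
  elim: k => [|k IH]; first by rewrite expr0; exact: is_derive_id.
  by rewrite exprS; apply: (@is_derive_compC (iter k f) f); rewrite ?it0.
have [K K0 HK] := cauchy_weak.
have B k : normc d ^+ k <= K.
  rewrite -normcX -[K]mulr1; apply: HK (d0it k) => z z1; first exact: dit.
  exact/ltW/it1.
rewrite leNgt; apply/negP => d1.
pose x := normc d - 1; have x0 : 0 < x by rewrite /x subr_gt0.
have bern k : 1 + k%:R * x <= normc d ^+ k.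
  elim: k => [|k IH]; first by rewrite mul0r addr0 expr0.
  rewrite exprS (_ : normc d = 1 + x); last by rewrite /x; ring.
  rewrite -natr1 mulrDl mul1r; rewrite (_ : normc d = 1 + x) in IH; last by rewrite /x; ring.
  apply: le_trans (ler_wpM2l _ IH); last by lra.
  have H : 0 <= k%:R * x * x by rewrite !mulr_ge0 // ltW.
  lra.
have := @archi_boundP _ (K / x); rewrite divr_ge0 ?(ltW x0) ?(ltW K0) // => /(_ isT).
rewrite ltr_pdivrMr // => H; have := le_trans (bern (Num.bound (K / x))) (B _); lra.
Qed.

Lemma cauchy_constant_exists : exists C0 : R, 0 < C0 /\
  forall f z0 d (M r : R), 0 < r ->
  (forall z, normc (z - z0) < r -> derivable f z 1) ->
  (forall z, normc (z - z0) < r -> normc (f z) <= M) -> is_derive z0 1 f d ->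
  normc d <= C0 * M / r.
Proof.
have [K K0 HK] := cauchy_weak; exists K; split=> // f z0 d M r r0 df fM d0.
pose l (z : C) := z0 + r%:C * z.
have dl z : is_derive z 1 l r%:C.
  rewrite -[X in is_derive _ _ _ X]add0r; apply: is_deriveD.
  exact: is_derive_scale.
have lz z : normc z < 1 -> normc (l z - z0) < r.
  rewrite /l addrAC subrr add0r normcM normc_real gtr0_norm // => z1.
  by rewrite gtr_pMr.
have l0 : l 0 = z0 by rewrite /l mulr0 addr0.
rewrite ler_pdivlMr //.
rewrite -[X in _ * X](gtr0_norm r0) -normc_real -normcM.
apply: (HK (f \o l)).
- move=> z /lz H; have /derivableP H2 := df _ H.
  by have [] := is_derive_compC (dl z) H2.
- by move=> z /lz; exact: fM.
- by apply: is_derive_compC => //; rewrite l0.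
Qed.

(** Kept abstract: later estimates see it only through its positivity and [cauchy_disc]. *)
Definition cauchy_constant : R := projT1 (cid cauchy_constant_exists).

Lemma cauchy_constant_gt0 : 0 < cauchy_constant.
Proof. by rewrite /cauchy_constant; case: cid => ? []. Qed.

Lemma cauchy_disc f z0 d (M r : R) : 0 < r ->
  (forall z, normc (z - z0) < r -> derivable f z 1) ->
  (forall z, normc (z - z0) < r -> normc (f z) <= M) -> is_derive z0 1 f d ->
  normc d <= cauchy_constant * M / r.
Proof. by rewrite /cauchy_constant; case: cid => ? [? H]; exact: H. Qed.

(** Schwarz's lemma after the Cayley transform u -> (u - w)/(u + conj w), which carries the right
    half-plane to the disc and w = f(0) to 0, with derivative 1/(2 Re w) at w. The constant 2 is
    sharp and is the origin of the factor 1/2 in the lower bound. *)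
Lemma halfplane_derive f d (r : R) : 0 < r ->
  (forall z, normc z < r -> derivable f z 1) ->
  (forall z, normc z < r -> 0 < complex.Re (f z)) -> is_derive (0 : C) 1 f d ->
  normc d <= 2 * complex.Re (f 0) / r.
Proof.
move=> r0 df fr d0; pose w := f 0.
pose l (z : C) := r%:C * z.
have dl z : is_derive z 1 l r%:C by exact: is_derive_scale.
have lz z : normc z < 1 -> normc (l z) < r.
  by rewrite /l normcM normc_real gtr0_norm // => z1; rewrite gtr_pMr.
have w0 : 0 < complex.Re w by apply: fr; rewrite normc0.
have den (u : C) : 0 < complex.Re u -> u + conjc w != 0.
  move=> u0; apply: contraTneq (addr_gt0 u0 w0) => H.
  have : complex.Re (u + conjc w) = 0 by rewrite H.
  by rewrite ReD; case: (w) => ? ? /= ->; rewrite ltxx.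
pose m (u : C) := (u - w) / (u + conjc w).
have dm u : 0 < complex.Re u -> is_derive u 1 m ((w + conjc w) / (u + conjc w) ^+ 2).
  move=> u0; have du := den u u0.
  have i1 : is_derive u 1 (fun v : C => v - w) (1 - 0) by apply: is_deriveB.
  have i2 : is_derive u 1 (fun v : C => v + conjc w) (1 + 0) by apply: is_deriveD.
  have i3 : is_derive u 1 (fun v : C => (v + conjc w)^-1)
      (- (u + conjc w) ^- 2 *: (1 + 0)).
    apply: DeriveDef; first by apply: derivableV => //; case: i2.
    by rewrite (@deriveV _ _ (fun v => v + conjc w)) //; case: i2 => // _ ->.
  have i4 := is_deriveM i1 i3.
  apply: is_derive_eq i4 _; rewrite -![_ *: _]/(_ * _) /=.
  by field.
pose g := m \o (f \o l).
suff : normc (r%:C * d / (w + conjc w)) <= 1.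
  have -> : w + conjc w = (2 * complex.Re w)%:C.
    by apply/eqP; rewrite eq_complex; case: (w) => x y /=; apply/andP; split; apply/eqP; ring.
  have w2 : 0 < 2 * complex.Re w by rewrite mulr_gt0.
  rewrite !normcM normcV !normc_real !gtr0_norm // ler_pdivrMr // mul1r.
  by rewrite ler_pdivlMr // mulrC.
have dg z : normc z < 1 -> derivable g z 1.
  move=> /lz H; have /derivableP H2 := df _ H.
  by have [] := is_derive_compC (is_derive_compC (dl z) H2) (dm _ (fr _ H)).
apply: (@schwarz_derive g) => //.
- move=> z /lz H; rewrite /g /=; move: (f _) (fr _ H) => u u0.
  rewrite /m normcM normcV ltr_pdivrMr ?normc_gt0 ?den // mul1r.
  rewrite -(@ltr_pXn2r _ 2) ?nnegrE ?normc_ge0 // !normc_sqr !ReD !ImD ReN ImN.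
  case: (w) w0 u0 => x y; case: (u) => p q /= x0 p0.
  by have := mulr_gt0 x0 p0; lra.
- have l0 : l 0 = 0 by rewrite /l mulr0.
  have fl : is_derive (0 : C) 1 (f \o l) (d * r%:C) by apply: is_derive_compC => //; rewrite l0.
  have := is_derive_compC fl; rewrite /= l0 => /(_ _ _ (dm _ w0)).
  have ww := den w w0.
  by move=> H; apply: is_derive_eq H _; field.
- by rewrite /g /m /= /l mulr0 subrr mul0r.
Qed.
End Cauchy.

Arguments cauchy_constant : clear implicits.
Arguments cauchy_constant_gt0 : clear implicits.

(** * Derivatives along real curves, and Cauchy estimates in several variables *)

Section RealDerivative.
Context {R : realType}.

(** The parameter is real while the scalars of [V] are complex, so the increment acts through its
    image in [R[i]]. [rderivP] ties this notion to [velocity]. *)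
Definition rderiv (V : normedModType R[i]) (h : R -> V) (t : R) (v : V) :=
  forall e : R, 0 < e -> exists2 r : R, 0 < r & forall s, `|s - t| <= r ->
    nr (h s - h t - (s - t)%:C *: v) <= e * `|s - t|.

Lemma is_deriveRP (u : R -> R) (t d : R) : is_derive t 1 u d <->
  forall e : R, 0 < e -> exists2 r : R, 0 < r & forall s, `|s - t| <= r ->
    `|u s - u t - d * (s - t)| <= e * `|s - t|.
Proof.
split=> [[df dfd] e e0|H].
  move/cvgrPdist_lt : df => /(_ e e0); rewrite -/('D_1 u t) dfd.
  rewrite /dnbhs near_withinE => -[r /= r0 Hr].
  exists (r / 2) => [|s st]; first by rewrite divr_gt0.
  have [->|st0] := eqVneq s t; first by rewrite !subrr mulr0 subr0 normr0 mulr0.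
  have st1 : s - t != 0 by rewrite subr_eq0.
  have := Hr (s - t); rewrite /= sub0r normrN => /(_ _ st1) H.
  rewrite -ler_pdivrMr ?normr_gt0 // -normfV -normrM mulrBl mulfK //.
  rewrite distrC mulrC; apply/ltW.
  by have := H _; rewrite [_%:A]mulr1 subrK; apply; lra.
have L : (fun h => h^-1 *: ((u \o shift t) (h *: 1) - u t)) @ 0^' --> d.
  apply/cvgrPdist_le => e e0; have [r r0 Hr] := H _ e0.
  rewrite /dnbhs near_withinE; exists r => //= h; rewrite /= sub0r normrN => hr h0.
  have := Hr (h + t); rewrite addrK [_%:A]mulr1 => /(_ (ltW hr)) B.
  rewrite /= distrC -(@ler_pM2r _ `|h|) ?normr_gt0 // -normrM mulrBl.
  by rewrite -[_ *: _]/(_ * _) mulrAC mulVf // mul1r.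
by apply: DeriveDef; [apply/cvg_ex; exists d|exact: cvg_lim].
Qed.

Lemma ReZ (a : R) (z : R[i]) : complex.Re (a%:C *: z) = a * complex.Re z.
Proof. by case: z => x y /=; rewrite mul0r subr0. Qed.

Lemma ImZ (a : R) (z : R[i]) : complex.Im (a%:C *: z) = a * complex.Im z.
Proof. by case: z => x y /=; rewrite mul0r addr0. Qed.

Lemma rderiv_Re (h : R -> R[i]) t v :
  rderiv h t v -> is_derive t 1 (@complex.Re R \o h) (complex.Re v).
Proof.
move=> H; apply/is_deriveRP => e /H[r r0 Hr]; exists r => // s /Hr.
rewrite nr_normc; apply: le_trans; apply: le_trans (normc_Re _).
by rewrite /= !(ReD, ReN) ReZ mulrC.
Qed.

Lemma rderiv_Im (h : R -> R[i]) t v :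
  rderiv h t v -> is_derive t 1 (@complex.Im R \o h) (complex.Im v).
Proof.
move=> H; apply/is_deriveRP => e /H[r r0 Hr]; exists r => // s /Hr.
rewrite nr_normc; apply: le_trans; apply: le_trans (normc_Im _).
by rewrite /= !(ImD, ImN) ImZ mulrC.
Qed.

Lemma rderiv_ReIm (h : R -> R[i]) (t : R) v :
  is_derive t (1 : R) (@complex.Re R \o h) (complex.Re v) ->
  is_derive t 1 (@complex.Im R \o h) (complex.Im v) -> rderiv h t v.
Proof.
move=> /is_deriveRP H1 /is_deriveRP H2 e e0.
have e2 : 0 < e / 2 by rewrite divr_gt0.
have [r1 r10 K1] := H1 _ e2; have [r2 r20 K2] := H2 _ e2.
exists (Num.min r1 r2) => [|s]; first by rewrite lt_min r10.
rewrite le_min => /andP[/K1 {}K1 /K2 {}K2]; rewrite nr_normc.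
apply: le_trans (normc_le_ReIm _) _.
rewrite !(ReD, ReN, ImD, ImN) ReZ ImZ ![(s - t) * _]mulrC.
move: K1 K2 => /=; lra.
Qed.

Lemma segment_shift (K : pzRingType) (V : lmodType K) (a : K) (p u x : V) :
  p + u + a *: (x - u) - p = (1 - a) *: u + a *: x.
Proof.
by rewrite addrAC [p + u]addrC addrK scalerBl scale1r scalerBr addrA [RHS]addrAC.
Qed.

Section Row.
Context {n : nat}.
Implicit Types (h : R -> 'rV[R[i]]_n) (v : 'rV[R[i]]_n).

Lemma rderiv_coord h t v j : rderiv h t v -> rderiv (fun s => h s 0 j) t (v 0 j).
Proof.
move=> H e /H[r r0 Hr]; exists r => // s /Hr; apply: le_trans.
by rewrite nr_normc; have := normc_le_nr (h s - h t - (s - t)%:C *: v) j; rewrite !mxE.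
Qed.

Lemma rderiv_row h t v : (forall j, rderiv (fun s => h s 0 j) t (v 0 j)) -> rderiv h t v.
Proof.
move=> H e e0.
have K j : exists r, 0 < r /\ forall s, `|s - t| <= r ->
    nr (h s 0 j - h t 0 j - (s - t)%:C *: v 0 j) <= e * `|s - t|.
  by have [r r0 Hr] := H j e e0; exists r.
have [r Hr] := choice K.
exists (\big[Num.min/1]_j r j).
  by elim/big_ind : _ => // [x y x0 y0|j _]; [rewrite lt_min x0|have [] := Hr j].
move=> s sr; apply: nr_le => [|j]; first by rewrite mulr_ge0 // ltW.
have [_ /(_ s)] := Hr j; rewrite nr_normc !mxE; apply.
by apply: le_trans sr _; exact: bigmin_le.
Qed.

Lemma is_derive_derive1 (u : R -> R) (t : R) :
  derivable u t 1 -> is_derive t (1 : R) u (derive1 u t).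
Proof. by move=> du; rewrite derive1E; exact: derivableP. Qed.

Lemma rderivP h t v : rderiv h t v <->
  (forall j, real_derivable (fun s => h s 0 j) t) /\ velocity h t = v.
Proof.
split=> [H|[H <-]].
  have Hj j := rderiv_coord j H.
  split=> [j|].
    exact: conj (@ex_derive _ _ _ _ _ _ _ (rderiv_Re (Hj j)))
      (@ex_derive _ _ _ _ _ _ _ (rderiv_Im (Hj j))).
  apply/rowP => j; rewrite mxE /real_derive1 !derive1E.
  have [_ -> ] := rderiv_Re (Hj j); have [_ ->] := rderiv_Im (Hj j).
  by case: (v 0 j).
apply: rderiv_row => j; have [H1 H2] := H j; rewrite mxE.
by apply: rderiv_ReIm; [exact: is_derive_derive1 H1 | exact: is_derive_derive1 H2].
Qed.

Lemma rderiv_velocity h t v : rderiv h t v -> velocity h t = v.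
Proof. by case/rderivP. Qed.

End Row.

Section General.
Context {V W : normedModType R[i]}.
Implicit Types (h k : R -> V).

Lemma rderiv_near h k t v (r : R) : 0 < r -> (forall s, `|s - t| <= r -> h s = k s) ->
  rderiv h t v -> rderiv k t v.
Proof.
move=> r0 hk H e /H[r1 r10 Hr]; exists (Num.min r r1); first by rewrite lt_min r0.
move=> s; rewrite le_min => /andP[sr /Hr]; rewrite hk // hk //.
by rewrite subrr normr0 ltW.
Qed.

Lemma rderiv_cont h t v : rderiv h t v ->
  forall e : R, 0 < e -> exists2 r : R, 0 < r & forall s, `|s - t| <= r -> nr (h s - h t) <= e.
Proof.
move=> H e e0; have [r r0 Hr] := H 1 ltr01.
have L0 : 0 < 1 + nr v by rewrite ltr_pwDl // nr_ge0.
exists (Num.min r (e / (1 + nr v))) => [|s]; first by rewrite lt_min r0 divr_gt0.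
rewrite le_min ler_pdivlMr // => /andP[/Hr H1 H2].
rewrite -[X in nr X](subrK ((s - t)%:C *: v)); apply: le_trans (nrD _ _) _.
rewrite nrZ normc_real; lra.
Qed.

Lemma rderiv_affine (a v : V) t : rderiv (fun s => a + s%:C *: v) t v.
Proof.
move=> e e0; exists 1 => // s _.
rewrite opprD addrACA subrr add0r -scalerBl -rmorphB /= subrr nr0.
by rewrite mulr_ge0 // ltW.
Qed.

Lemma rderiv_lip h t v : rderiv h t v -> exists2 r : R, 0 < r &
  forall s, `|s - t| <= r -> nr (h s - h t) <= (1 + nr v) * `|s - t|.
Proof.
move=> H; have [r r0 Hr] := H 1 ltr01; exists r => // s /Hr H1.
rewrite -[X in nr X](subrK ((s - t)%:C *: v)); apply: le_trans (nrD _ _) _.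
by rewrite nrZ normc_real mulrDl mulrC; rewrite mulrC in H1; move: H1; lra.
Qed.

Lemma differentiable_nr (f : V -> W) z : differentiable f z ->
  forall e : R, 0 < e -> exists2 r : R, 0 < r & forall w, nr (w - z) <= r ->
    nr (f w - f z - 'd f z (w - z)) <= e * nr (w - z).
Proof.
move=> /diff_locally/eqaddoP H e e0.
have /H/nbhs_nrP[r r0 Hr] : 0 < e%:C by rewrite ltcR.
exists (r / 2) => [|w wz]; first by rewrite divr_gt0.
have := Hr (w - z); rewrite subr0 !nrC -rmorphM lecR /= => H1.
have E : f w - f z - 'd f z (w - z) = (f \o shift z - (cst (f z) + 'd f z)) (w - z).
  rewrite (_ : (f \o _ - _) _ = f (w - z + z) - (f z + 'd f z (w - z))) //.
  by rewrite subrK opprD addrA.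
rewrite [X in nr X]E; apply: H1.
by apply: le_lt_trans wz _; rewrite ltr_pdivrMr // ltr_pMr // ltr1n.
Qed.

Lemma diff_bounded (f : V -> W) z : differentiable f z ->
  exists2 k : R, 0 < k & forall u, nr ('d f z u) <= k * nr u.
Proof.
move=> df; have [k k0 Hk] := linear_lipschitz (diff_continuous df).
have E : k = (complex.Re k)%:C by rewrite RRe_real // gtr0_real.
exists (complex.Re k); first by rewrite -ltcR -E.
by move=> u; have := Hk u; rewrite !nrC E -rmorphM lecR.
Qed.

Lemma rderiv_comp (f : V -> W) h t v : differentiable f (h t) -> rderiv h t v ->
  rderiv (f \o h) t ('d f (h t) v).
Proof.
move=> df dh e e0; have [k k0 Hk] := diff_bounded df.
have [r1 r10 H1] := rderiv_lip dh.
have l0 : 0 < 1 + nr v by rewrite ltr_pwDl // nr_ge0.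
have [r2 r20 H2] := differentiable_nr df (divr_gt0 (divr_gt0 e0 (ltr0Sn R 1)) l0).
have [r3 r30 H3] := dh _ (divr_gt0 (divr_gt0 e0 (ltr0Sn R 1)) k0).
exists (Num.min r1 (Num.min (r2 / (1 + nr v)) r3)).
  by rewrite !lt_min r10 r30 divr_gt0.
move=> s; rewrite !le_min ler_pdivlMr // => /and3P[/H1 {}H1 s2 /H3 {}H3].
rewrite mulrC in s2; have {}H2 := H2 (h s) (le_trans H1 s2).
rewrite /= (_ : _ - _ = (f (h s) - f (h t) - 'd f (h t) (h s - h t)) +
    'd f (h t) (h s - h t - (s - t)%:C *: v)); last first.
  have -> : 'd f (h t) (h s - h t - (s - t)%:C *: v) =
    'd f (h t) (h s - h t) - (s - t)%:C *: 'd f (h t) v by rewrite [LHS]linearB linearZ.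
  by rewrite addrA subrK.
apply: le_trans (nrD _ _) _; rewrite (_ : e * _ = e / 2 * `|s - t| + e / 2 * `|s - t|); last lra.
apply: lerD.
  apply: le_trans H2 _; apply: le_trans (ler_wpM2l _ H1) _.
    by rewrite !divr_ge0 // ltW.
  by rewrite mulrA divfK ?gt_eqF.
apply: le_trans (Hk _) _; rewrite -ler_pdivlMl // mulrA.
by apply: le_trans H3 _; rewrite mulrCA mulrA mulrAC.
Qed.

End General.

Lemma lip_of_derive (u d : R -> R) (a b K : R) : a <= b ->
  (forall t, a <= t <= b -> is_derive t 1 u (d t)) ->
  (forall t, a <= t <= b -> `|d t| <= K) -> `|u b - u a| <= K * (b - a).
Proof.
rewrite le_eqVlt => /predU1P[->|ab] du dK; first by rewrite !subrr normr0 mulr0.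
have [||c] := @MVT _ u d a b ab.
- move=> x; rewrite in_itv /= => /andP[/ltW ax /ltW xb]; apply: du; exact/andP.
- apply: derivable_within_continuous => x; rewrite in_itv /= => xab.
  by have [] := du x xab.
rewrite in_itv /= => /andP[/ltW ac /ltW cb] ->.
by rewrite normrM (ger0_norm (_ : 0 <= b - a)) ?ler_wpM2r ?dK ?ac //; lra.
Qed.

(** The factor 2 arises because the mean value theorem is applied to real and imaginary parts
    separately. *)
Lemma rderiv_mvt n (h v : R -> 'rV[R[i]]_n) (K : R) : 0 <= K ->
  (forall t, 0 <= t <= 1 -> rderiv h t (v t)) ->
  (forall t, 0 <= t <= 1 -> nr (v t) <= K) -> nr (h 1 - h 0) <= 2 * K.
Proof.
move=> K0 dh vK; apply: nr_le => [|j]; first by rewrite mulr_ge0.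
have vj t : 0 <= t <= 1 -> normc (v t 0 j) <= K.
  by move=> t01; apply: le_trans (normc_le_nr _ _) (vK t t01).
have A : `|complex.Re (h 1 0 j) - complex.Re (h 0 0 j)| <= K * (1 - 0).
  apply: (@lip_of_derive (@complex.Re R \o fun s => h s 0 j)
    (fun t => complex.Re (v t 0 j))) => // t t01.
    exact/rderiv_Re/rderiv_coord/dh.
  exact: le_trans (normc_Re _) (vj t t01).
have B : `|complex.Im (h 1 0 j) - complex.Im (h 0 0 j)| <= K * (1 - 0).
  apply: (@lip_of_derive (@complex.Im R \o fun s => h s 0 j)
    (fun t => complex.Im (v t 0 j))) => // t t01.
    exact/rderiv_Im/rderiv_coord/dh.
  exact: le_trans (normc_Im _) (vj t t01).
rewrite !mxE; apply: le_trans (normc_le_ReIm _) _.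
by rewrite ReD ReN ImD ImN; move: A B; rewrite subr0 mulr1; lra.
Qed.

Lemma diff_line (V : normedModType R[i]) (phi : R[i] -> V) z x :
  'd phi z x = x *: 'd phi z 1.
Proof. by rewrite -linearZ /= [_ *: 1]mulr1. Qed.

Lemma cder_is_derive (f : R[i] -> R[i]) z d : (forall e : R, 0 < e ->
  exists2 r : R, 0 < r & forall w, normc (w - z) <= r ->
    normc (f w - f z - d * (w - z)) <= e * normc (w - z)) -> is_derive z 1 f d.
Proof.
move=> H.
have L : (fun h : R[i] => h^-1 *: ((f \o shift z) (h *: 1) - f z)) @ 0^' --> d.
  apply/(@cvg_nrP R R[i]) => e e0; have [r r0 Hr] := H _ (divr_gt0 e0 (ltr0Sn _ 1)).
  rewrite /dnbhs near_withinE; apply/nbhs_nrP; exists r => // h.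
  rewrite subr0 nr_normc => hr h0; rewrite nr_normc /=.
  have hp : 0 < normc h by rewrite normc_gt0.
  have := Hr (h + z); rewrite addrK [_%:A]mulr1 => /(_ (ltW hr)) B.
  rewrite -(ltr_pM2r hp) -normcM mulrBl -[_ *: _]/(_ * _) mulrAC mulVf // mul1r.
  apply: le_lt_trans B _; rewrite ltr_pM2r //; lra.
by apply: DeriveDef; [apply/cvg_ex; exists d|exact: cvg_lim].
Qed.

Lemma diff_coord n (phi : R[i] -> 'rV[R[i]]_n) z j : differentiable phi z ->
  is_derive z 1 (fun x => phi x 0 j) ('d phi z 1 0 j).
Proof.
move=> dphi; apply: cder_is_derive => e e0.
have [r r0 Hr] := differentiable_nr dphi e0; exists r => // w wz.
have := Hr w; rewrite nr_normc => /(_ wz); apply: le_trans.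
have := normc_le_nr (phi w - phi z - 'd phi z (w - z)) j.
by rewrite diff_line !mxE mulrC.
Qed.

Lemma diff_line_comp (V : normedModType R[i]) m (F : V -> 'rV[R[i]]_m) (w v : V) j (x : R[i]) :
  differentiable F (w + x *: v) ->
  is_derive x 1 (fun y : R[i] => F (w + y *: v) 0 j) ('d F (w + x *: v) v 0 j).
Proof.
move=> dF; apply: cder_is_derive => e e0.
have l0 : 0 < 1 + nr v by rewrite ltr_pwDl // nr_ge0.
have [r r0 Hr] := differentiable_nr dF (divr_gt0 e0 l0).
exists (r / (1 + nr v)) => [|y]; first by rewrite divr_gt0.
rewrite ler_pdivlMr // => yx.
have E : w + y *: v - (w + x *: v) = (y - x) *: v.
  by rewrite opprD addrACA subrr add0r scalerBl.
have vl : nr v <= 1 + nr v by rewrite lerDr.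
have := Hr (w + y *: v); rewrite E nrZ => /(_ _)/(le_trans _) H.
have := normc_le_nr (F (w + y *: v) - F (w + x *: v) - 'd F (w + x *: v) ((y - x) *: v)) j.
move=> /H; rewrite linearZ !mxE [_ * (y - x)]mulrC.
move=> /(_ (le_trans (ler_wpM2l (normc_ge0 _) vl) yx))/le_trans; apply.
rewrite (_ : _ * (_ * _) = e * normc (y - x) * (nr v / (1 + nr v))); last by ring.
by rewrite ler_piMr ?mulr_ge0 ?normc_ge0 ?(ltW e0) // ler_pdivrMr // mul1r.
Qed.

(** The one-variable estimate, for each coordinate of [F], on the complex line w + y v, which stays
    in the ball as long as |y| < rho / |v|. *)
Lemma diff_cauchy m n (F : 'rV[R[i]]_m -> 'rV[R[i]]_n) w v (rho M : R) : 0 < rho -> 0 <= M ->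
  (forall z, nr (z - w) < rho -> differentiable F z) ->
  (forall z, nr (z - w) < rho -> nr (F z) <= M) ->
  nr ('d F w v) <= cauchy_constant R * M / rho * nr v.
Proof.
move=> rho0 M0 dF FM; have c0 := ltW (cauchy_constant_gt0 R).
have C0 : 0 <= cauchy_constant R * M / rho by rewrite divr_ge0 ?mulr_ge0 // ltW.
have [->|v0] := eqVneq v 0; first by rewrite linear0 !nr0 mulr0.
have vp : 0 < nr v by rewrite nr_gt0.
apply: nr_le => [|j]; first by rewrite mulr_ge0 // nr_ge0.
have inb (z : R[i]) : normc (z - 0) < rho / nr v -> nr (w + z *: v - w) < rho.
  by rewrite subr0 addrAC subrr add0r nrZ ltr_pdivlMr.
rewrite (_ : _ * _ = cauchy_constant R * M / (rho / nr v)); last by rewrite invf_div; ring.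
apply: (@cauchy_disc _ (fun y : R[i] => F (w + y *: v) 0 j) 0).
- by rewrite divr_gt0.
- by move=> z /inb/dF/diff_line_comp => /(_ j)[].
- by move=> z /inb/FM; exact: le_trans (normc_le_nr _ _).
- have := @diff_line_comp _ _ F w v j 0; rewrite scale0r addr0; apply.
  by apply: dF; rewrite subrr nr0.
Qed.

(** Around each point of the segment from [a] to [b] a ball of radius rho still lies in the ball of
    radius 2 rho where [F] is bounded, so Cauchy's estimate controls the derivative along the whole
    segment. *)
Lemma holo_lip m n (F : 'rV[R[i]]_m -> 'rV[R[i]]_n) w (rho M : R) : 0 < rho -> 0 <= M ->
  (forall z, nr (z - w) < 2 * rho -> differentiable F z) ->
  (forall z, nr (z - w) < 2 * rho -> nr (F z) <= M) ->
  forall a b, nr (a - w) < rho -> nr (b - w) < rho ->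
    nr (F b - F a) <= 2 * (cauchy_constant R * M / rho) * nr (b - a).
Proof.
move=> rho0 M0 dF FM a b aw bw; have c0 := ltW (cauchy_constant_gt0 R).
pose h (t : R) := a + t%:C *: (b - a).
have hw t : 0 <= t <= 1 -> nr (h t - w) < rho.
  move=> /andP[t0 t1]; rewrite (_ : h t - w = (1 - t)%:C *: (a - w) + t%:C *: (b - w)).
    apply: le_lt_trans (nrD _ _) _; rewrite !nrZ !normc_real !ger0_norm ?subr_ge0 //.
    have [->|tn0] := eqVneq t 0; first by rewrite mul0r addr0 subr0 mul1r.
    have tp : 0 < t by rewrite lt_neqAle eq_sym tn0.
    have : t * nr (b - w) < t * rho by rewrite ltr_pM2l.
    have : (1 - t) * nr (a - w) <= (1 - t) * rho by rewrite ler_wpM2l ?subr_ge0 // ltW.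
    lra.
  rewrite rmorphB rmorph1 -(segment_shift _ w) [w + _]addrC subrK.
  by rewrite opprB addrA subrK.
have near z t : 0 <= t <= 1 -> nr (z - h t) < rho -> nr (z - w) < 2 * rho.
  move=> t01 zt; apply: le_lt_trans (nr_triangle (h t) _ _) _; have := hw t t01; lra.
have E0 : h 0 = a by rewrite /h scale0r addr0.
have E1 : h 1 = b by rewrite /h scale1r addrCA subrr addr0.
rewrite -{1}E0 -{1}E1 -mulrA.
apply: (@rderiv_mvt n (F \o h) (fun t => 'd F (h t) (b - a))).
  - by rewrite mulr_ge0 ?nr_ge0 // divr_ge0 ?mulr_ge0 // ltW.
  - move=> t t01; apply: rderiv_comp; last exact: rderiv_affine.
    by apply: dF; apply: lt_trans (hw t t01) _; lra.
  - move=> t t01; apply: diff_cauchy => // z /(near _ _ t01); [exact: dF|exact: FM].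
Qed.

(** Holomorphic maps are C^1. The difference of the differentials at [w] and [z0] is the
    differential at 0 of u -> F(w + u) - F(z0 + u); by the Lipschitz bound this map is O(|w - z0|)
    on a fixed ball, and Cauchy's estimate transfers the smallness to its differential. *)
Lemma diff_continuous_dir m n (D : set 'rV[R[i]]_m) (F : 'rV[R[i]]_m -> 'rV[R[i]]_n) z0 (e : R) :
  open D -> holomorphic_on D F -> D z0 -> 0 < e ->
  exists2 r : R, 0 < r & forall w, nr (w - z0) <= r ->
    D w /\ forall v, nr ('d F w v - 'd F z0 v) <= e * nr v.
Proof.
move=> oD hF D0 e0.
have [r1 r10 H1] := (open_nrP D).1 oD _ D0.
have [r2 r20 H2] : exists2 r2 : R, 0 < r2 & forall w, nr (w - z0) < r2 -> nr (F w) <= 1 + nr (F z0).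
  have := @nr_near R _ (F z0) 1 ltr01.
  move=> /(differentiable_continuous (hF _ D0))/nbhs_nrP[r2 r20 H2]; exists r2 => // w /H2 /=.
  by move=> H; rewrite -lerBlDr; apply: le_trans (le_nrB _ _) (ltW H).
have M0 : 0 <= 1 + nr (F z0) by rewrite addr_ge0 ?nr_ge0.
move: (1 + nr (F z0)) M0 H2 => M M0 H2.
pose rho := Num.min r1 r2 / 4; have rho0 : 0 < rho by rewrite divr_gt0 // lt_min r10.
have rho4 w : nr (w - z0) < 4 * rho -> D w /\ nr (F w) <= M.
  by rewrite /rho mulrC divfK // lt_min => /andP[/H1 ? /H2].
move: rho rho0 rho4 => rho rho0 rho4.
pose K := 2 * (cauchy_constant R * M / (2 * rho)).
have rho20 : 0 < 2 * rho by rewrite mulr_gt0.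
have c0 := ltW (cauchy_constant_gt0 R).
have K0 : 0 <= K by apply: mulr_ge0 => //; apply: divr_ge0; [exact: mulr_ge0|exact: ltW].
have lip a b : nr (a - z0) < 2 * rho -> nr (b - z0) < 2 * rho -> nr (F b - F a) <= K * nr (b - a).
  have rho22 : 2 * (2 * rho) = 4 * rho by ring.
  by apply: holo_lip => // z; rewrite rho22 => /rho4[] // /hF.
pose L := cauchy_constant R * K / rho + 1.
have L0 : 0 < L.
  by apply: ltr_wpDl => //; apply: divr_ge0; [exact: mulr_ge0|exact: ltW].
exists (Num.min (rho / 2) (e / L)) => [|w]; first by rewrite lt_min; apply/andP; split; apply: divr_gt0.
rewrite le_min => /andP[wr we].
have Dw : D w by have [] := rho4 w; first lra.
split=> // v; pose G u := F (w + u) - F (z0 + u).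
have wn u : nr u < rho -> nr (w + u - z0) < 2 * rho.
  by move=> u1; rewrite addrAC; apply: le_lt_trans (nrD _ _) _; lra.
have zn u : nr u < rho -> nr (z0 + u - z0) < 2 * rho.
  by move=> u1; rewrite addrAC subrr add0r; lra.
have dsh c u : differentiable F (c + u) ->
    is_diff u (fun x => F (c + x)) ('d F (c + u) : _ -> _).
  move=> dF.
  have i1 : is_diff u (fun x => c + x) (0 + id) by apply: is_diffD.
  have dd : is_diff (c + u) F ('d F (c + u)) by exact: differentiableP.
  have := @is_diff_comp _ _ _ _ (fun x => c + x) _ F _ u i1 dd.
  by move=> H; apply: is_diff_eq H _; rewrite add0r.
have dG u : nr u < rho -> is_diff u G (fun x => 'd F (w + u) x - 'd F (z0 + u) x).
  move=> u1; apply: is_diffB; apply: dsh.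
    by apply/hF/(rho4 (w + u) _).1/(lt_trans (wn u u1)); rewrite ltr_pM2r // ltr_nat.
  by apply/hF/(rho4 (z0 + u) _).1/(lt_trans (zn u u1)); rewrite ltr_pM2r // ltr_nat.
have -> : 'd F w v - 'd F z0 v = 'd G 0 v.
  have r00 : nr (0 : 'rV[R[i]]_m) < rho by rewrite nr0.
  have [_ E] := dG 0 r00.
  have {}E := congr1 (fun f : 'rV[R[i]]_m -> 'rV[R[i]]_n => f v) E.
  by apply/esym; apply: etrans E _; rewrite !addr0.
apply: (@le_trans _ _ (cauchy_constant R * (K * nr (w - z0)) / rho * nr v)).
  have G1 : 0 <= K * nr (w - z0) by apply: mulr_ge0 => //; exact: nr_ge0.
  apply: (diff_cauchy v rho0 G1) => z; rewrite subr0 => z1; first by have [] := dG z z1.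
  have := lip _ _ (zn _ z1) (wn _ z1).
  by rewrite opprD addrACA subrr addr0.
rewrite ler_wpM2r ?nr_ge0 //; rewrite ler_pdivlMr // in we.
apply: le_trans we; rewrite /L mulrDr mulr1 (_ : _ / rho = nr (w - z0) * (cauchy_constant R * K / rho)); last by ring.
by rewrite lerDl nr_ge0.
Qed.

End RealDerivative.

(** * C^1 curves and their images under holomorphic maps *)

Section C1Curves.
Context {R : realType}.

Lemma nbhsRP (t : R) (P : set R) :
  nbhs t P <-> exists2 r : R, 0 < r & forall s, `|s - t| < r -> P s.
Proof.
split=> [/nbhs_ballP[r /= r0 H]|[r r0 H]].
  by exists r => // s st; apply: H; rewrite /ball /= distrC.
by apply/nbhs_ballP; exists r => // s; rewrite /ball /= distrC; exact: H.
Qed.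

Lemma continuous_nrP (V : normedModType R[i]) (f : R -> V) (t : R) :
  {for t, continuous f} <-> forall e : R, 0 < e ->
    exists2 r : R, 0 < r & forall s, `|s - t| <= r -> nr (f s - f t) <= e.
Proof.
split=> [/cvg_nrP H e /H/nbhsRP[r r0 Hr]|H].
  exists (r / 2) => [|s st]; first by rewrite divr_gt0.
  by apply/ltW/Hr/(le_lt_trans st); rewrite ltr_pdivrMr // ltr_pMr // ltr1n.
apply/cvg_nrP => e e0; have [r r0 Hr] := H _ (divr_gt0 e0 (ltr0Sn _ 1)).
apply/nbhsRP; exists r => // s /ltW/Hr/le_lt_trans; apply.
by rewrite ltr_pdivrMr // ltr_pMr // ltr1n.
Qed.

Definition clamp (a b t : R) : R := if t <= a then a else if t <= b then t else b.

Lemma clamp_lip a b s t : a <= b -> `|clamp a b s - clamp a b t| <= `|s - t|.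
Proof.
move=> ab; rewrite /clamp; have := ler_norm (s - t); have := ler_norm (- (s - t)).
rewrite normrN; case: (leP s a) => ?; case: (leP t a) => ?; case: (leP s b) => ?;
  case: (leP t b) => ? ? ?; rewrite ler_norml; apply/andP; split; lra.
Qed.

Lemma clamp_in a b t : a <= b -> a <= clamp a b t <= b.
Proof. by move=> ab; rewrite /clamp; case: (leP t a) => ?; case: (leP t b) => ?; lra. Qed.

Lemma clamp_id a b t : a <= t <= b -> clamp a b t = t.
Proof. by rewrite /clamp; case: (leP t a) => ?; case: (leP t b) => ?; lra. Qed.

Lemma clamp_l a b t : t <= a -> clamp a b t = a.
Proof. by rewrite /clamp => ->. Qed.

Lemma clamp_r a b t : a <= b -> b <= t -> clamp a b t = b.
Proof. by rewrite /clamp; case: (leP t a) => ?; case: (leP t b) => ?; lra. Qed.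

Section Extension.
Context (n : nat) (a b : R) (f w : R -> 'rV[R[i]]_n).
Context (ab : a < b).
Context (df : forall t, a <= t <= b -> rderiv f t (w t)).
Context (cw : forall t, a <= t <= b -> forall e : R, 0 < e ->
  exists2 r : R, 0 < r & forall s, a <= s <= b -> `|s - t| <= r -> nr (w s - w t) <= e).

Let cl := clamp a b.
(** Continues the curve along its tangent lines beyond [a] and [b], so that its derivative is [w]
    composed with the clamp and hence continuous on the whole line. *)
Let k t := f (cl t) + (t - cl t)%:C *: w (cl t).

Let dk t : rderiv k t (w (cl t)).
Proof.
have lab := ltW ab.
have aff c v s : rderiv (fun x => f c + (x - c)%:C *: v) s v.
  apply: (@rderiv_near _ _ (fun x : R => (f c - c%:C *: v) + x%:C *: v) _ s v 1 ltr01).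
    by move=> x _; rewrite rmorphB /= scalerBl addrAC -addrA.
  exact: rderiv_affine.
have [ta|ta|ta] := ltgtP t a.
- rewrite /cl clamp_l ?(ltW ta) //.
  apply: (@rderiv_near _ _ (fun x => f a + (x - a)%:C *: w a) _ t (w a) (a - t)).
  + by rewrite subr_gt0.
  + by move=> s; rewrite ler_norml => /andP[_ sa]; rewrite /k /cl clamp_l //; lra.
  + exact: aff.
- have [tb|tb|tb] := ltgtP t b.
  + rewrite /cl clamp_id ?(ltW ta) ?(ltW tb) //.
    apply: (@rderiv_near _ _ f _ t (w t) (Num.min (t - a) (b - t))).
    * by rewrite lt_min !subr_gt0 ta.
    * move=> s; rewrite le_min !ler_norml => /andP[/andP[? ?] /andP[? ?]].
      by rewrite /k /cl clamp_id; [rewrite subrr scale0r addr0|lra].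
    * by apply: df; rewrite !ltW.
  + rewrite /cl clamp_r ?(ltW tb) //.
    apply: (@rderiv_near _ _ (fun x => f b + (x - b)%:C *: w b) _ t (w b) (t - b)).
    * by rewrite subr_gt0.
    * by move=> s; rewrite ler_norml => /andP[sa _]; rewrite /k /cl clamp_r //; lra.
    * exact: aff.
  + rewrite {}tb /cl clamp_r // => e e0.
    have [|r r0 Hr] := df (_ : a <= b <= b) e0; first by rewrite lab lexx.
    exists (Num.min r (b - a)); first by rewrite lt_min r0 subr_gt0.
    move=> s; rewrite le_min => /andP[/Hr {}Hr]; rewrite ler_norml => /andP[? ?].
    rewrite (_ : k b = f b); last by rewrite /k /cl clamp_r // subrr scale0r addr0.
    have [sb|sb] := leP s b; rewrite /k /cl.
      by rewrite clamp_id ?subrr ?scale0r ?addr0 //; lra.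
    rewrite clamp_r ?(ltW sb) // addrAC addrK subrr nr0.
    by rewrite mulr_ge0 ?(ltW e0).
- rewrite {}ta /cl clamp_l // => e e0.
  have [|r r0 Hr] := df (_ : a <= a <= b) e0; first by rewrite lexx lab.
  exists (Num.min r (b - a)); first by rewrite lt_min r0 subr_gt0.
  move=> s; rewrite le_min => /andP[/Hr {}Hr]; rewrite ler_norml => /andP[? ?].
  rewrite (_ : k a = f a); last by rewrite /k /cl clamp_l // subrr scale0r addr0.
  have [sb|sb] := leP a s; rewrite /k /cl.
    by rewrite clamp_id ?subrr ?scale0r ?addr0 //; lra.
  rewrite clamp_l ?(ltW sb) // addrAC addrK subrr nr0.
  by rewrite mulr_ge0 ?(ltW e0).
Qed.

Lemma C1_extension : C1_curve a b f.
Proof.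
have lab := ltW ab.
exists k; split.
- by move=> t j; have /rderivP[] := dk t.
- have -> : velocity k = w \o cl by apply/funext => t; rewrite (rderiv_velocity (dk t)).
  move=> t; apply/continuous_nrP => e e0.
  have [r r0 Hr] := cw (clamp_in t lab) e0.
  exists r => // s st.
  exact: Hr _ (clamp_in s lab) (le_trans (clamp_lip _ _ lab) st).
- by move=> t tab; rewrite /k /cl clamp_id // subrr scale0r addr0.
Qed.

End Extension.

Lemma C1_rderiv n (h : R -> 'rV[R[i]]_n) :
  (forall t j, real_derivable (fun s => h s 0 j) t) -> forall t, rderiv h t (velocity h t).
Proof. by move=> H t; apply/rderivP. Qed.

Lemma C1_curve_rderiv n (a b : R) (g : R -> 'rV[R[i]]_n) t : C1_curve a b g -> a < t < b ->
  rderiv g t (velocity g t).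
Proof.
move=> [h [/C1_rderiv dh _ gh]] /andP[ta tb].
have dg : rderiv g t (velocity h t).
  apply: (@rderiv_near _ _ h _ t _ (Num.min (t - a) (b - t))) => //.
    by rewrite lt_min !subr_gt0 ta.
  move=> s; rewrite le_min !ler_norml => /andP[/andP[? ?] /andP[? ?]]; rewrite gh //; lra.
by rewrite (rderiv_velocity dg).
Qed.

Lemma diff_bounded_sub (V W : normedModType R[i]) (f : V -> W) z : differentiable f z ->
  exists2 k : R, 0 < k & forall u v, nr ('d f z u - 'd f z v) <= k * nr (u - v).
Proof.
by move=> /diff_bounded[k k0 Hk]; exists k => // u v; rewrite -linearB; exact: Hk.
Qed.

Lemma diff_along_continuous n m (D : set 'rV[R[i]]_n) (F : 'rV[R[i]]_n -> 'rV[R[i]]_m)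
    (h v : R -> 'rV[R[i]]_n) t : open D -> holomorphic_on D F -> D (h t) ->
  rderiv h t (v t) -> {for t, continuous v} -> {for t, continuous (fun s => 'd F (h s) (v s))}.
Proof.
move=> oD hF Dt Rh /continuous_nrP cvt; apply/continuous_nrP => e e0.
have [K K0 HK] := diff_bounded_sub (hF _ Dt).
have v1 : 0 < nr (v t) + 1 by rewrite ltr_wpDl ?nr_ge0.
have e2 : 0 < e / 2 by rewrite divr_gt0.
have [r1 r10 H1] := diff_continuous_dir oD hF Dt (divr_gt0 e2 v1).
have [r2 r20 H2] := rderiv_cont Rh r10.
have [r3 r30 H3] := cvt _ (divr_gt0 e2 K0).
have [r4 r40 H4] := cvt 1 ltr01.
exists (Num.min r2 (Num.min r3 r4)); first by rewrite !lt_min r20 r30.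
move=> s; rewrite !le_min => /and3P[s2 /H3 {}H3 /H4 {}H4].
have [_ H5] := H1 _ (H2 _ s2).
apply: le_trans (nr_triangle ('d F (h t) (v s)) _ _) _.
rewrite (splitr e); apply: lerD.
  apply: le_trans (H5 _) _; rewrite mulrAC ler_pdivrMr // ler_wpM2l ?(ltW e2) //.
  by have := le_nrB (v s) (v t); lra.
by apply: le_trans (HK _ _) _; rewrite -ler_pdivlMl // mulrC.
Qed.

(** The curve [h] that extends [g] to the line may leave [D] outside [a, b], where nothing is known
    about [F]; the image curve is therefore extended anew from its values on [a, b]. *)
Lemma C1_comp n m (D : set 'rV[R[i]]_n) (F : 'rV[R[i]]_n -> 'rV[R[i]]_m) (a b : R) g :
  open D -> holomorphic_on D F -> a < b -> C1_curve a b g ->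
  (forall t, a <= t <= b -> D (g t)) -> C1_curve a b (F \o g).
Proof.
move=> oD hF ab [h [dh cv gh]] gD.
have hD t : a <= t <= b -> D (h t) by move=> tab; rewrite -gh //; exact: gD.
have Rh := C1_rderiv dh.
suff [k [k1 k2 k3]] : C1_curve a b (F \o h).
  by exists k; split => // t tab; rewrite -k3 //= gh.
apply: (@C1_extension m a b _ (fun t => 'd F (h t) (velocity h t))) => //.
  by move=> t /hD/hF dF; exact: rderiv_comp.
move=> t tab e e0; have Dt := hD t tab.
have /continuous_nrP/(_ e e0)[r r0 Hr] := diff_along_continuous oD hF Dt (Rh t) (cv t).
by exists r => // s _ /Hr.
Qed.

Lemma velocity_comp n m (F : 'rV[R[i]]_n -> 'rV[R[i]]_m) (a b : R) g t :
  C1_curve a b g -> a < t < b -> differentiable F (g t) ->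
  velocity (F \o g) t = 'd F (g t) (velocity g t).
Proof.
move=> cg tab dF; apply: rderiv_velocity; apply: rderiv_comp => //.
exact: C1_curve_rderiv cg tab.
Qed.

End C1Curves.

(** * Integrals of nonnegative functions that need not be measurable *)

Section LowerIntegral.
Context {R : realType}.
Local Notation mu := (@lebesgue_measure R).
Local Open Scope ereal_scope.
Import HBNNSimple.

(** The integral of a nonnegative function is a supremum over the simple functions below it, and
    this supremum is monotone for arbitrary functions. *)
Lemma le_integral_nomeas (D : set R) (f g : R -> \bar R) :
  (forall x, D x -> 0 <= f x) -> (forall x, D x -> f x <= g x) ->
  \int[mu]_(x in D) f x <= \int[mu]_(x in D) g x.
Proof.
move=> f0 fg; rewrite !ge0_integralE //; last first.
  by move=> x Dx; exact: le_trans (f0 x Dx) (fg x Dx).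
apply: ge_ereal_sup => _ [h /= hf <-]; apply: ereal_sup_ubound; exists h => //= x.
apply: le_trans (hf x) _; rewrite /patch; case: ifP => //.
by rewrite inE; exact: fg.
Qed.

(** The device for the rest of this part: a bound valid for all measurable minorants bounds the
    integral, so facts about measurable functions carry over to arbitrary ones. *)
Lemma integral_le_simple (D : set R) (f : R -> \bar R) c : measurable D ->
  (forall x, D x -> 0 <= f x) ->
  (forall h : R -> R, measurable_fun setT h -> (forall x, (0 <= h x)%R) ->
     (forall x, D x -> (h x)%:E <= f x) -> (forall x, ~ D x -> h x = 0%R) ->
     \int[mu]_(x in D) (h x)%:E <= c) ->
  \int[mu]_(x in D) f x <= c.
Proof.
move=> mD f0 H; rewrite ge0_integralE //; apply: ge_ereal_sup => _ [h /= hf <-].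
have h0 x : ~ D x -> h x = 0%R.
  move=> Dx; apply/eqP; rewrite eq_le fun_ge0 andbT -lee_fin.
  by apply: le_trans (hf x) _; rewrite patchE memNset.
have -> : sintegral mu h = \int[mu]_(x in D) (h x)%:E.
  rewrite integral_nnsfun //; congr sintegral; apply/funext => x.
  by rewrite patchE; case: ifPn => // /negP; rewrite inE => /h0.
apply: (H h) => //; first exact: (measurable_funPT h).
by move=> x Dx; have := hf x; rewrite patchE mem_set.
Qed.

Lemma integral_oo_cc (a b : R) (f : R -> \bar R) : (forall x, 0 <= f x) ->
  \int[mu]_(x in `[a, b]) f x = \int[mu]_(x in `]a, b[) f x.
Proof.
move=> f0; apply/eqP; rewrite eq_le; apply/andP; split.
  apply: integral_le_simple => // h mh h0 hf hz.
  rewrite integral_itv_bndoo; last by apply/measurable_EFinP; exact: measurable_funTS.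
  apply: le_integral_nomeas => x; first by rewrite lee_fin.
  by rewrite /= in_itv /= => /andP[/ltW ax /ltW xb]; apply: hf; rewrite /= in_itv /= ax.
apply: integral_le_simple => // h mh h0 hf hz.
rewrite -(@integral_itv_bndoo _ _ _ _ true false); last first.
  by apply/measurable_EFinP; exact: measurable_funTS.
apply: le_integral_nomeas => x; first by rewrite lee_fin.
have [xab _|/hz -> _] := pselect (`]a, b[%classic x); [exact: hf|exact: f0].
Qed.

Lemma integral_split_measurable (a b c : R) (h : R -> R) : (a < b)%R -> (b < c)%R ->
  measurable_fun setT h -> (forall x, (0 <= h x)%R) ->
  \int[mu]_(x in `]a, c[) (h x)%:E =
  \int[mu]_(x in `]a, b[) (h x)%:E + \int[mu]_(x in `]b, c[) (h x)%:E.
Proof.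
move=> ab bc mh h0.
have mE (A : set (measurableTypeR R)) : measurable_fun A (EFin \o h : measurableTypeR R -> \bar R).
  by apply/measurable_EFinP; exact: measurable_funTS.
have -> : `]a, c[%classic = `]a, b]%classic `|` `]b, c[%classic.
  apply/seteqP; split => x /=; rewrite !in_itv /=.
    by move=> /andP[ax xc]; case: (leP x b) => xb; [left|right]; apply/andP.
  by move=> [/andP[ax xb]|/andP[bx xc]]; apply/andP; split => //; lra.
rewrite ge0_integral_setU //.
- by rewrite (@integral_itv_bndoo _ a b _ false false) //; exact: mE.
- by move=> x _; rewrite lee_fin.
- apply/disj_setPS => x /=; rewrite !in_itv /= => -[/andP[_ xb] /andP[bx _]]; lra.
Qed.

(** For one inequality a minorant on the whole interval restricts to both halves. For the other,
    minorants on the halves vanish elsewhere and add up to a minorant on the whole; the two suprema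
    are taken one after the other by subtraction, after the infinite case has been set aside. *)
Lemma integral_split (a b c : R) (f : R -> \bar R) : (a < b)%R -> (b < c)%R ->
  (forall x, 0 <= f x) ->
  \int[mu]_(x in `]a, c[) f x = \int[mu]_(x in `]a, b[) f x + \int[mu]_(x in `]b, c[) f x.
Proof.
move=> ab bc f0; apply/eqP; rewrite eq_le; apply/andP; split.
  apply: integral_le_simple => // h mh h0 hf hz.
  rewrite (integral_split_measurable ab bc) //; apply: leeD.
    apply: le_integral_nomeas => x; first by rewrite lee_fin.
    by rewrite /= in_itv /= => /andP[ax xb]; apply: hf; rewrite /= in_itv /= ax /=; lra.
  apply: le_integral_nomeas => x; first by rewrite lee_fin.
  by rewrite /= in_itv /= => /andP[ax xb]; apply: hf; rewrite /= in_itv /= xb andbT; lra.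
set I := \int[mu]_(x in `]a, c[) f x.
have I0 : 0 <= I by exact: integral_ge0.
have [->|If] := eqVneq I +oo; first exact: leey.
have fI : I \is a fin_num by rewrite ge0_fin_numE // ltey.
have two (h1 h2 : R -> R) : measurable_fun setT h1 -> (forall x, (0 <= h1 x)%R) ->
     (forall x, `]a, b[%classic x -> (h1 x)%:E <= f x) ->
     (forall x, ~ `]a, b[%classic x -> h1 x = 0%R) ->
     measurable_fun setT h2 -> (forall x, (0 <= h2 x)%R) ->
     (forall x, `]b, c[%classic x -> (h2 x)%:E <= f x) ->
     (forall x, ~ `]b, c[%classic x -> h2 x = 0%R) ->
     \int[mu]_(x in `]a, b[) (h1 x)%:E + \int[mu]_(x in `]b, c[) (h2 x)%:E <= I.
  move=> m1 p1 f1 z1 m2 p2 f2 z2.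
  apply: (@le_trans _ _ (\int[mu]_(x in `]a, c[) (h1 x + h2 x)%:E)).
    rewrite (integral_split_measurable ab bc); last 2 first.
    - exact: measurable_funD.
    - by move=> x; rewrite addr_ge0.
    apply: leeD; apply: le_integral_nomeas => x _; rewrite lee_fin //.
      by rewrite lerDl.
    by rewrite lerDr.
  apply: le_integral_nomeas => x; first by rewrite lee_fin addr_ge0.
  move=> _; have [xab|xab] := pselect (`]a, b[%classic x).
    rewrite z2 ?addr0; first exact: f1.
    move: xab => /=; rewrite !in_itv /= => /andP[_ xb] /andP[bx _]; lra.
  rewrite z1 // add0r.
  have [xbc|xbc] := pselect (`]b, c[%classic x); first exact: f2.
  by rewrite z2.
have fin2 (h : R -> R) A : measurable A -> (forall x, (0 <= h x)%R) ->
    \int[mu]_(x in A) (h x)%:E <= I -> \int[mu]_(x in A) (h x)%:E \is a fin_num.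
  move=> mA h0 hI; rewrite ge0_fin_numE; last by apply: integral_ge0 => x _; rewrite lee_fin.
  by apply: le_lt_trans hI _; rewrite ltey.
have z0 : measurable_fun [set: R] (fun=> 0%R : R) by exact: measurable_cst.
have A1 (h2 : R -> R) : measurable_fun setT h2 -> (forall x, (0 <= h2 x)%R) ->
     (forall x, `]b, c[%classic x -> (h2 x)%:E <= f x) ->
     (forall x, ~ `]b, c[%classic x -> h2 x = 0%R) ->
     \int[mu]_(x in `]a, b[) f x <= I - \int[mu]_(x in `]b, c[) (h2 x)%:E.
  move=> m2 p2 f2 z2.
  have F2 : \int[mu]_(x in `]b, c[) (h2 x)%:E \is a fin_num.
    apply: fin2 => //; have := two (fun=> 0%R) h2 z0 (fun=> lexx _) (fun x _ => f0 x) (fun _ _ => erefl) m2 p2 f2 z2.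
    by rewrite integral0_eq // add0e.
  apply: integral_le_simple => // h1 m1 p1 f1 z1.
  by rewrite leeBrDr //; exact: two.
have F1 : \int[mu]_(x in `]a, b[) f x \is a fin_num.
  rewrite ge0_fin_numE; last exact: integral_ge0.
  have := A1 (fun=> 0%R) z0 (fun=> lexx _) (fun x _ => f0 x) (fun _ _ => erefl).
  by rewrite [X in _ - X]integral0_eq // sube0 => /le_lt_trans; apply; rewrite ltey.
rewrite addeC -leeBrDr //; apply: integral_le_simple => // h2 m2 p2 f2 z2.
rewrite leeBrDr // addeC -leeBrDr; first exact: A1.
apply: fin2 => //; have := two (fun=> 0%R) h2 z0 (fun=> lexx _) (fun x _ => f0 x) (fun _ _ => erefl) m2 p2 f2 z2.
by rewrite integral0_eq // add0e.
Qed.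

Definition affine (k c : R) (t : measurableTypeR R) : measurableTypeR R := (k * t + c)%R.

Lemma measurable_affine k c : measurable_fun [set: measurableTypeR R] (affine k c).
Proof.
by apply: (@measurable_funD _ _ R setT (fun t => k * t)%R (cst c)) => //;
  exact: measurable_funM.
Qed.

HB.instance Definition _ k c :=
  isMeasurableFun.Build _ _ _ _ (affine k c) (measurable_affine k c).

(** The image of Lebesgue measure under t -> k t + c, rescaled by |k|; by uniqueness it is Lebesgue
    measure again. *)
Definition affine_image (k c : R) : {measure set (measurableTypeR R) -> \bar R}.
Proof.
refine (mscale (NngNum (normr_ge0 k)) (pushforward mu (affine k c))).
exact: measurable_affine.
Defined.

Lemma lebesgue_measure_affine (k c : R) : k != 0%R -> forall A, measurable A ->
  mu A = (`|k|%:E * mu (affine k c @^-1` A)).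
Proof.
move=> k0.
pose nu := affine_image k c.
apply: (@lebesgue_measure_unique _ nu) => _ [[a b] _ <-] /=.
rewrite /nu /affine_image /mscale /= /pushforward.
have [kp|kn] := ltP 0%R k.
  have -> : affine k c @^-1` `]a, b]%classic = `]((a - c) / k)%R, ((b - c) / k)%R]%classic.
    apply/seteqP; split => t /=; rewrite /affine !in_itv /= ltr_pdivrMr // ler_pdivlMr // (mulrC t);
    by move=> /andP[? ?]; apply/andP; split; lra.
  rewrite !lebesgue_measure_itv /= !lte_fin ltr_pM2r ?invr_gt0 // ltrD2r.
  case: ifP => _; last by rewrite mule0.
  rewrite -!EFinB -EFinM; congr _%:E; rewrite gtr0_norm //; field.
  by rewrite gt_eqF.
have {}kn : (k < 0)%R by rewrite lt_neqAle k0.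
have -> : affine k c @^-1` `]a, b]%classic = `[((b - c) / k)%R, ((a - c) / k)%R[%classic.
  apply/seteqP; split => t /=; rewrite /affine !in_itv /= ler_ndivrMr // ltr_ndivlMr // (mulrC t);
  by move=> /andP[? ?]; apply/andP; split; lra.
rewrite !lebesgue_measure_itv /= !lte_fin ltr_nM2r ?invr_lt0 // ltrD2r.
case: ifP => _; last by rewrite mule0.
rewrite -!EFinB -EFinM; congr _%:E; rewrite ltr0_norm //; field.
by rewrite lt_eqF.
Qed.

Lemma integral_affine_measurable (k c : R) (D : set (measurableTypeR R)) (h : R -> R) :
  k != 0%R -> measurable D -> measurable_fun setT h -> (forall x, (0 <= h x)%R) ->
  \int[mu]_(x in D) (h x)%:E =
  `|k|%:E * \int[mu]_(t in affine k c @^-1` D) (h (affine k c t))%:E.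
Proof.
move=> k0 mD mh h0.
pose nu := affine_image k c.
have mE : measurable_fun D (EFin \o h : measurableTypeR R -> \bar R).
  by apply/measurable_EFinP; exact: measurable_funTS.
rewrite (eq_measure_integral nu); last first.
  by move=> A mA _; exact: lebesgue_measure_affine.
rewrite ge0_integral_mscale //; last by move=> x _; rewrite lee_fin.
rewrite /= (ge0_integral_pushforward (measurable_affine k c)) //.
by move=> x _; rewrite lee_fin.
Qed.

(** A measurable minorant [h] of the left integrand is transported to the minorant |k|^-1 h((x -
    c)/k) of [f], with the same integral. *)
Lemma integral_affine_le (k c : R) (D : set (measurableTypeR R)) (f : R -> \bar R) :
  k != 0%R -> measurable D -> (forall x, 0 <= f x) ->
  \int[mu]_(t in affine k c @^-1` D) (`|k|%:E * f (k * t + c)%R)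
    <= \int[mu]_(x in D) f x.
Proof.
move=> k0 mD f0.
have kp : (0 < `|k|)%R by rewrite normr_gt0.
have mP : measurable (affine k c @^-1` D).
  by rewrite -[X in measurable X]setTI; exact: measurable_affine.
apply: integral_le_simple => //; first by move=> x _; rewrite mule_ge0 // lee_fin.
move=> h mh h0 hf hz.
pose l (x : R) := (`|k|^-1 * h ((x - c) / k))%R.
have ml : measurable_fun [set: R] l.
  apply: measurable_funM => //; apply: measurableT_comp => //.
  by apply: measurable_funM => //; exact: measurable_funB.
have l0 x : (0 <= l x)%R by rewrite mulr_ge0 // invr_ge0.
have lE t : l (affine k c t) = (`|k|^-1 * h t)%R.
  by rewrite /l /affine addrK mulrAC mulfV // mul1r.
apply: (@le_trans _ _ (\int[mu]_(x in D) (l x)%:E)).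
  rewrite (integral_affine_measurable c k0 mD ml l0).
  have -> : \int[mu]_(t in affine k c @^-1` D) (l (affine k c t))%:E =
      `|k|^-1%:E * \int[mu]_(t in affine k c @^-1` D) (h t)%:E.
    rewrite -ge0_integralZl_EFin //.
    - by apply: eq_integral => x _; rewrite lE EFinM.
    - by move=> x _; rewrite lee_fin.
    - by apply/measurable_EFinP; exact: measurable_funTS.
  by rewrite muleA -EFinM mulfV ?gt_eqF // mul1e.
apply: le_integral_nomeas => x; first by rewrite lee_fin.
move=> Dx; rewrite /l EFinM lee_pdivrMl //.
have E : (k * ((x - c) / k) + c)%R = x by rewrite mulrC divfK // subrK.
have := hf ((x - c) / k)%R; rewrite /= /affine E; exact.
Qed.

End LowerIntegral.

(** * The Kobayashi-Royden metric *)

Lemma unit_disc0 (R : realType) : unit_disc (0 : R[i]).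
Proof. by rewrite /unit_disc /mkset normc0 ltr01. Qed.

Section Royden.
Context {R : realType} {n : nat}.
Implicit Types (D : set 'rV[R[i]]_n) (z v : 'rV[R[i]]_n).
Local Notation KR := (@kobayashi_royden R n).

Lemma KR_ge0 D z v : (0 <= KR D z v)%E.
Proof. by apply: le_ereal_inf_tmp => _ [xi _ <-]; rewrite lee_fin normc_ge0. Qed.

Lemma KR_lb D z v (c : R) :
  (forall phi xi, holomorphic_on unit_disc phi -> (forall x, unit_disc x -> D (phi x)) ->
     phi 0 = z -> 'd phi (0 : R[i]) xi = v -> c <= normc xi) -> (c%:E <= KR D z v)%E.
Proof.
move=> H; apply: le_ereal_inf_tmp => _ [xi [phi [h1 h2 h3 h4]] <-].
by rewrite lee_fin; exact: H h4.
Qed.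

Lemma KR_ub D z v phi xi : holomorphic_on unit_disc phi ->
  (forall x, unit_disc x -> D (phi x)) -> phi 0 = z -> 'd phi (0 : R[i]) xi = v ->
  (KR D z v <= (normc xi)%:E)%E.
Proof. by move=> h1 h2 h3 h4; apply: ereal_inf_lbound; exists xi => //; exists phi. Qed.

Lemma KR_scale_le D z v (c : R[i]) : c != 0 ->
  (KR D z (c *: v) <= (normc c)%:E * KR D z v)%E.
Proof.
move=> c0; have cp : 0 < normc c by rewrite normc_gt0.
rewrite -lee_pdivrMl //; apply: le_ereal_inf_tmp => _ [xi [phi [h1 h2 h3 h4]] <-].
rewrite lee_pdivrMl // -EFinM -normcM; apply: (KR_ub h1 h2 h3).
by rewrite -[c * xi]/(c *: xi) linearZ /= h4.
Qed.

Lemma affine_disc (a v : 'rV[R[i]]_n) (x : R[i]) :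
  is_diff x (fun y : R[i] => a + y *: v) (fun y => y *: v).
Proof.
have i1 : is_diff x (fun y : R[i] => y *: v) (fun y => y *: v).
  exact: (is_diff_scalel x v).
have := is_diffD (is_diff_cst a x) i1.
by move=> H; apply: is_diff_eq H _; rewrite add0r.
Qed.

Lemma KR_ball D z v (r : R) : 0 < r -> (forall w, nr (w - z) < r -> D w) ->
  (KR D z v <= (nr v / r)%:E)%E.
Proof.
move=> r0 zD; have [->|v0] := eqVneq v 0.
  rewrite nr0 mul0r -(@normc0 R); apply: (@KR_ub _ _ _ (cst z) 0) => //.
  - by move=> x _; apply: zD; rewrite /cst subrr nr0.
  - by rewrite linear0.
have vp : 0 < nr v by rewrite nr_gt0.
have rv : 0 < nr v / r by rewrite divr_gt0.
have -> : nr v / r = normc (nr v / r)%:C by rewrite normc_real gtr0_norm.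
pose k : R[i] := (r / nr v)%:C.
have D0 x := affine_disc z (k *: v) x.
apply: (@KR_ub _ _ _ (fun y : R[i] => z + y *: (k *: v))).
- by move=> x _; have [] := D0 x.
- move=> x x1; apply: zD; rewrite addrAC subrr add0r !nrZ normc_real gtr0_norm ?divr_gt0 //.
  by rewrite divfK ?gt_eqF // gtr_pMl.
- by rewrite scale0r addr0.
- have [_ E] := D0 0; rewrite [LHS](congr1 (fun f : _ -> _ => f (nr v / r)%:C) E) scalerA.
  by rewrite /k -rmorphM /= mulrA divfK ?gt_eqF // divff ?gt_eqF // scale1r.
Qed.

End Royden.

Lemma KR_holo (R : realType) n m (D : set 'rV[R[i]]_n) (D' : set 'rV[R[i]]_m) F z v :
  holomorphic_on D F -> (forall w, D w -> D' (F w)) -> D z ->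
  (kobayashi_royden D' (F z) ('d F z v) <= kobayashi_royden D z v)%E.
Proof.
move=> hF FD Dz; apply: le_ereal_inf_tmp => _ [xi [phi [h1 h2 h3 h4]] <-].
have dF x : unit_disc x -> differentiable F (phi x) by move=> /h2/hF.
apply: (@KR_ub _ _ _ _ _ (F \o phi)).
- by move=> x x1; exact: (@differentiable_comp _ _ _ _ phi F x (h1 x x1) (dF x x1)).
- by move=> x /h2; exact: FD.
- by rewrite /= h3.
- have d0 := @unit_disc0 R.
  have E := congr1 (fun f : _ -> _ => f xi) (@diff_comp _ _ _ _ phi F 0 (h1 0 d0) (dF 0 d0)).
  by apply: etrans E _; rewrite /= h3 h4.
Qed.

(** * Piecewise C^1 curves and their Kobayashi lengths *)

Section Curves.
Context {R : realType} {n : nat}.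
Local Notation mu := (@lebesgue_measure R).
Implicit Types (g : R -> 'rV[R[i]]_n) (D : set 'rV[R[i]]_n).

(** Describes a piecewise C^1 curve as an iterated concatenation instead of by its list of break
    points, so that properties of such curves follow by induction. [piecewise_pw] relates the two
    descriptions. *)
Inductive pw g : R -> R -> Prop :=
| pw_one a b : a < b -> C1_curve a b g -> pw g a b
| pw_cat a b c : pw g a b -> pw g b c -> pw g a c.

Lemma pw_lt g a b : pw g a b -> a < b.
Proof. by elim=> // x y z _ xy _; exact: lt_trans. Qed.

Lemma pw_of_seq g s a : path <%R a s -> s != [::] ->
  (forall i, (i < size s)%N -> C1_curve (nth 0 (a :: s) i) (nth 0 s i) g) ->
  pw g a (last a s).
Proof.
elim: s a => // x s IH a /= /andP[ax xs] _ H.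
have [s0|s0] := eqVneq s [::].
  by rewrite s0; apply: pw_one => //; have := H 0%N; exact.
apply: pw_cat (IH x xs s0 _); first by apply: pw_one => //; have := H 0%N; exact.
by move=> i si; have := H i.+1; exact.
Qed.

Lemma seq_of_pw g a b : pw g a b -> exists s, [/\ path <%R a s, last a s = b
  & forall i, (i < size s)%N -> C1_curve (nth 0 (a :: s) i) (nth 0 s i) g].
Proof.
elim=> {a b} [a b ab Cg|a b c _ [s [s1 s2 s3]] _ [t [t1 t2 t3]]].
  by exists [:: b]; split => //=; [rewrite ab|case].
exists (s ++ t); split; first by rewrite cat_path s1 s2.
  by rewrite last_cat s2.
move=> i; rewrite size_cat => ist; have [si|si] := ltnP i (size s).
  by rewrite -cat_cons !nth_cat /= si ltnS (ltnW si); exact: s3.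
have [j ej] : exists j, i = (size s + j)%N by exists (i - size s)%N; rewrite subnKC.
subst i; rewrite ltn_add2l in ist.
have -> : nth 0 (s ++ t) (size s + j) = nth 0 t j by rewrite nth_cat ltnNge leq_addr addKn.
suff -> : nth 0 (a :: s ++ t) (size s + j) = nth 0 (b :: t) j by exact: t3.
case: j {ist si} => [|j]; rewrite -cat_cons nth_cat /= ltnS.
  by rewrite addn0 leqnn -[size s]/(size (a :: s)).-1 nth_last.
by rewrite addnS ltnNge leq_addr /= subSS addKn.
Qed.

Lemma piecewise_pw g : piecewise_C1_curve g <-> pw g 0 1.
Proof.
split=> [[s [s1 s2 s3]]|/seq_of_pw]; last exact.
rewrite -s2; apply: pw_of_seq => //; apply: contra_eq_neq s2 => ->.
by rewrite eq_sym oner_eq0.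
Qed.

Lemma C1_curve_ext g g' a b : (forall t, a <= t <= b -> g t = g' t) ->
  C1_curve a b g -> C1_curve a b g'.
Proof. by move=> E [h [h1 h2 h3]]; exists h; split => // t tab; rewrite -E ?h3. Qed.

Lemma pw_ext g g' a b : (forall t, a <= t <= b -> g t = g' t) -> pw g a b -> pw g' a b.
Proof.
move=> + H; elim: H => {a b} [a b ab Cg E|a b c p1 IH1 p2 IH2 E].
  by apply: pw_one => //; exact: C1_curve_ext Cg.
have ab := ltW (pw_lt p1); have bc := ltW (pw_lt p2).
apply: (@pw_cat _ a b c); [apply: IH1|apply: IH2] => t /andP[t1 t2]; apply: E.
  by rewrite t1 (le_trans t2).
by rewrite t2 (le_trans _ t1).
Qed.

Lemma C1_curve_sub g a b c d : a <= c -> d <= b -> C1_curve a b g -> C1_curve c d g.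
Proof.
move=> ac db [h [h1 h2 h3]]; exists h; split => // t /andP[ct td]; apply: h3.
by rewrite (le_trans ac ct) (le_trans td db).
Qed.

Lemma pw_cut g a b c : pw g a b -> a < c -> c < b -> pw g a c /\ pw g c b.
Proof.
move=> H; elim: H c => {a b} [a b ab Cg c ac cb|a b c p1 IH1 p2 IH2 d ad dc].
  by split; apply: pw_one => //; apply: C1_curve_sub Cg => //; exact: ltW.
have [db|bd|->] := ltgtP d b; last by [].
  by have [q1 q2] := IH1 d ad db; split=> //; exact: pw_cat p2.
by have [q1 q2] := IH2 d bd dc; split=> //; exact: pw_cat q1.
Qed.

Lemma rderiv_reparam g (k c t : R) v : rderiv g (k * t + c) v ->
  rderiv (fun s => g (k * s + c)) t (k%:C *: v).
Proof.
move=> H e e0; have k1 : 0 < `|k| + 1 by rewrite ltr_wpDl.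
have [r r0 Hr] := H _ (divr_gt0 e0 k1).
exists (r / (`|k| + 1)); first by rewrite divr_gt0.
move=> s; rewrite ler_pdivlMr // => st.
have E : k * s + c - (k * t + c) = k * (s - t) by ring.
have Ekst : `|k * (s - t)| <= (`|k| + 1) * `|s - t|.
  by rewrite normrM ler_wpM2r // lerDl.
have st' : (`|k| + 1) * `|s - t| <= r by rewrite mulrC.
have H1 := Hr (k * s + c); rewrite E in H1; have {}H1 := H1 (le_trans Ekst st').
rewrite scalerA -rmorphM /= [(s - t) * k]mulrC; apply: le_trans H1 _.
rewrite mulrAC ler_pdivrMr // -mulrA ler_wpM2l ?(ltW e0) //.
by rewrite [leRHS]mulrC.
Qed.

Lemma C1_curve_reparam g a b (k c a' b' : R) : C1_curve a b g ->
  (forall t, a' <= t <= b' -> a <= k * t + c <= b) ->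
  C1_curve a' b' (fun t => g (k * t + c)).
Proof.
move=> [h [/C1_rderiv dh ch gh]] H.
have d2 t : rderiv (fun s => h (k * s + c)) t (k%:C *: velocity h (k * t + c)).
  exact: rderiv_reparam.
exists (fun s => h (k * s + c)); split.
- by move=> t j; have /rderivP[] := d2 t.
- rewrite (_ : velocity _ = fun t => k%:C *: velocity h (k * t + c)); last first.
    by apply/funext => t; rewrite (rderiv_velocity (d2 t)).
  move=> t; apply/continuous_nrP => e e0.
  have k1 : 0 < `|k| + 1 by rewrite ltr_wpDl.
  have /continuous_nrP/(_ _ (divr_gt0 e0 k1))[r r0 Hr] := ch (k * t + c).
  exists (r / (`|k| + 1)) => [|s]; first by rewrite divr_gt0.
  rewrite ler_pdivlMr // => st.
  rewrite -scalerBr nrZ normc_real.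
  have {}Hr := Hr (k * s + c).
  apply: (@le_trans _ _ ((`|k| + 1) * (e / (`|k| + 1)))); last by rewrite mulrC divfK ?gt_eqF.
  apply: ler_pM => //; first exact: nr_ge0.
    by rewrite lerDl.
  apply: Hr; rewrite (_ : _ - _ = (s - t) * k); last by ring.
  by apply: le_trans st; rewrite normrM ler_wpM2l // lerDl.
- by move=> t /H; exact: gh.
Qed.

Lemma pw_reparam_pos g a b (k c a' b' : R) : pw g a b -> 0 < k ->
  a = k * a' + c -> b = k * b' + c -> pw (fun t => g (k * t + c)) a' b'.
Proof.
move=> H k0; elim: H a' b' => {a b} [a b ab Cg a' b' Ea Eb|a b d p1 IH1 p2 IH2 a' d' Ea Ed].
  apply: pw_one; first by move: ab; rewrite Ea Eb ltrD2r ltr_pM2l.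
  apply: C1_curve_reparam Cg _ => t /andP[t1 t2].
  by rewrite Ea Eb !lerD2r !ler_pM2l // t1.
have Eb : b = k * ((b - c) / k) + c by rewrite mulrC divfK ?gt_eqF // subrK.
by apply: (@pw_cat _ _ ((b - c) / k)); [exact: IH1|exact: IH2].
Qed.

Lemma pw_reparam_neg g a b (k c a' b' : R) : pw g a b -> k < 0 ->
  b = k * a' + c -> a = k * b' + c -> pw (fun t => g (k * t + c)) a' b'.
Proof.
move=> H k0; elim: H a' b' => {a b} [a b ab Cg a' b' Ea Eb|a b d p1 IH1 p2 IH2 a' d' Ea Ed].
  apply: pw_one; first by move: ab; rewrite Ea Eb ltrD2r ltr_nM2l.
  apply: C1_curve_reparam Cg _ => t /andP[t1 t2].
  by rewrite Ea Eb !lerD2r !ler_nM2l // t1 andbT.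
have Eb : b = k * ((b - c) / k) + c by rewrite mulrC divfK ?lt_eqF // subrK.
by apply: (@pw_cat _ _ ((b - c) / k)); [exact: IH2|exact: IH1].
Qed.

(** The interval is open because at its end points [velocity g] would depend on values of [g]
    outside [a, b]. *)
Definition curve_length D g a b : \bar R :=
  (\int[mu]_(t in `]a, b[) kobayashi_royden D (g t) (velocity g t))%E.

Lemma kobayashi_lengthE D g : kobayashi_length D g = curve_length D g 0 1.
Proof. by apply: integral_oo_cc => t; exact: KR_ge0. Qed.

Lemma curve_length_ge0 D g a b : (0 <= curve_length D g a b)%E.
Proof. by apply: integral_ge0 => t _; exact: KR_ge0. Qed.

Lemma curve_length_cat D g a b c : a < b -> b < c ->
  curve_length D g a c = (curve_length D g a b + curve_length D g b c)%E.
Proof. by move=> ab bc; apply: integral_split => // t; exact: KR_ge0. Qed.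

Lemma curve_length_ext D g g' a b : pw g a b -> (forall t, a <= t <= b -> g t = g' t) ->
  curve_length D g a b = curve_length D g' a b.
Proof.
elim=> {a b} [a b ab Cg E|a b c p1 IH1 p2 IH2 E].
  apply: eq_integral => t; rewrite inE /= in_itv /= => tab.
  have /andP[ta tb] := tab.
  rewrite E; last by rewrite !ltW.
  congr (kobayashi_royden _ _ _).
  have d1 := C1_curve_rderiv Cg tab.
  apply/esym/rderiv_velocity.
  apply: (@rderiv_near _ _ g _ t _ (Num.min (t - a) (b - t))) => //.
    by rewrite lt_min !subr_gt0 ta.
  by move=> s; rewrite le_min !ler_norml => /andP[/andP[? ?] /andP[? ?]]; apply: E; lra.
have ab := pw_lt p1; have bc := pw_lt p2.
rewrite (curve_length_cat D g ab bc) (curve_length_cat D g' ab bc).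
have e1 : curve_length D g a b = curve_length D g' a b.
  by apply: IH1 => t /andP[t1 t2]; apply: E; lra.
have e2 : curve_length D g b c = curve_length D g' b c.
  by apply: IH2 => t /andP[t1 t2]; apply: E; lra.
by rewrite e1 e2.
Qed.

(** One inequality serves, since reparametrised curves are used only as competitors in the infimum
    defining the distance. A negative [k] reverses the curve and yields symmetry. *)
Lemma curve_length_reparam D g a b (k c a' b' : R) : pw g a b -> k != 0 ->
  (forall t, (a' < t < b')%R = (a < k * t + c < b)%R) ->
  (curve_length D (fun t => g (k * t + c)%R) a' b' <= curve_length D g a b)%E.
Proof.
move=> H k0; elim: H a' b' => {a b} [a b ab Cg a' b' E|a b d p1 IH1 p2 IH2 a' d' E].
  apply: le_trans (integral_affine_le c k0 _ _) => //; last first.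
    by move=> x; exact: KR_ge0.
  rewrite (_ : affine k c @^-1` _ = `]a', b'[%classic); last first.
    by apply/seteqP; split => t /=; rewrite /affine !in_itv /= E.
  apply: le_integral_nomeas => t; first by move=> _; exact: KR_ge0.
  rewrite /= in_itv /= E => tab.
  rewrite (rderiv_velocity (rderiv_reparam (C1_curve_rderiv Cg tab))).
  by rewrite -(normc_real k); apply: KR_scale_le; rewrite -normc_eq0 normc_real normr_eq0.
have ab := pw_lt p1; have bd := pw_lt p2.
pose b' := (b - c) / k.
have Eb' : k * b' + c = b by rewrite /b' mulrC divfK // subrK.
have /andP[ab' bd'] : a' < b' < d' by rewrite E Eb' ab.
rewrite (curve_length_cat D _ ab' bd') (curve_length_cat D g ab bd).
have [kp|kn] := ltP 0 k.
  apply: leeD; [apply: IH1|apply: IH2] => t; have := E t; rewrite -Eb' ltrD2r ltr_pM2l //.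
    have [tb|_] := ltP t b'; rewrite ?andbT ?andbF // (lt_trans tb bd') andbT => ->.
    suff -> : k * t + c < d by rewrite andbT.
    by apply: lt_trans bd; rewrite -Eb' ltrD2r ltr_pM2l.
  have [tb|_] := ltP b' t; rewrite // (lt_trans ab' tb) /= => ->.
  suff -> : a < k * t + c by [].
  by apply: (lt_trans ab); rewrite -Eb' ltrD2r ltr_pM2l.
have {}kn : k < 0 by rewrite lt_neqAle k0.
rewrite [leRHS]addeC; apply: leeD; [apply: IH2|apply: IH1] => t; have := E t;
    rewrite -Eb' ltrD2r ltr_nM2l //; last first.
  have [tb|_] := ltP b' t; rewrite ?andbT ?andbF // (lt_trans ab' tb) /= => ->.
  suff -> : k * t + c < d by rewrite andbT.
  by apply: lt_trans bd; rewrite -Eb' ltrD2r ltr_nM2l.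
have [tb|_] := ltP t b'; rewrite ?andbF //= (lt_trans tb bd') andbT => ->.
suff -> : a < k * t + c by [].
by apply: (lt_trans ab); rewrite -Eb' ltrD2r ltr_nM2l.
Qed.

End Curves.

(** * The Kobayashi pseudodistance *)

Section Distance.
Context {R : realType} {n : nat}.
Implicit Types (g : R -> 'rV[R[i]]_n) (D : set 'rV[R[i]]_n) (x y z : 'rV[R[i]]_n).
Local Notation kd := (@kobayashi_dist R n).

Lemma kd_ge0 D x y : (0 <= kd D x y)%E.
Proof.
apply: le_ereal_inf_tmp => _ [g _ <-]; rewrite kobayashi_lengthE.
exact: curve_length_ge0.
Qed.

Lemma kd_le_length D g a b : pw g a b -> (forall t, a <= t <= b -> D (g t)) ->
  (kd D (g a) (g b) <= curve_length D g a b)%E.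
Proof.
move=> pg gD; have ab := pw_lt pg; have k0 : 0 < b - a by rewrite subr_gt0.
apply: (@le_trans _ _ (curve_length D (fun t => g ((b - a) * t + a)) 0 1)); last first.
  apply: curve_length_reparam => //; first by rewrite gt_eqF.
  by move=> t; rewrite ltrDr pmulr_rgt0 // -ltrBrDr gtr_pMr.
apply: ereal_inf_lbound; exists (fun t => g ((b - a) * t + a)); last exact: kobayashi_lengthE.
split.
- by apply/piecewise_pw; apply: pw_reparam_pos pg _ _ _ => //; ring.
- move=> t /andP[t0 t1]; apply: gD; apply/andP; split.
    by rewrite lerDr mulr_ge0 // ltW.
  by rewrite -lerBrDr -{2}[b - a]mulr1 ler_pM2l.
- by rewrite mulr0 add0r.
- by rewrite mulr1 subrK.
Qed.

Lemma kd_curve D x y c : (kd D x y < c)%E -> exists g,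
  [/\ pw g 0 1, forall t, 0 <= t <= 1 -> D (g t), g 0 = x, g 1 = y
    & (curve_length D g 0%R 1%R < c)%E].
Proof.
move=> /ereal_inf_lt[_ [g [g1 g2 g3 g4] <-]]; rewrite kobayashi_lengthE => gc.
by exists g; split => //; exact/piecewise_pw.
Qed.

Lemma kd_sym_le D x y : (kd D x y <= kd D y x)%E.
Proof.
apply: le_ereal_inf_tmp => _ [g [/piecewise_pw g1 g2 g3 g4] <-].
rewrite kobayashi_lengthE.
have pg : pw (fun t => g (-1 * t + 1)) 0 1.
  by apply: pw_reparam_neg g1 _ _ _; rewrite ?ltrN10 //; ring.
apply: (@le_trans _ _ (curve_length D (fun t => g (-1 * t + 1)) 0 1)).
  have := @kd_le_length D _ _ _ pg; rewrite mulr0 add0r mulr1 addNr g3 g4; apply.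
  by move=> t t01; apply: g2; lra.
apply: curve_length_reparam g1 _ _; first by rewrite oppr_eq0 oner_eq0.
by move=> t; apply/andP/andP => -[? ?]; split; lra.
Qed.

Lemma kd_sym D x y : kd D x y = kd D y x.
Proof. by apply/eqP; rewrite eq_le !kd_sym_le. Qed.

Lemma kd_triangle D x y z : (kd D x z <= kd D x y + kd D y z)%E.
Proof.
have [xy|xy] := eqVneq (kd D x y) +oo%E.
  by rewrite xy addye ?leey // gt_eqF // (lt_le_trans _ (kd_ge0 _ _ _)) // ltNye.
have [yz|yz] := eqVneq (kd D y z) +oo%E.
  by rewrite yz addey ?leey // gt_eqF // (lt_le_trans _ (kd_ge0 _ _ _)) // ltNye.
have fxy : kd D x y \is a fin_num by rewrite ge0_fin_numE ?kd_ge0 // ltey.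
have fyz : kd D y z \is a fin_num by rewrite ge0_fin_numE ?kd_ge0 // ltey.
apply/lee_addgt0Pr => e e0; have e2 : 0 < e / 2 by rewrite divr_gt0.
have [|g1 [p1 d1 x1 y1 l1]] := @kd_curve D x y (kd D x y + (e / 2)%:E)%E.
  by rewrite lteDl // lte_fin.
have [|g2 [p2 d2 x2 y2 l2]] := @kd_curve D y z (kd D y z + (e / 2)%:E)%E.
  by rewrite lteDl // lte_fin.
(* The shift is written [1 * t + -1] to match the pattern [k * t + c] of the reparametrisation
   lemmas. *)
pose g t := if t <= 1 then g1 t else g2 (1 * t + -1).
have E1 t : 0 <= t <= 1 -> g1 t = g t by rewrite /g => /andP[_ ->].
have E2 t : 1 <= t <= 2 -> g2 (1 * t + -1) = g t.
  move=> /andP[t1 t2]; rewrite /g; case: leP => // t1'.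
  by rewrite (_ : t = 1) ?mulr1 ?subrr ?y1 // ; lra.
have q1 := pw_ext E1 p1.
have p2' : pw (fun t => g2 (1 * t + -1)) 1 2.
  by apply: pw_reparam_pos p2 _ _ _ => //; ring.
have q2 := pw_ext E2 p2'.
have gx : g 0 = x by rewrite /g ler01.
have gz : g 2 = z.
  by rewrite /g ifF; [rewrite -y2; congr g2; ring|apply/negbTE; rewrite -ltNge ltr1n].
have pg := pw_cat q1 q2.
have := @kd_le_length D _ _ _ pg; rewrite gx gz => H; apply: le_trans (H _) _ => {H}.
  move=> t t02; rewrite /g; case: leP => t1; first by apply: d1; lra.
  by apply: d2; lra.
rewrite (curve_length_cat D g (pw_lt q1) (pw_lt q2)).
rewrite -(curve_length_ext D p1 E1) -(curve_length_ext D p2' E2).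
have l2' : (curve_length D (fun t => g2 (1 * t + -1)%R) 1%R 2%R <= curve_length D g2 0%R 1%R)%E.
  apply: curve_length_reparam p2 _ _; first by rewrite oner_eq0.
  by move=> t; apply/andP/andP => -[? ?]; split; lra.
apply: le_trans (leeD (ltW l1) (le_trans l2' (ltW l2))) _.
by rewrite addeACA -EFinD -splitr.
Qed.

Lemma pw_segment x w : pw (fun t : R => x + t%:C *: (w - x)) 0 1.
Proof.
apply: pw_one => //; exists (fun t : R => x + t%:C *: (w - x)); split => //.
- by move=> t j; have /rderivP[] := rderiv_affine x (w - x) t.
- rewrite (_ : velocity _ = cst (w - x)); first exact: cst_continuous.
  by apply/funext => t; rewrite (rderiv_velocity (rderiv_affine _ _ _)).
Qed.

Lemma kd_segment D x w (c : R) :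
  (forall t : R, 0 <= t <= 1 -> D (x + t%:C *: (w - x)) /\
    (kobayashi_royden D (x + t%:C *: (w - x)) (w - x) <= c%:E)%E) ->
  (kd D x w <= c%:E)%E.
Proof.
move=> H; have := @kd_le_length D _ _ _ (pw_segment x w) (fun t t01 => (H t t01).1).
rewrite scale0r addr0 scale1r [x + _]addrC subrK => /le_trans; apply.
apply: (@le_trans _ _ (\int[lebesgue_measure]_(t in `]0%R, 1%R[) c%:E)%E).
  apply: le_integral_nomeas => t; first by move=> _; exact: KR_ge0.
  rewrite /= in_itv /= => /andP[t0 t1]; rewrite (rderiv_velocity (rderiv_affine _ _ _)).
  by apply: (H t _).2; rewrite !ltW.
rewrite integral_cst //= lebesgue_measure_itv /= lte_fin ltr01.
by rewrite -EFinB subr0 mule1.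
Qed.

Lemma kd_ball D x w (r : R) : 0 < r -> (forall u, nr (u - x) < 2 * r -> D u) ->
  nr (w - x) < r -> (kd D x w <= (nr (w - x) / r)%:E)%E.
Proof.
move=> r0 xD xw; apply: kd_segment => t /andP[t0 t1].
have tx : nr (x + t%:C *: (w - x) - x) < r.
  rewrite addrAC subrr add0r nrZ normc_real ger0_norm //.
  by apply: le_lt_trans xw; rewrite ler_piMl ?nr_ge0.
split; first by apply: xD; lra.
apply: KR_ball => // u ut; apply: xD.
by apply: le_lt_trans (nr_triangle (x + t%:C *: (w - x)) _ _) _; lra.
Qed.

Lemma kd_self D x : open D -> D x -> kd D x x = 0%E.
Proof.
move=> /open_nrP oD /oD[r r0 Hr]; apply/eqP; rewrite eq_le kd_ge0 andbT.
have r2 : 0 < r / 2 by rewrite divr_gt0.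
have := @kd_ball D x x (r / 2) r2; rewrite subrr nr0 mul0r; apply => // u.
by rewrite mulrC divfK //; exact: Hr.
Qed.

(** Small balls have finite distance to their centre, so the points at finite distance from [x] and
    those at infinite distance both form open sets; connectedness decides. *)
Lemma kd_fin D x y : domain D -> D x -> D y -> (kd D x y < +oo)%E.
Proof.
move=> [oD cD _] Dx Dy.
pose A := [set w | D w /\ (kd D x w < +oo)%E].
have loc w : D w -> exists2 r : R, 0 < r & forall u, nr (u - w) < r -> D u /\ (kd D w u < +oo)%E.
  move=> /((open_nrP D).1 oD)[r r0 Hr]; exists (r / 2) => [|u uw]; first by rewrite divr_gt0.
  split; first by apply: Hr; lra.
  apply: le_lt_trans (kd_ball _ _ uw) (ltey _); first by rewrite divr_gt0.
  by move=> v; rewrite mulrC divfK //; exact: Hr.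
have oA : open A.
  apply/open_nrP => w [Dw xw]; have [r r0 Hr] := loc w Dw; exists r => // u /Hr[Du wu].
  by split=> //; apply: le_lt_trans (kd_triangle D x w u) _; rewrite lte_add_pinfty.
have oB : open [set w | D w /\ ~ (kd D x w < +oo)%E].
  apply/open_nrP => w [Dw xw]; have [r r0 Hr] := loc w Dw; exists r => // u /Hr[Du wu].
  split=> // xu; apply: xw; apply: le_lt_trans (kd_triangle D x u w) _.
  by rewrite lte_add_pinfty // kd_sym.
suff : A = D by move=> AD; have [] : A y by rewrite AD.
apply: cD.
- by exists x; split=> //; rewrite kd_self // ltey.
- by exists A => //; apply/seteqP; split => w [].
- exists (~` [set w | D w /\ ~ (kd D x w < +oo)%E]); first exact: open_closedC.
  apply/seteqP; split => w /=; first by move=> [Dw xw]; split => // -[].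
  by move=> [Dw H]; split=> //; apply: contrapT => xw; apply: H.
Qed.

Lemma curve_ivt D g a b (phi : 'rV[R[i]]_n -> R) (v : R) : pw g a b ->
  (forall t, a <= t <= b -> D (g t)) ->
  (forall x, D x -> forall e : R, 0 < e -> exists2 r : R, 0 < r &
     forall w, nr (w - x) < r -> `|phi w - phi x| < e) ->
  phi (g a) <= v <= phi (g b) -> exists2 t, a <= t <= b & phi (g t) = v.
Proof.
move=> H + cphi; elim: H => {a b} [a b ab [h [/C1_rderiv dh _ gh]] gD|a b c p1 IH1 p2 IH2 gD] /andP[va vb].
  have lab := ltW ab.
  have [] := @IVT R (phi \o h) a b v lab.
  - apply: continuous_in_subspaceT => t; rewrite inE /= in_itv /= => tab.
    have Dt : D (h t) by rewrite -gh //; exact: gD.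
    apply/cvgrPdist_lt => e e0; have [r r0 Hr] := cphi _ Dt e e0.
    have r2 : 0 < r / 2 by rewrite divr_gt0.
    have [s s0 Hs] := rderiv_cont (dh t) r2.
    apply/nbhsRP; exists s => // u /ltW/Hs ut; rewrite distrC; apply: Hr.
    by apply: le_lt_trans ut _; lra.
  - rewrite /= -!gh ?lexx ?lab // ge_min va /=.
    by rewrite le_max vb orbT.
  - by move=> t; rewrite in_itv /= => tab <-; exists t => //=; rewrite gh.
have ab := pw_lt p1; have bc := pw_lt p2.
have [vb'|vb'] := leP v (phi (g b)).
  have [||t /andP[t1 t2] tv] := IH1; first by move=> t /andP[? ?]; apply: gD; lra.
    by rewrite va.
  by exists t => //; lra.
have [||t /andP[t1 t2] tv] := IH2; first by move=> t /andP[? ?]; apply: gD; lra.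
  by rewrite vb andbT ltW.
by exists t => //; lra.
Qed.

(** Here [u] is a potential: its differential is dominated by the metric, so its increment along a
    curve is at most the length. Its regularity is stated along curves, the form in which the chain
    rule provides it. *)
Lemma curve_length_lower D (u : 'rV[R[i]]_n -> R) (du : 'rV[R[i]]_n -> 'rV[R[i]]_n -> R) g a b :
  (forall h t v, D (h t) -> rderiv h t v -> is_derive t (1 : R) (u \o h) (du (h t) v)) ->
  (forall h, (forall t, rderiv h t (velocity h t)) -> continuous (velocity h) ->
    forall t, D (h t) -> {for t, continuous (fun s => du (h s) (velocity h s))}) ->
  (forall x v, D x -> (`|du x v|%:E <= kobayashi_royden D x v)%E) ->
  pw g a b -> (forall t, a <= t <= b -> D (g t)) ->
  (`|u (g b) - u (g a)|%:E <= curve_length D g a b)%E.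
Proof.
move=> U1 U2 U3; elim=> {a b} [a b ab [h [/C1_rderiv dh ch gh]] gD|a b c p1 IH1 p2 IH2 gD].
  have lab := ltW ab.
  have hD t : a <= t <= b -> D (h t) by move=> tab; rewrite -gh //; exact: gD.
  rewrite !gh ?lexx ?lab //.
  pose f t := du (h t) (velocity h t).
  have cf t : a <= t <= b -> {for t, continuous f} by move=> /hD; exact: U2.
  have df t : a <= t <= b -> is_derive t (1 : R) (u \o h) (f t) by move=> /hD Dt; exact: U1.
  have cfab : {within `[a, b], continuous f}.
    by apply: continuous_in_subspaceT => t; rewrite inE /= in_itv /=; exact: cf.
  have FTC : (\int[lebesgue_measure]_(t in `[a, b]) (f t)%:E = (u (h b))%:E - (u (h a))%:E)%E.
    apply: (@continuous_FTC2 R f (u \o h) a b ab cfab).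
      have cu t : a <= t <= b -> (u \o h) s @[s --> t] --> (u \o h) t.
        move=> /df[d _]; apply: differentiable_continuous; exact/derivable1_diffP.
      split.
      - move=> t; rewrite in_itv /= => /andP[t1 t2].
        have tab : a <= t <= b by rewrite !ltW.
        by have [] := df t tab.
      - by apply: cvg_at_right_filter; apply: cu; rewrite lexx.
      - by apply: cvg_at_left_filter; apply: cu; rewrite lexx lab.
    move=> t; rewrite in_itv /= => /andP[t1 t2]; rewrite derive1E.
    have tab : a <= t <= b by rewrite !ltW.
    by have [_ ->] := df t tab.
  have mf : measurable_fun `[a, b] f.
    exact: subspace_continuous_measurable_fun.
  rewrite -abse_EFin EFinB -FTC.
  apply: le_trans (le_abse_integral _ _ _) _ => //.
    by apply/measurable_EFinP.
  rewrite integral_oo_cc; last by move=> t.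
  apply: le_integral_nomeas => t // ; rewrite /= in_itv /= => /andP[t1 t2].
  have tab : a < t < b by rewrite t1.
  have tab' : a <= t <= b by rewrite !ltW.
  have -> : velocity g t = velocity h t.
    apply/rderiv_velocity; apply: (@rderiv_near _ _ h _ t _ (Num.min (t - a) (b - t))) => //.
      by rewrite lt_min !subr_gt0 t1.
    by move=> s; rewrite le_min !ler_norml => /andP[/andP[? ?] /andP[? ?]]; rewrite gh //; lra.
  by rewrite gh //; apply: U3; exact: hD.
have ab := pw_lt p1; have bc := pw_lt p2.
rewrite (curve_length_cat D g ab bc).
apply: (@le_trans _ _ (`|u (g b) - u (g a)|%:E + `|u (g c) - u (g b)|%:E)%E).
  rewrite -EFinD lee_fin (_ : u (g c) - u (g a) = u (g b) - u (g a) + (u (g c) - u (g b))).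
    exact: ler_normD.
  by ring.
by apply: leeD; [apply: IH1|apply: IH2] => t /andP[? ?]; apply: gD; lra.
Qed.

Lemma kd_lower D (u : 'rV[R[i]]_n -> R) (du : 'rV[R[i]]_n -> 'rV[R[i]]_n -> R) x y :
  (forall h t v, D (h t) -> rderiv h t v -> is_derive t (1 : R) (u \o h) (du (h t) v)) ->
  (forall h, (forall t, rderiv h t (velocity h t)) -> continuous (velocity h) ->
    forall t, D (h t) -> {for t, continuous (fun s => du (h s) (velocity h s))}) ->
  (forall x v, D x -> (`|du x v|%:E <= kobayashi_royden D x v)%E) ->
  (`|u y - u x|%:E <= kd D x y)%E.
Proof.
move=> U1 U2 U3; apply: le_ereal_inf_tmp => _ [g [/piecewise_pw g1 g2 <- <-] <-].
by rewrite kobayashi_lengthE; exact: (curve_length_lower U1 U2 U3).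
Qed.

End Distance.

Lemma kd_holo (R : realType) n m (D : set 'rV[R[i]]_n) (D' : set 'rV[R[i]]_m) F x y :
  open D -> holomorphic_on D F -> (forall w, D w -> D' (F w)) ->
  (kobayashi_dist D' (F x) (F y) <= kobayashi_dist D x y)%E.
Proof.
move=> oD hF FD; apply: le_ereal_inf_tmp => _ [g [/piecewise_pw g1 g2 <- <-] <-].
rewrite kobayashi_lengthE.
have pF a b : pw g a b -> (forall t, a <= t <= b -> D (g t)) -> pw (F \o g) a b /\
    (curve_length D' (F \o g) a b <= curve_length D g a b)%E.
  elim=> {a b} [a b ab Cg gD|a b c p1 IH1 p2 IH2 gD].
    split; first by apply: pw_one => //; exact: C1_comp hF ab Cg gD.
    apply: le_integral_nomeas => t; first by move=> _; exact: KR_ge0.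
    rewrite /= in_itv /= => tab; have /andP[t1 t2] := tab.
    have Dt : D (g t) by apply: gD; rewrite !ltW.
    by rewrite (velocity_comp Cg tab (hF _ Dt)); exact: KR_holo.
  have ab := pw_lt p1; have bc := pw_lt p2.
  have [|q1 l1] := IH1; first by move=> t /andP[? ?]; apply: gD; lra.
  have [|q2 l2] := IH2; first by move=> t /andP[? ?]; apply: gD; lra.
  split; first exact: pw_cat q2.
  rewrite (curve_length_cat D' _ ab bc) (curve_length_cat D g ab bc).
  exact: leeD.
have [q l] := pF 0 1 g1 g2.
apply: le_trans (kd_le_length q _) l.
by move=> t /g2; exact: FD.
Qed.

(** * Hopf-Rinow: compact balls and geodesics for a complete length metric *)

Section HopfRinow.
Context {R : realType} {n : nat}.
Local Notation T := 'rV[R[i]]_n.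
Context (X : set T) (d : T -> T -> R) (M : R).
Context (d_ge0 : forall x y, 0 <= d x y).
Context (d_self : forall x, X x -> d x x = 0).
Context (d_sym : forall x y, d x y = d y x).
Context (d_tri : forall x y z, X x -> X y -> X z -> d x z <= d x y + d y z).
Context (M_gt0 : 0 < M).
Context (d_nr : forall x y, X x -> X y -> nr (y - x) <= M * d x y).
Context (nr_d : forall x, X x -> forall e : R, 0 < e -> exists2 r : R, 0 < r &
  forall y, nr (y - x) < r -> X y /\ d x y < e).
Context (d_complete : forall u : nat -> T, (forall k, X (u k)) ->
  (forall e : R, 0 < e -> exists N, forall k l, (N <= k)%N -> (N <= l)%N -> d (u k) (u l) < e) ->
  exists2 z, X z & forall e : R, 0 < e -> exists N, forall k, (N <= k)%N -> d (u k) z < e).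
Context (d_length : forall x y, X x -> X y -> forall s, 0 <= s <= d x y ->
  forall e : R, 0 < e -> exists z, [/\ X z, d x z = s & d z y <= d x y - s + e]).

Definition cball (x : T) (r : R) : set T := [set y | X y /\ d x y <= r].

Lemma finite_cover (K : set T) (delta : T -> R) : compact K ->
  (forall z, K z -> 0 < delta z) ->
  exists s : seq T, (forall z, z \in s -> K z) /\
    forall y, K y -> exists2 z, z \in s & nr (y - z) < delta z.
Proof.
rewrite compact_cover => cK dK.
have [||D' D'K KD'] := cK T K (fun z => [set y | nr (y - z) < delta z]).
- move=> z _; apply/open_nrP => y /= yz; exists (delta z - nr (y - z)); first by rewrite subr_gt0.
  by move=> w wy; apply: le_lt_trans (nr_triangle y _ _) _; lra.
- by move=> z Kz; exists z => //=; rewrite subrr nr0; exact: dK.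
exists (finmap.enum_fset D'); split; first by move=> z /D'K; rewrite inE.
by move=> y /KD'[z zD yz]; exists z.
Qed.

Definition totally_d_bounded (A : set T) := forall e : R, 0 < e ->
  exists s : seq T, (forall z, z \in s -> X z) /\
    forall y, A y -> exists2 z, z \in s & d z y < e.

Lemma compact_totally_bounded (K : set T) : compact K -> K `<=` X -> totally_d_bounded K.
Proof.
move=> cK KX e e0.
have H z : exists r : R, K z -> 0 < r /\ forall y, nr (y - z) < r -> d z y < e.
  have [Kz|nKz] := pselect (K z); last by exists 0.
  by have [r r0 Hr] := nr_d (KX _ Kz) e0; exists r => _; split=> // y /Hr[].
have [delta Hd] := choice H.
have [|s [sK sc]] := @finite_cover K delta cK; first by move=> z /Hd[].
exists s; split; first by move=> z /sK/KX.
move=> y Ky; have [z zs yz] := sc y Ky; exists z => //.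
by have [_] := Hd z (sK z zs); exact.
Qed.

Lemma half_pow_lt (e : R) : 0 < e -> exists k : nat, 2^-1 ^+ k < e.
Proof.
move=> e0; exists (Num.bound e^-1); rewrite exprVn invf_plt ?posrE ?exprn_gt0 //.
have := @archi_boundP _ e^-1; rewrite invr_ge0 => /(_ (ltW e0))/lt_le_trans; apply.
by rewrite -natrX ler_nat ltnW // ltn_expl.
Qed.

Lemma half_pow_le (k l : nat) : (k <= l)%N -> 2^-1 ^+ l <= 2^-1 ^+ k :> R.
Proof.
move=> kl; rewrite !exprVn lef_pV2 ?posrE ?exprn_gt0 //.
by rewrite ler_eXn2l // ltr1n.
Qed.

Lemma ultra_finite_union (F : set_system T) (s : seq T) (B : T -> set T) (A : set T) :
  UltraFilter F -> F A -> (forall y, A y -> exists2 z, z \in s & B z y) ->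
  exists2 z, z \in s & F (B z).
Proof.
move=> UF; elim: s A => [|z s IH] A FA H.
  have AA : A `<=` set0 by move=> y /H[].
  by case: (@filter_not_empty _ F _ (filterS AA FA)).
have [FB|FB] := in_ultra_setVsetC (B z) UF.
  by exists z => //; rewrite mem_head.
have [|w ws FBw] := IH _ (filterI FA FB).
  move=> y [/H[w + Bw] nBz]; rewrite inE => /predU1P[wz|ws]; last by exists w.
  by case: nBz; rewrite -wz.
by exists w => //; rewrite inE ws orbT.
Qed.

(** For every k an ultrafilter on [A] contains one of finitely many balls of radius 2^-k. Points
    taken from the intersections of the first of these balls form a Cauchy sequence, and the
    ultrafilter converges to its limit. *)
Lemma totally_bounded_compact (A : set T) : totally_d_bounded A -> A `<=` X ->
  (forall z, X z -> (forall e : R, 0 < e -> exists2 y, A y & d y z < e) -> A z) ->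
  compact A.
Proof.
move=> tbA AX Acl; rewrite compact_ultra => F UF FA.
have Hz k : exists z, X z /\ F [set y | d z y < 2^-1 ^+ k].
  have [|s [sX sA]] := tbA (2^-1 ^+ k); first by rewrite exprn_gt0.
  have [z zs Fz] := ultra_finite_union (B := fun z => [set y | d z y < 2^-1 ^+ k]) UF FA sA.
  by exists z; split=> //; exact: sX.
have [z {}Hz] := choice Hz.
have FB k : F [set y | A y /\ forall j, (j <= k)%N -> d (z j) y < 2^-1 ^+ j].
  elim: k => [|k IH].
    have [_ F0] := Hz 0%N; apply: filterS (filterI FA F0) => y [Ay zy]; split=> // j.
    by rewrite leqn0 => /eqP ->.
  have [_ Fk] := Hz k.+1; apply: filterS (filterI IH Fk) => y [[Ay zy] zky]; split=> // j.
  by rewrite leq_eqVlt => /predU1P[->//|]; rewrite ltnS; exact: zy.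
have Hu k : exists y, A y /\ forall j, (j <= k)%N -> d (z j) y < 2^-1 ^+ j.
  by have [y Hy] := filter_ex (FB k); exists y.
have [u {}Hu] := choice Hu.
have Xu k : X (u k) by apply: AX; have [] := Hu k.
have [|w Xw uw] := d_complete Xu.
  move=> e e0; have [N HN] := half_pow_lt (divr_gt0 e0 (ltr0Sn R 1)).
  exists N => k l Nk Nl; have [_ /(_ N Nk) h1] := Hu k; have [_ /(_ N Nl) h2] := Hu l.
  have := d_tri (Xu k) (Hz N).1 (Xu l); rewrite (d_sym (u k) (z N)); lra.
exists w; split.
  apply: Acl => // e e0; have [N HN] := uw e e0.
  by exists (u N); [have [] := Hu N|exact: HN].
move=> U /nbhs_nrP[e e0 eU].
have e4 : 0 < e / M / 3 by rewrite !divr_gt0.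
have [N HN] := half_pow_lt e4; have [N2 HN2] := uw _ e4.
apply: filterS (FB N) => y [Ay zy]; apply: eU.
have k1 : (N <= maxn N N2)%N by rewrite leq_maxl.
have k2 : (N2 <= maxn N N2)%N by rewrite leq_maxr.
have [_ /(_ N k1) h1] := Hu (maxn N N2); have h2 := HN2 _ k2; have h3 := zy N (leqnn N).
apply: le_lt_trans (d_nr Xw (AX _ Ay)) _.
rewrite mulrC -ltr_pdivlMr // d_sym.
have t1 := d_tri (AX _ Ay) (Hz N).1 Xw; have t2 := d_tri (Hz N).1 (Xu (maxn N N2)) Xw.
rewrite d_sym in h3; lra.
Qed.

Lemma cball_dclosed x r z : X x -> X z ->
  (forall e : R, 0 < e -> exists2 y, cball x r y & d y z < e) -> cball x r z.
Proof.
move=> Xx Xz H; split=> //; apply/ler_addgt0Pr => e /H[y [Xy xy] yz].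
have := d_tri Xx Xy Xz; lra.
Qed.

Lemma nr_hausdorff : hausdorff_space T.
Proof.
move=> x y cxy; apply/eqP; rewrite eq_sym -subr_eq0 -nr_eq0 eq_le nr_ge0 andbT leNgt.
apply/negP => e0; have e2 : 0 < nr (y - x) / 2 by rewrite divr_gt0.
have [z [/= zx zy]] := cxy _ _ (nr_near x e2) (nr_near y e2).
by have := nr_triangle z y x; rewrite (nrB y z); lra.
Qed.

Lemma cball_sub_compact (C : set T) x r : X x -> compact C -> C `<=` X ->
  cball x r `<=` C -> compact (cball x r).
Proof.
move=> Xx cC CX rC; apply: (subclosed_compact _ cC rC).
rewrite closure_id; apply/seteqP; split; first exact: subset_closure.
move=> y cy.
have Xy : X y.
  apply: CX; have : closed C by exact: (compact_closed nr_hausdorff cC).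
  by rewrite closure_id => ->; exact: closure_subset cy.
apply: cball_dclosed => // e e0; have [s s0 Hs] := nr_d Xy e0.
have [w rw wy] := (closure_nrP _ _).1 cy s s0.
by exists w => //; rewrite d_sym; have [] := Hs w wy.
Qed.

Lemma local_compact x : X x -> exists2 r : R, 0 < r & compact (cball x r).
Proof.
move=> Xx; have [s s0 Hs] := nr_d Xx ltr01.
pose C := [set y : T | nr (y - x) <= s / 2].
have CX : C `<=` X.
  move=> y /= yx; have [] := Hs y _ => //; apply: le_lt_trans yx _; lra.
have cC : compact C.
  apply: closed_bounded_compact.
    apply/bounded_nrP; exists (s / 2 + nr x + 1); first by rewrite addr_gt0 // ltr_wpDr ?nr_ge0 // divr_gt0.
    move=> y yx; have := le_nrB y x; rewrite /C /= in yx; lra.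
  rewrite closure_id; apply/seteqP; split; first exact: subset_closure.
  move=> y cy; rewrite /C /=; apply/ler_addgt0Pr => e e0.
  have [w rw wy] := (closure_nrP _ _).1 cy e e0.
  apply: le_trans (nr_triangle w _ _) _; rewrite nrB in wy; rewrite /C /= in rw; lra.
exists (s / 2 / M); first by rewrite !divr_gt0.
apply: (cball_sub_compact Xx cC CX) => y [Xy xy]; rewrite /C /=.
by apply: le_trans (d_nr Xx Xy) _; rewrite mulrC -ler_pdivlMr.
Qed.

Lemma bigU_compact (s : seq T) (f : T -> set T) : (forall z, z \in s -> compact (f z)) ->
  compact [set y | exists2 z, z \in s & f z y].
Proof.
elim: s => [|z s IH] H.
  rewrite (_ : mkset _ = set0); first exact: compact0.
  by apply/seteqP; split => y // [].
rewrite (_ : mkset _ = f z `|` [set y | exists2 z, z \in s & f z y]).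
  apply: compactU; first by apply: H; rewrite mem_head.
  by apply: IH => w ws; apply: H; rewrite inE ws orbT.
apply/seteqP; split => y /=.
  by move=> [w]; rewrite inE => /predU1P[-> ?|ws ?]; [left|right; exists w].
move=> [fy|[w ws fy]]; first by exists z => //; rewrite mem_head.
by exists w => //; rewrite inE ws orbT.
Qed.

(** The ball is covered by finitely many small balls whose doubles are compact. By the length
    property each point of the ball of radius r + eta is within 2 eta of the original ball, hence
    inside one of the doubles. *)
Lemma cball_grow x r : X x -> 0 <= r -> compact (cball x r) ->
  exists2 eta : R, 0 < eta & compact (cball x (r + eta)).
Proof.
move=> Xx r0 cr.
have H z : exists q : R * R, cball x r z -> [/\ 0 < q.1, 0 < q.2, compact (cball z (2 * q.1)) &
    forall y, nr (y - z) < q.2 -> X y /\ d z y < q.1].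
  have [[Xz xz]|nz] := pselect (cball x r z); last by exists (0, 0).
  have [r1 r10 c1] := local_compact Xz.
  have [r2 r20 H2] := nr_d Xz (divr_gt0 r10 (ltr0Sn R 1)).
  exists (r1 / 2, r2) => _ /=; split => //; first by rewrite divr_gt0.
  by rewrite mulrC divfK.
have [q Hq] := choice H.
have [|s [sK sc]] := @finite_cover _ (fun z => (q z).2) cr; first by move=> z /Hq[].
have [eta eta0 etas] : exists2 eta : R, 0 < eta & forall z, z \in s -> eta <= (q z).1 / 2.
  have q0 z : z \in s -> 0 < (q z).1 by move=> /sK/Hq[].
  elim: (s) q0 => [|z s' IH] q0; first by exists 1.
  have [|eta eta0 He] := IH; first by move=> w ws; apply: q0; rewrite inE ws orbT.
  exists (Num.min eta ((q z).1 / 2)); first by rewrite lt_min eta0 divr_gt0 // q0 // mem_head.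
  move=> w; rewrite inE ge_min => /predU1P[->|/He ->//]; by rewrite lexx orbT.
exists eta => //.
pose C := [set y | exists2 z, z \in s & cball z (2 * (q z).1) y].
have cC : compact C by apply: bigU_compact => z /sK/Hq[].
apply: (cball_sub_compact Xx cC); first by move=> y [z _ []].
move=> y [Xy xy].
have [w [Xw xw wy]] : exists w, [/\ X w, d x w <= r & d w y <= 2 * eta].
  have [xyr|rxy] := leP (d x y) r.
    by exists y; split => //; rewrite d_self // mulr_ge0 // ltW.
  have [|w [Xw xw wy]] := d_length Xx Xy _ eta0 (s := r); first by rewrite r0 ltW.
  by exists w; rewrite xw; split => //; lra.
have [z zs wz] := sc w (conj Xw xw).
have [q1 _ _ q4] := Hq z (sK z zs); have [_ zw] := q4 w wz.
exists z => //; split => //.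
have Xz : X z by have [] := sK z zs.
have := d_tri Xz Xw Xy; have := etas z zs; lra.
Qed.

(** By the length property every point of the ball of radius rho is close to a slightly smaller
    ball, which is compact and has finite nets; so the large ball has them too. *)
Lemma cball_sup x rho : X x -> 0 < rho -> (forall r, 0 <= r -> r < rho -> compact (cball x r)) ->
  compact (cball x rho).
Proof.
move=> Xx rho0 H; apply: totally_bounded_compact.
- move=> e e0; pose e4 := Num.min (e / 4) (rho / 2).
  have e40 : 0 < e4 by rewrite lt_min !divr_gt0.
  have e4e : e4 <= e / 4 by rewrite ge_min lexx.
  have e4r : e4 <= rho / 2 by rewrite ge_min lexx orbT.
  have r0 : 0 <= rho - e4 by lra.
  have cr : compact (cball x (rho - e4)) by apply: H => //; lra.
  have [s [sX sc]] := compact_totally_bounded cr (fun y (p : cball x (rho - e4) y) => p.1) (divr_gt0 e0 (ltr0Sn R 3)).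
  exists s; split=> // y [Xy xy].
  have [xyr|rxy] := leP (d x y) (rho - e4).
    by have [z zs zy] := sc y (conj Xy xyr); exists z => //; lra.
  have [|w [Xw xw wy]] := d_length Xx Xy _ e40 (s := rho - e4); first by rewrite r0 ltW.
  have [|z zs zw] := sc w _; first by split => //; rewrite xw.
  exists z => //; have := d_tri (sX z zs) Xw Xy; lra.
- by move=> y [].
- by move=> z Xz; exact: cball_dclosed.
Qed.

Lemma cball_mono x r r' : X x -> compact (cball x r') -> r <= r' -> compact (cball x r).
Proof.
move=> Xx cr' rr'; apply: (cball_sub_compact Xx cr'); first by move=> y [].
by move=> y [Xy xy]; split=> //; exact: le_trans xy rr'.
Qed.

(** If some ball is not compact, the radii of compact balls have a supremum; [cball_sup] shows that
    it is attained and [cball_grow] that it is exceeded. *)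
Lemma hopf_rinow x r : X x -> compact (cball x r).
Proof.
move=> Xx; apply: contrapT => nr1.
pose G := [set r : R | 0 <= r /\ compact (cball x r)].
have [r2 r20 cr2] := local_compact Xx.
have Gr2 : G r2 by split=> //; exact: ltW.
have ubG : ubound G r.
  move=> t [_ ct]; rewrite leNgt; apply/negP => rt; apply: nr1.
  by apply: cball_mono ct (ltW rt).
have hs : has_sup G by split; [exists r2|exists r].
have rho0 : 0 < sup G by apply: lt_le_trans r20 _; by apply: ub_le_sup => //; exists r.
have crho : compact (cball x (sup G)).
  apply: cball_sup => // t t0 ts.
  have e0 : 0 < sup G - t by rewrite subr_gt0.
  have [u [u0 cu] tu] := sup_adherent e0 hs.
  by apply: cball_mono cu _ => //; rewrite subKr in tu; exact: ltW.
have [eta eta0 ce] := cball_grow Xx (ltW rho0) crho.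
have : sup G + eta <= sup G.
  by apply: ub_le_sup; [exists r|split => //; rewrite addr_ge0 // ltW].
by rewrite gerDl leNgt eta0.
Qed.

(** The approximate points with error 2^-k lie in the ball of radius [s], now known to be compact,
    and a cluster point has no error left. *)
Lemma exact_point x y s : X x -> X y -> 0 <= s <= d x y ->
  exists z, [/\ X z, d x z = s & d z y = d x y - s].
Proof.
move=> Xx Xy sxy.
have Hk (k : nat) : exists z, [/\ X z, d x z = s & d z y <= d x y - s + 2^-1 ^+ k].
  by apply: d_length => //; rewrite exprn_gt0.
have [u Hu] := choice Hk.
have cK := @hopf_rinow x s Xx.
have [|z [[Xz xz] clz]] := cK (u @ \oo) _.
  by exists 0%N => // k _ /=; have [Xk xk _] := Hu k; split; rewrite ?xk.
have near (e : R) (N : nat) : 0 < e -> exists2 k, (N <= k)%N & d z (u k) < e.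
  move=> e0; have [r r0 Hr] := nr_d Xz e0.
  have [|_ [[k /= Nk <-] /Hr[_ zk]]] := clz (u @` [set k | (N <= k)%N]) _ _ (nr_near z r0).
    by exists N => // k Nk; exists k.
  by exists k.
have xs : d x z = s.
  apply/eqP; rewrite eq_le; apply/andP; split; apply/ler_addgt0Pr => e e0; have [k _ zk] := near e 0%N e0.
    by have [Xk <- _] := Hu k; have := d_tri Xx Xk Xz; rewrite (d_sym (u k)); lra.
  by have [Xk <- _] := Hu k; have := d_tri Xx Xz Xk; lra.
exists z; split => //; apply/eqP; rewrite eq_le; apply/andP; split.
  apply/ler_addgt0Pr => e e0; have e2 : 0 < e / 2 by rewrite divr_gt0.
  have [N HN] := half_pow_lt e2; have [k Nk zk] := near _ N e2.
  have [Xk _ ky] := Hu k; have := d_tri Xz Xk Xy; have := half_pow_le Nk; lra.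
by have := d_tri Xx Xz Xy; lra.
Qed.

Lemma geodesic_chain m x y (h : R) : 0 <= h -> X x -> X y -> d x y = m%:R * h ->
  exists c : nat -> T, [/\ c 0%N = x, c m = y, forall j, (j <= m)%N -> X (c j) &
    forall j k, (j <= k)%N -> (k <= m)%N -> d (c j) (c k) = (k - j)%:R * h].
Proof.
move=> h0; elim: m x y => [|m IH] x y Xx Xy xy.
  have E : x = y.
    apply/eqP; rewrite eq_sym -subr_eq0 -nr_eq0 eq_le nr_ge0 andbT.
    by have := d_nr Xx Xy; rewrite xy mul0r mulr0.
  exists (fun=> x); split => // j k jk; rewrite leqn0 => /eqP k0.
  by move: jk; rewrite k0 leqn0 => /eqP ->; rewrite d_self // mul0r.
have [|z [Xz xz zy]] := @exact_point x y h Xx Xy.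
  by rewrite h0 xy -natr1 mulrDl mul1r lerDr mulr_ge0.
have [|c [c0 cm cX cd]] := IH z y Xz Xy.
  by rewrite zy xy -natr1 mulrDl mul1r addrK.
have xc j : (j <= m)%N -> d x (c j) = j.+1%:R * h.
  move=> jm; apply/eqP; rewrite eq_le; apply/andP; split.
    have zc : d z (c j) = j%:R * h by rewrite -c0 cd // subn0.
    have := d_tri Xx Xz (cX j jm); rewrite xz zc -natr1 mulrDl mul1r; lra.
  have cy : d (c j) y = (m - j)%:R * h by rewrite -cm cd.
  have := d_tri Xx (cX j jm) Xy; rewrite xy cy natrB // -natr1 -(natr1 j); lra.
exists (fun j => if j is j'.+1 then c j' else x); split => //.
  by case=> // j; exact: cX.
case=> [|j] [|k] //=.
- by rewrite d_self // mul0r.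
- by rewrite subn0 => _; exact: xc.
- by rewrite !ltnS subSS; exact: cd.
Qed.

(** Step functions along chains of N + 1 equal steps are isometric up to 2 L / (N + 1). A cluster
    point in the product topology suffices as a limit, because the isometry condition involves only
    two times at once. *)
Lemma geodesic_exists x y : X x -> X y -> exists g : R -> T,
  [/\ g 0 = x, g (d x y) = y, forall t, 0 <= t <= d x y -> X (g t)
    & forall s t, 0 <= s <= d x y -> 0 <= t <= d x y -> d (g s) (g t) = `|s - t|].
Proof.
move=> Xx Xy; set L := d x y.
have L0 : 0 <= L by exact: d_ge0.
have [L_eq0|L_neq0] := eqVneq L 0.
  have [c [c0 _ _ _]] := @geodesic_chain 0 x y 0 (lexx 0) Xx Xy (etrans L_eq0 (esym (mul0r _))).
  exists (fun=> x); split => //.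
  - apply/eqP; rewrite eq_sym -subr_eq0 -nr_eq0 eq_le nr_ge0 andbT.
    by have := d_nr Xx Xy; rewrite -/L L_eq0 mulr0.
  - move=> s t; rewrite L_eq0 => /le_anti <- /le_anti <-.
    by rewrite d_self // subrr normr0.
have Lp : 0 < L by rewrite lt_neqAle eq_sym L_neq0.
have Hg (N : nat) : exists g : R -> T, [/\ g 0 = x, g L = y,
    forall t, cball x L (g t) &
    forall s t, 0 <= s <= L -> 0 <= t <= L -> `|d (g s) (g t) - `|s - t| | <= 2 * (L / N.+1%:R)].
  pose h := L / N.+1%:R; have h0 : 0 < h by rewrite divr_gt0.
  have Nh : N.+1%:R * h = L by rewrite /h mulrC divfK.
  have [c [c0 cm cX cd]] := @geodesic_chain N.+1 x y h (ltW h0) Xx Xy (esym Nh).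
  (* The cap keeps the step function in the compact ball also for times beyond [L], as the product
     over all of [R] requires. *)
  pose p t := minn (Num.truncn (t / h)) N.+1.
  have pN t : (p t <= N.+1)%N by rewrite geq_minr.
  have pt t : 0 <= t <= L -> (p t)%:R * h <= t < (p t)%:R * h + h.
    move=> /andP[t0 tL].
    have th : 0 <= t / h by rewrite divr_ge0 // ltW.
    have /andP[q1 q2] := truncn_itv th.
    have qN : (Num.truncn (t / h) <= N.+1)%N.
      by rewrite -(ler_nat R); apply: le_trans q1 _; rewrite ler_pdivrMr // Nh.
    rewrite /p (minn_idPl qN) -ler_pdivlMr // q1 /=.
    by rewrite -[X in _ + X]mul1r -mulrDl natr1 -ltr_pdivrMr.
  exists (fun t => c (p t)); split.
  - by rewrite /p mul0r truncn0 min0n c0.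
  - by rewrite /p (_ : L / h = N.+1%:R) ?natrK ?minnn // -Nh mulfK // gt_eqF.
  - move=> t; split; first exact: cX.
    rewrite -{1}c0 cd // subn0 -[leRHS]Nh ler_pM2r // ler_nat; exact: pN.
  - move=> s t /pt/andP[s1 s2] /pt/andP[t1 t2]; rewrite -/h.
    have D : d (c (p s)) (c (p t)) = `|(p s)%:R * h - (p t)%:R * h|.
      have [pst|/ltnW pst] := leqP (p s) (p t).
        rewrite cd // natrB // mulrBl distrC ger0_norm // subr_ge0 ler_pM2r // ler_nat //.
      rewrite d_sym cd // natrB // mulrBl ger0_norm // subr_ge0 ler_pM2r // ler_nat //.
    rewrite D; apply: le_trans (ler_dist_dist _ _) _.
    rewrite ler_norml; apply/andP; split; lra.
have [g {}Hg] := choice Hg.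
have cK : compact (cball x L) := @hopf_rinow x L Xx.
have cP := @tychonoff R (fun=> T) (fun=> cball x L) (fun=> cK).
have [|f [Kf clf]] := cP ((fun N => g N : forall _ : R, T) @ \oo) _.
  by exists 0%N => // N _ /= t; have [_ _ + _] := Hg N; exact.
have pick (s t : R) (e : R) (N0 : nat) : 0 < e -> exists N, [/\ (N0 <= N)%N,
    d (f s) (g N s) < e & d (f t) (g N t) < e].
  move=> e0; have [Xs _] := Kf s; have [Xt _] := Kf t.
  have [r1 r10 H1] := nr_d Xs e0; have [r2 r20 H2] := nr_d Xt e0.
  pose B : set (forall _ : R, T) := (fun q => q s) @^-1` [set y | nr (y - f s) < r1] `&`
    (fun q => q t) @^-1` [set y | nr (y - f t) < r2].
  have nB : nbhs (f : prod_topology (fun _ : R => T)) B.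
    apply: (@filterI _ (nbhs (f : prod_topology (fun _ : R => T)))).
      exact: (@proj_continuous R (fun=> T) s f _ (nr_near (f s) r10)).
    exact: (@proj_continuous R (fun=> T) t f _ (nr_near (f t) r20)).
  have [|_ [[N /= NN <-] [/H1[_ b1] /H2[_ b2]]]] :=
    clf ((fun N => g N : forall _ : R, T) @` [set N | (N0 <= N)%N]) B _ nB.
    by exists N0 => // N NN; exists N.
  by exists N.
have smallL (e : R) : 0 < e -> exists N0 : nat, forall N, (N0 <= N)%N -> 2 * (L / N.+1%:R) <= e.
  move=> e0; exists (Num.bound (2 * L / e)) => N NN.
  rewrite mulrA ler_pdivrMr // [leRHS]mulrC -ler_pdivrMr //.
  have := @archi_boundP _ (2 * L / e); rewrite divr_ge0 ?mulr_ge0 ?(ltW e0) // => /(_ isT)/ltW/le_trans; apply.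
  by rewrite ler_nat; apply: leq_trans NN _.
have fX t : X (f t) by have [] := Kf t.
have gX N t : X (g N t) by have [_ _ /(_ t)[]] := Hg N.
have fix_pt t z : X z -> (forall N, g N t = z) -> f t = z.
  move=> Xz gz; apply/eqP; rewrite -subr_eq0 -nr_eq0 eq_le nr_ge0 andbT.
  apply/ler_addgt0Pr => e e0; rewrite add0r.
  have [N [_ + _]] := pick t t _ 0%N (divr_gt0 e0 M_gt0); rewrite gz d_sym => zf.
  by apply: le_trans (d_nr Xz (fX t)) _; rewrite mulrC -ler_pdivlMr // ltW.
exists f; split.
- by apply: fix_pt => // N; have [] := Hg N.
- by apply: fix_pt => // N; have [] := Hg N.
- by move=> t _.
- move=> s t sL tL; apply/eqP; rewrite -subr_eq0 -normr_eq0 eq_le normr_ge0 andbT.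
  apply/ler_addgt0Pr => e e0; rewrite add0r.
  have e3 : 0 < e / 3 by rewrite divr_gt0.
  have [N0 HN0] := smallL _ e3.
  have [N [NN h1 h2]] := pick s t _ N0 e3; have h3 := HN0 N NN.
  have [_ _ _ /(_ s t sL tL)] := Hg N.
  have t1 := d_tri (fX s) (gX N s) (fX t); have t2 := d_tri (gX N s) (gX N t) (fX t).
  have t3 := d_tri (gX N s) (fX s) (gX N t); have t4 := d_tri (fX s) (fX t) (gX N t).
  rewrite (d_sym (g N t) (f t)) in t2; rewrite (d_sym (g N s) (f s)) in t3.
  move: h3; move: (2 * _) => Q h3; rewrite !ler_norml => /andP[? ?]; apply/andP; split; lra.
Qed.

End HopfRinow.

(** * The Kobayashi distance on bounded and complete hyperbolic domains *)

Section KobayashiDistance.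
Context {R : realType} {n : nat}.
Local Notation T := 'rV[R[i]]_n.
Local Notation kd := kobayashi_dist.
Local Notation KR := kobayashi_royden.

Definition dk (D : set T) (x y : T) : R := fine (kd D x y).

(** Cauchy's estimate for the coordinates of a disc in a bounded domain; it makes the Kobayashi
    metric dominate a multiple of the norm. *)
Lemma coord_KR (D : set T) (M : R) (j : 'I_n) (x v : T) : 0 < M -> (forall w, D w -> nr w <= M) ->
  ((normc (v 0 j) / (cauchy_constant R * M))%:E <= KR D x v)%E.
Proof.
move=> M0 DM; apply: KR_lb => phi xi hphi phiD p0 pv.
have c0 := cauchy_constant_gt0 R.
rewrite ler_pdivrMr ?mulr_gt0 // -pv diff_line mxE normcM.
apply: ler_wpM2l; first exact: normc_ge0.
rewrite -[leRHS]divr1; apply: (cauchy_disc (f := fun z => phi z 0 j) (z0 := 0) ltr01).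
- move=> z; rewrite subr0 => z1; exact: (@ex_derive _ _ _ _ _ _ _ (diff_coord j (hphi z z1))).
- move=> z; rewrite subr0 => z1; apply: le_trans (normc_le_nr _ _) _; exact: DM (phiD _ z1).
- exact: diff_coord (hphi 0 (unit_disc0 R)).
Qed.

Lemma dkE (D : set T) (x y : T) : domain D -> D x -> D y -> kd D x y = (dk D x y)%:E.
Proof. by move=> dD Dx Dy; rewrite /dk fineK // ge0_fin_numE ?kd_ge0 // kd_fin. Qed.

Lemma dk_ge0 (D : set T) (x y : T) : 0 <= dk D x y.
Proof. exact: fine_ge0 (kd_ge0 _ _ _). Qed.

Lemma dk_sym (D : set T) (x y : T) : dk D x y = dk D y x.
Proof. by rewrite /dk kd_sym. Qed.

Lemma dk_triangle (D : set T) (x y z : T) : domain D -> D x -> D y -> D z ->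
  dk D x z <= dk D x y + dk D y z.
Proof. by move=> dD Dx Dy Dz; have := kd_triangle D x y z; rewrite !dkE // lee_fin. Qed.

Lemma dk_self (D : set T) (x : T) : open D -> D x -> dk D x x = 0.
Proof. by move=> oD Dx; rewrite /dk kd_self. Qed.

(** To be used with the real and the imaginary part for [f]: the corresponding real coordinate,
    suitably scaled, is a potential for [kd_lower]. *)
Lemma coord_dk (f : R[i] -> R) (D : set T) (M : R) (j : 'I_n) (x y : T) :
  continuous f -> (forall h t v, rderiv h t v -> is_derive t (1 : R) (f \o h) (f v)) ->
  (forall z, `|f z| <= normc z) -> 0 < M -> (forall w, D w -> nr w <= M) ->
  domain D -> D x -> D y ->
  `|f (y 0 j) - f (x 0 j)| <= cauchy_constant R * M * dk D x y.
Proof.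
move=> fc fd f1 M0 DM dD Dx Dy.
have c0 : 0 < cauchy_constant R * M by rewrite mulr_gt0 // cauchy_constant_gt0.
have := @kd_lower R n D (fun x => (cauchy_constant R * M)^-1 * f (x 0 j))
  (fun _ v => (cauchy_constant R * M)^-1 * f (v 0 j)) x y.
rewrite -mulrBr normrM ger0_norm ?invr_ge0 ?(ltW c0) // dkE // lee_fin ler_pdivrMl //; apply.
- move=> h t v _ hv; have H := fd _ _ _ (rderiv_coord j hv).
  exact: (is_deriveZ _ H).
- move=> h _ vc t _; apply: (@continuousM _ _ (fun=> _) (fun s => f (velocity h s 0 j))).
    exact: cst_continuous.
  apply: (continuous_comp (f := fun s => velocity h s 0 j)); last exact: fc.
  exact: (@cvg_comp _ _ _ (velocity h) (fun A : T => A 0 j) _ _ _ (vc t) (@coord_continuous _ _ _ 0 j _)).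
- move=> z v _; apply: le_trans (coord_KR j z v M0 DM); rewrite lee_fin.
  rewrite normrM ger0_norm ?invr_ge0 ?(ltW c0) // mulrC; apply: ler_wpM2r => //.
  by rewrite invr_ge0 ltW.
Qed.

Lemma nr_le_dk (D : set T) (M : R) : 0 < M -> (forall w, D w -> nr w <= M) -> domain D ->
  forall x y, D x -> D y -> nr (y - x) <= 2 * (cauchy_constant R * M) * dk D x y.
Proof.
move=> M0 DM dD x y Dx Dy.
have c0 : 0 < cauchy_constant R * M by rewrite mulr_gt0 // cauchy_constant_gt0.
apply: nr_le; first by rewrite mulr_ge0 ?dk_ge0 // mulr_ge0 // ltW.
move=> j; rewrite !mxE; apply: le_trans (normc_le_ReIm _) _.
have := coord_dk j (@Re_continuous R) (@rderiv_Re R) (@normc_Re R) M0 DM dD Dx Dy.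
have := coord_dk j (@Im_continuous R) (@rderiv_Im R) (@normc_Im R) M0 DM dD Dx Dy.
by rewrite !(ReD, ImD, ReN, ImN) -mulrA; lra.
Qed.

Lemma dk_small (D : set T) (x : T) : domain D -> D x -> forall e : R, 0 < e ->
  exists2 r : R, 0 < r & forall y, nr (y - x) < r -> D y /\ dk D x y < e.
Proof.
move=> dD Dx e e0; have [oD _ _] := dD.
have [r r0 Hr] := (open_nrP D).1 oD x Dx.
have r2 : 0 < r / 2 by rewrite divr_gt0.
exists (r / 2 * Num.min 1 e); first by rewrite mulr_gt0 // lt_min ltr01.
move=> y; rewrite minr_pMr ?(ltW r2) // mulr1 lt_min => /andP[y1 y2].
have Dy : D y by apply: Hr; lra.
split=> //; have := @kd_ball R n D x y (r / 2) r2 _ y1.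
rewrite mulrC divfK // dkE // lee_fin => /(_ Hr)/le_lt_trans; apply.
by rewrite ltr_pdivrMr // mulrC.
Qed.

(** A nearly shortest curve is cut where the distance from [x] equals [s]; the remaining piece is
    too short to exceed dk D x y - s by more than [e]. *)
Lemma dk_length (D : set T) (x y : T) : domain D -> D x -> D y ->
  forall s, 0 <= s <= dk D x y -> forall e : R, 0 < e ->
  exists z, [/\ D z, dk D x z = s & dk D z y <= dk D x y - s + e].
Proof.
move=> dD Dx Dy s sxy e e0; have [oD _ _] := dD.
have [|g [pg gD g0 g1 gL]] := @kd_curve R n D x y (dk D x y + e)%:E.
  by rewrite dkE // lte_fin ltrDl.
have [||t t01 ts] := @curve_ivt R n D g 0 1 (dk D x) s pg gD _ _.
- move=> w Dw c /(dk_small dD Dw)[r r0 Hr]; exists r => // u /Hr[Du wu].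
  have t1 := dk_triangle dD Dx Dw Du; have t2 := dk_triangle dD Dx Du Dw.
  rewrite (dk_sym D u w) in t2.
  by rewrite ltr_norml; apply/andP; split; lra.
- by rewrite g0 g1 dk_self.
have Dt := gD t t01.
exists (g t); split => //.
have [t0|t0] := eqVneq t 0.
  by move: ts; rewrite t0 g0 dk_self // => <-; rewrite subr0 lerDl ltW.
have [t1|t1] := eqVneq t 1.
  move: ts; rewrite t1 g1 dk_self // => ->; rewrite subrr add0r; exact: ltW.
have /andP[tt0 tt1] : 0 < t < 1.
  by move: t01 => /andP[a b]; rewrite lt_neqAle eq_sym t0 a lt_neqAle t1.
have [p1 p2] := pw_cut pg tt0 tt1.
have l1 : (kd D x (g t) <= curve_length D g 0%R t)%E.
  rewrite -g0; apply: (kd_le_length p1) => u /andP[a b]; apply: gD.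
  by rewrite a /=; exact: le_trans b (ltW tt1).
have l2 : (kd D (g t) y <= curve_length D g t 1%R)%E.
  rewrite -g1; apply: (kd_le_length p2) => u /andP[a b]; apply: gD.
  by rewrite b andbT; exact: le_trans (ltW tt0) a.
have := leeD l1 l2; rewrite -(curve_length_cat D g tt0 tt1) => l3.
have := le_lt_trans l3 gL; rewrite !dkE // -EFinD lte_fin ts; lra.
Qed.

Lemma dk_complete (D : set T) : domain D -> complete_hyperbolic D ->
  forall u : nat -> T, (forall k, D (u k)) ->
  (forall e : R, 0 < e -> exists N, forall k l, (N <= k)%N -> (N <= l)%N -> dk D (u k) (u l) < e) ->
  exists2 z, D z & forall e : R, 0 < e -> exists N, forall k, (N <= k)%N -> dk D (u k) z < e.
Proof.
move=> dD [_ cD] u Du cu; have [|z Dz uz] := cD u Du.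
  by move=> e /cu[N HN]; exists N => k l Nk Nl; rewrite dkE // lte_fin; exact: HN.
exists z => // e e0.
have /cvgrPdist_lt/(_ e e0)[N _ HN] : (fun k => dk D (u k) z) @ \oo --> (0 : R).
  by apply: fine_cvg; exact: uz.
by exists N => k /HN; rewrite sub0r normrN ger0_norm ?dk_ge0.
Qed.

Section Geodesics.
Context (D : set T) (dD : domain D) (bD : bounded_set D) (cD : complete_hyperbolic D).

Lemma kobayashi_geodesic x y : D x -> D y -> exists g : R -> T,
  [/\ g 0 = x, g (dk D x y) = y & geodesic D `[0, dk D x y] g].
Proof.
move=> Dx Dy; have [M M0 DM] := (bounded_nrP D).1 bD; have [oD _ _] := dD.
have K0 : 0 < 2 * (cauchy_constant R * M) by rewrite !mulr_gt0 // cauchy_constant_gt0.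
have [g [g0 g1 gD gd]] := geodesic_exists (dk_ge0 D) (fun x => @dk_self D x oD) (@dk_sym D)
  (fun x y z => @dk_triangle D x y z dD) K0 (nr_le_dk M0 DM dD) (fun x => @dk_small D x dD)
  (dk_complete dD cD) (fun x y => @dk_length D x y dD) Dx Dy.
exists g; split => //; split.
  by move=> t /=; rewrite in_itv /=; exact: gD.
move=> s t /=; rewrite !in_itv /= => sL tL; rewrite dkE ?gd //; exact: gD.
Qed.

End Geodesics.

End KobayashiDistance.

(** * Real-linear and real-bilinear forms on C^n *)

Section RealForms.
Context {R : realType} {n : nat}.
Local Notation T := 'rV[R[i]]_n.
Local Notation e j := (delta_mx 0 j : T).
Local Notation J v := ('i *: (v : T)).

Definition real_linear (A : T -> R) :=
  (forall v w, A (v + w) = A v + A w) /\ (forall (a : R) v, A (a%:C *: v) = a * A v).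

Definition complex_linear (A : T -> R[i]) :=
  forall (a : R[i]) v w, A (a *: v + w) = a * A v + A w.

Definition real_bilinear (B : T -> T -> R) :=
  (forall w, real_linear (fun v => B v w)) /\ (forall v, real_linear (B v)).

(* The complex-linear functional with real part [L]. *)
Definition cplx (L : T -> R) (v : T) : R[i] := L v +i* - L (J v).

Lemma JJ v : J (J v) = - v.
Proof. by rewrite scalerA -expr2 sqr_i scaleN1r. Qed.

Lemma scale_ReIm (a : R[i]) (v : T) :
  a *: v = (complex.Re a)%:C *: v + (complex.Im a)%:C *: J v.
Proof.
rewrite scalerA -scalerDl; congr (_ *: _); case: a => x y /=.
by apply/eqP; rewrite eq_complex /=; apply/andP; split; apply/eqP; ring.
Qed.

Lemma real_linear0 A : real_linear A -> A 0 = 0.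
Proof. by case=> _ /(_ 0 0); rewrite scaler0 mul0r. Qed.

Lemma real_linearN A v : real_linear A -> A (- v) = - A v.
Proof. by case=> _ /(_ (-1) v); rewrite rmorphN1 scaleN1r mulN1r. Qed.

Lemma real_linear_sum A (I : Type) (r : seq I) (f : I -> T) : real_linear A ->
  A (\sum_(i <- r) f i) = \sum_(i <- r) A (f i).
Proof.
move=> lA; elim: r => [|i r IH]; first by rewrite !big_nil real_linear0.
by rewrite !big_cons lA.1 IH.
Qed.

Lemma real_linear_coord A v : real_linear A ->
  A v = \sum_j (complex.Re (v 0 j) * A (e j) + complex.Im (v 0 j) * A (J (e j))).
Proof.
move=> lA; rewrite {1}[v]row_sum_delta real_linear_sum //; apply: eq_bigr => j _.
by rewrite scale_ReIm lA.1 !lA.2.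
Qed.

Lemma real_linear_bound A (m : R) v : real_linear A ->
  (forall j, `|A (e j)| <= m) -> (forall j, `|A (J (e j))| <= m) ->
  `|A v| <= 2 * n%:R * m * nr v.
Proof.
move=> lA h1 h2; rewrite (real_linear_coord v lA).
apply: le_trans (ler_norm_sum _ _ _) _.
rewrite (_ : 2 * n%:R * m * nr v = \sum_(j < n) 2 * (m * nr v)); last first.
  by rewrite sumr_const card_ord -mulr_natr; ring.
apply: ler_sum => j _; apply: le_trans (ler_normD _ _) _; rewrite !normrM mulrDl mul1r.
have := normc_le_nr v j; have := normc_Re (v 0 j); have := normc_Im (v 0 j) => p1 p2 p3.
have q1 := le_trans p1 p3; have q2 := le_trans p2 p3.
by apply: lerD; rewrite [leRHS]mulrC; apply: ler_pM.
Qed.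

Lemma real_linear_bounded A : real_linear A ->
  exists2 C : R, 0 < C & forall v, `|A v| <= C * nr v.
Proof.
move=> lA; pose m : R := \sum_j (`|A (e j)| + `|A (J (e j))|).
have m1 j : `|A (e j)| + `|A (J (e j))| <= m.
  by rewrite /m (bigD1 j) //= lerDl; apply: sumr_ge0 => k _; rewrite addr_ge0.
have m0 : 0 <= m by apply: sumr_ge0 => k _; rewrite addr_ge0.
exists (2 * n%:R * m + 1); first by rewrite ltr_wpDl // !mulr_ge0.
move=> v; apply: le_trans (real_linear_bound (m := m) v lA _ _) _.
- by move=> j; apply: le_trans (m1 j); rewrite lerDl.
- by move=> j; apply: le_trans (m1 j); rewrite lerDr.
by apply: ler_wpM2r; rewrite ?nr_ge0 // lerDl.
Qed.

Lemma real_bilinear_bound B (m : R) v w : real_bilinear B ->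
  (forall x y, (exists j, x = e j \/ x = J (e j)) -> (exists j, y = e j \/ y = J (e j)) ->
    `|B x y| <= m) ->
  `|B v w| <= (2 * n%:R) ^+ 2 * m * (nr v * nr w).
Proof.
move=> [lB rB] H.
have H1 x : (exists j, x = e j \/ x = J (e j)) -> `|B x w| <= 2 * n%:R * m * nr w.
  by move=> Hx; apply: real_linear_bound => // j; apply: H => //; exists j; [left|right].
have := @real_linear_bound (fun v => B v w) (2 * n%:R * m * nr w) v (lB w).
rewrite (_ : 2 * n%:R * (2 * n%:R * m * nr w) * nr v =
  (2 * n%:R) ^+ 2 * m * (nr v * nr w)); last by ring.
by apply=> j; apply: H1; exists j; [left|right].
Qed.

Lemma real_bilinear_bounded B : real_bilinear B ->
  exists2 C : R, 0 < C & forall v w, `|B v w| <= C * (nr v * nr w).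
Proof.
move=> bB; have [lB rB] := bB.
have : exists m, forall w, (exists j, w = e j \/ w = J (e j)) -> forall v, `|B v w| <= m * nr v.
  pose P (w : T) (C : R) := 0 <= C /\ forall v, `|B v w| <= C * nr v.
  have H w : exists C, P w C by have [C /ltW C0 HC] := real_linear_bounded (lB w); exists C.
  have [C HC] := choice H.
  pose m : R := \sum_j (C (e j) + C (J (e j))).
  have Cw w : 0 <= C w by have [] := HC w.
  have m1 j : C (e j) + C (J (e j)) <= m.
    by rewrite /m (bigD1 j) //= lerDl; apply: sumr_ge0 => k _; rewrite addr_ge0.
  exists m => w [j jw] v; have [_ /(_ v)] := HC w; move/le_trans; apply.
  apply: ler_wpM2r; first exact: nr_ge0.
  apply: le_trans (m1 j); case: jw => ->; by rewrite ?lerDl ?lerDr.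
move=> [m Hm].
exists (2 * n%:R * `|m| + 1); first by rewrite ltr_wpDl // !mulr_ge0.
move=> v w; have := @real_linear_bound (B v) (`|m| * nr v) w (rB v).
have mv u : (exists j, u = e j \/ u = J (e j)) -> `|B v u| <= `|m| * nr v.
  move=> /Hm/(_ v)/le_trans; apply; apply: ler_wpM2r; [exact: nr_ge0|exact: ler_norm].
move=> /(_ _ _)/le_trans; apply.
- by move=> j; apply: mv; exists j; left.
- by move=> j; apply: mv; exists j; right.
have := mulr_ge0 (nr_ge0 v) (nr_ge0 w); move: (nr v) (nr w) => a b ab.
rewrite mulrDl mul1r [leLHS](_ : _ = 2 * n%:R * `|m| * (a * b)); [lra|ring].
Qed.

Lemma real_bilinearB B B' : real_bilinear B -> real_bilinear B' ->
  real_bilinear (fun v w => B v w - B' v w).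
Proof.
move=> [l1 l2] [k1 k2]; split=> [w|u]; split=> [p q|a p].
- by rewrite (l1 w).1 (k1 w).1; ring.
- by rewrite (l1 w).2 (k1 w).2; ring.
- by rewrite (l2 u).1 (k2 u).1; ring.
- by rewrite (l2 u).2 (k2 u).2; ring.
Qed.

Lemma quad_continuous B : real_bilinear B -> forall z (r : R), 0 < r ->
  exists2 d : R, 0 < d & forall y, nr (y - z) < d -> `|B y y - B z z| < r.
Proof.
move=> bB z r r0; have [C C0 HC] := real_bilinear_bounded bB; have [lB rB] := bB.
pose K := C * (1 + 2 * nr z).
have K0 : 0 < K by rewrite mulr_gt0 // ltr_wpDr // mulr_ge0 // nr_ge0.
exists (Num.min 1 (r / K)); first by rewrite lt_min ltr01 divr_gt0.
move=> y; rewrite lt_min => /andP[y1 y2].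
have -> : B y y - B z z = B (y - z) y + B z (y - z).
  have [ly _] := lB y; have [rz _] := rB z.
  by rewrite ly rz (real_linearN _ (lB y)) (real_linearN _ (rB z)); ring.
apply: le_lt_trans (ler_normD _ _) _.
have ny : nr y <= 1 + nr z by have := le_nrB y z; lra.
have h1 := HC (y - z) y; have h2 := HC z (y - z).
have h3 : nr (y - z) * nr y <= nr (y - z) * (1 + nr z) by apply: ler_wpM2l => //; exact: nr_ge0.
have h4 := ler_wpM2l (ltW C0) h3.
apply: le_lt_trans (lerD h1 h2) _.
apply: (@le_lt_trans _ _ (K * nr (y - z))); last by rewrite mulrC -ltr_pdivlMr.
by rewrite /K; move: h4; move: (nr (y - z)) (nr y) (nr z) => a b c; nra.
Qed.

(* A quadratic form that is positive on the zero set of [P >= 0] becomes positive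
   definite after adding a large multiple of [P]. *)
Lemma quad_penalize (B P : T -> T -> R) : real_bilinear B -> real_bilinear P ->
  (forall v, 0 <= P v v) -> (forall v, v != 0 -> P v v = 0 -> 0 < B v v) ->
  exists A c : R, [/\ 0 <= A, 0 < c & forall v, c * nr v ^+ 2 <= B v v + A * P v v].
Proof.
move=> bB bP P0 BP; pose S := [set v : T | nr v = 1].
have cS : compact S.
  apply: closed_bounded_compact.
    by apply/bounded_nrP; exists 1 => // v ->.
  rewrite closure_id; apply/seteqP; split; first exact: subset_closure.
  move=> y cy; rewrite /S /=; apply/eqP; rewrite -subr_eq0 -normr_eq0 eq_le normr_ge0 andbT.
  apply/ler_addgt0Pr => t t0; have [w rw wy] := (closure_nrP _ _).1 cy t t0.
  rewrite /S /= in rw; rewrite -rw add0r ler_norml.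
  have h1 := le_nrB y w; have h2 := le_nrB w y; rewrite (nrB y w) in h1; lra.
have loc z : exists q : R * R * R, S z -> [/\ 0 <= q.1.1, 0 < q.1.2, 0 < q.2 &
    forall y, nr (y - z) < q.1.2 -> q.2 <= B y y + q.1.1 * P y y].
  have [Sz|nSz] := pselect (S z); last by exists (0, 0, 0).
  have z0 : z != 0 by rewrite -nr_gt0 Sz.
  have [Pz|Pz] := eqVneq (P z z) 0.
    have b0 := BP z z0 Pz; have b2 : 0 < B z z / 2 by rewrite divr_gt0.
    have [d d0 Hd] := quad_continuous bB z b2.
    exists (0, d, B z z / 2) => _; split => //= y /Hd; rewrite ltr_norml => /andP[? ?]; lra.
  have p0 : 0 < P z z by rewrite lt_neqAle eq_sym Pz P0.
  have p2 : 0 < P z z / 2 by rewrite divr_gt0.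
  have [d d0 Hd] := quad_continuous bP z p2.
  have [d' d'0 Hd'] := quad_continuous bB z ltr01.
  (* Near [z] one has B >= B z z - 1 and P >= P z z / 2, so this choice makes B + A P at least 1
     there. *)
  pose A := (`|B z z| + 2) / (P z z / 2).
  have A0 : 0 <= A by rewrite divr_ge0 ?addr_ge0 // ltW.
  exists (A, Num.min d d', 1) => _; split => //=; first by rewrite lt_min d0.
  move=> y; rewrite lt_min => /andP[/Hd + /Hd']; rewrite !ltr_norml => /andP[k1 _] /andP[k2 _].
  have k3 : P z z / 2 <= P y y by lra.
  have := ler_wpM2l A0 k3; rewrite {1}/A divfK ?gt_eqF // => k4.
  have := ler_norm (- B z z); rewrite normrN; lra.
have [q Hq] := choice loc.
have [|s [sK sc]] := @finite_cover R n S (fun z => (q z).1.2) cS; first by move=> z /Hq[].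
have [A [c [A0 c0 HA]]] : exists A c : R, [/\ 0 <= A, 0 < c & forall z, z \in s ->
    (q z).1.1 <= A /\ c <= (q z).2].
  have q0 z : z \in s -> 0 <= (q z).1.1 /\ 0 < (q z).2 by move=> /sK/Hq[].
  elim: (s) q0 => [|z s' IH] q0; first by exists 0, 1.
  have [|A [c [A0 c0 HA]]] := IH; first by move=> w ws; apply: q0; rewrite inE ws orbT.
  have [z1 z2] := q0 z (mem_head _ _).
  exists (Num.max A (q z).1.1), (Num.min c (q z).2).
  rewrite le_max lt_min A0 c0 z2; split=> // w; rewrite inE le_max ge_min.
  by move=> /predU1P[->|/HA[-> ->]]; rewrite ?lexx ?orbT.
exists A, c; split => // v.
have [->|v0] := eqVneq v 0.
  by rewrite (real_linear0 (bB.2 0)) nr0 expr0n mulr0 add0r mulr_ge0.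
have nv : 0 < nr v by rewrite nr_gt0.
pose w := (nr v)^-1%:C *: v.
have vw : v = (nr v)%:C *: w.
  by rewrite /w scalerA -rmorphM divff ?gt_eqF // scale1r.
have Sw : S w.
  by rewrite /S /= /w nrZ normc_real ger0_norm ?invr_ge0 ?nr_ge0 // mulVf // gt_eqF.
have [z zs wz] := sc w Sw; have [_ _ _ /(_ w wz) hw] := Hq z (sK z zs).
have [hA hc] := HA z zs.
have hP := ler_wpM2r (P0 w) hA.
clearbody w; rewrite {2 3 4 5}vw !(bB.1 _).2 !(bB.2 _).2 !(bP.1 _).2 !(bP.2 _).2.
rewrite (_ : _ + _ = (B w w + A * P w w) * nr v ^+ 2); last by ring.
by apply: ler_wpM2r; [rewrite exprn_ge0 // ltW|lra].
Qed.

Lemma complex_linear_coord A v : complex_linear A -> A v = \sum_j v 0 j * A (e j).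
Proof.
move=> lA; have A0 : A 0 = 0.
  by have := lA (-1) 0 0; rewrite scaler0 addr0 mulN1r addNr.
have As (r : seq 'I_n) : A (\sum_(j <- r) v 0 j *: e j) = \sum_(j <- r) v 0 j * A (e j).
  elim: r => [|i r IH]; first by rewrite !big_nil.
  by rewrite !big_cons lA IH.
by rewrite {1}[v]row_sum_delta As.
Qed.

Lemma cplx_linear L : real_linear L -> complex_linear (cplx L).
Proof.
move=> lL a v w; have [ad sc] := lL; rewrite /cplx !scalerDr !ad.
have H u : L (a *: u) = complex.Re a * L u + complex.Im a * L (J u).
  by rewrite scale_ReIm ad !sc.
have -> : J (a *: v) = a *: J v by rewrite !scalerA mulrC.
rewrite !H JJ (real_linearN v lL); case: a {H} => x y /=.
by apply/eqP; rewrite eq_complex /=; apply/andP; split; apply/eqP; ring.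
Qed.

Lemma real_linearJ L : real_linear L -> real_linear (fun v => L (J v)).
Proof.
by move=> [ad sc]; split=> [v w|a v]; rewrite ?scalerDr ?ad // -sc !scalerA mulrC.
Qed.

Lemma complex_linear_holo A z : complex_linear A -> differentiable (A : T -> R[i]^o) z.
Proof.
move=> lA.
rewrite (_ : A = \sum_j (fun v : T => v 0 j * A (e j))); last first.
  by apply/funext => v; rewrite fct_sumE (complex_linear_coord v lA).
apply: differentiable_sum => j; apply: differentiableM; last exact: differentiable_cst.
exact: differentiable_coord.
Qed.

End RealForms.

(** * Directional derivatives, the Hessian and the second-order Taylor formula *)

Section DirectionalDerivatives.
Context {R : realType} {n : nat}.
Local Notation T := 'rV[R[i]]_n.
Local Notation e j := (delta_mx 0 j : T).
Local Notation J v := ('i *: (v : T)).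
Local Notation is_dir v f z d := (is_derive (0 : R) (1 : R) (fun t : R => f (z + t%:C *: v)) d).

Lemma dir_deriveP (v : T) f z : dir_derivable v f z -> is_dir v f z (dir_derive v f z).
Proof. by move=> df; rewrite /dir_derive derive1E; exact: (DeriveDef df erefl). Qed.

Lemma dir_derive_val (v : T) f z (d : R) : is_dir v f z d -> dir_derive v f z = d.
Proof. by move=> df; rewrite /dir_derive derive1E derive_val. Qed.

Lemma is_derive_shift (g : R -> R) (t d : R) :
  is_derive (0 : R) (1 : R) (fun s => g (t + s)) d -> is_derive t (1 : R) g d.
Proof.
move=> /is_deriveRP H; apply/is_deriveRP => c /H[r r0 Hr]; exists r => // s st.
have := Hr (s - t); rewrite subr0 addr0 => /(_ st).
by rewrite addrCA subrr addr0.
Qed.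

Lemma is_dir_line (v : T) f z (t : R) : dir_derivable v f (z + t%:C *: v) ->
  is_derive t (1 : R) (fun s : R => f (z + s%:C *: v)) (dir_derive v f (z + t%:C *: v)).
Proof.
move=> /dir_deriveP H; apply: is_derive_shift.
have -> // : (fun s : R => f (z + (t + s)%:C *: v)) = (fun s : R => f (z + t%:C *: v + s%:C *: v)).
by apply/funext => s; rewrite rmorphD scalerDl addrA.
Qed.

Lemma is_dir_scale (v : T) f z (a d : R) : is_dir v f z d -> is_dir (a%:C *: v) f z (a * d).
Proof.
move=> /is_deriveRP H; apply/is_deriveRP => c c0.
have a0 : 0 < `|a| + 1 by rewrite ltr_wpDl.
have [r r0 Hr] := H (c / (`|a| + 1)) (divr_gt0 c0 a0).
exists (r / (`|a| + 1)); first by rewrite divr_gt0.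
move=> s; rewrite subr0 ler_pdivlMr // => hs.
have as1 : `|s * a| <= `|s| * (`|a| + 1) by rewrite normrM; apply: ler_wpM2l => //; lra.
have := Hr (s * a); rewrite subr0 => /(_ (le_trans as1 hs)).
rewrite !scalerA -!rmorphM mul0r (_ : d * (s * a) = a * d * s); last by ring.
move/le_trans; apply; rewrite mulrAC -mulrA.
rewrite ler_pM2l // ler_pdivrMr // normrM mulrC.
Qed.

Lemma is_dir_ext (v : T) (f g : T -> R) (U : set T) z d : open U -> U z ->
  (forall w, U w -> f w = g w) -> is_dir v f z d -> is_dir v g z d.
Proof.
move=> oU Uz fg /is_deriveRP H; apply/is_deriveRP => c /H[r r0 Hr].
have [s s0 Hs] := (open_nrP U).1 oU z Uz.
have v0 : 0 < nr v + 1 by rewrite ltr_wpDl // nr_ge0.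
have near t : `|t| <= s / (nr v + 1) / 2 -> U (z + t%:C *: v).
  move=> ht; apply: Hs; rewrite addrC addKr nrZ normc_real.
  have h1 : `|t| * nr v <= `|t| * (nr v + 1) by apply: ler_wpM2l => //; lra.
  apply: le_lt_trans h1 _; rewrite -ltr_pdivlMr //.
  by apply: le_lt_trans ht _; have := divr_gt0 s0 v0; lra.
exists (Num.min r (s / (nr v + 1) / 2)); first by rewrite lt_min r0 !divr_gt0.
move=> t; rewrite le_min => /andP[/Hr + ht]; rewrite !fg //.
- by apply: near; rewrite normr0 !divr_ge0 // ltW.
- by apply: near; rewrite subr0 in ht.
Qed.

Lemma is_dir_add (v : T) (f g : T -> R) z d d' : is_dir v f z d -> is_dir v g z d' ->
  is_dir v (fun w => f w + g w) z (d + d').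
Proof. by move=> H1 H2; exact: is_deriveD H1 H2. Qed.

Lemma is_dir_mul (v : T) (f : T -> R) z (a d : R) : is_dir v f z d ->
  is_dir v (fun w => a * f w) z (a * d).
Proof. by move=> H1; exact: (is_deriveZ _ H1). Qed.

Lemma cont_nrP (f : T -> R) z : {for z, continuous f} <->
  forall c : R, 0 < c -> exists2 r : R, 0 < r & forall w, nr (w - z) < r -> `|f w - f z| < c.
Proof.
split=> [/cvgrPdist_lt H c /H/nbhs_nrP[r r0 Hr]|H].
  by exists r => // w /Hr; rewrite distrC.
move=> A /nbhs_ballP[c c0 Hc]; have [r r0 Hr] := H c c0.
by apply/nbhs_nrP; exists r => // w /Hr wz; apply: Hc; rewrite /ball /= distrC.
Qed.

Lemma is_derive_mulr (a t : R) : is_derive t (1 : R) (fun s : R => s * a) a.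
Proof.
apply/is_deriveRP => c c0; exists 1 => // s _.
by rewrite mulrBr ![a * _]mulrC subrr normr0 mulr_ge0 // ltW.
Qed.

(* Additivity of the directional derivative needs continuity of the partial
   derivatives: [f (z + t (v + w))] is reached along [v] and then along [w]. *)
Lemma is_dir_addv (U : set T) (f : T -> R) (v w z : T) : open U -> U z ->
  (forall y, U y -> dir_derivable v f y) -> (forall y, U y -> dir_derivable w f y) ->
  {for z, continuous (dir_derive w f)} ->
  is_dir (v + w) f z (dir_derive v f z + dir_derive w f z).
Proof.
move=> oU Uz dv dw cw; apply/is_deriveRP => c c0; have c2 : 0 < c / 2 by rewrite divr_gt0.
have /is_deriveRP/(_ _ c2)[r1 r10 H1] := dir_deriveP (dv z Uz).
have [r2 r20 H2] := (cont_nrP _ _).1 cw _ c2.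
have [r3 r30 H3] := (open_nrP U).1 oU z Uz.
pose N := nr v + nr w + 1; have N0 : 0 < N by rewrite ltr_wpDl // addr_ge0 ?nr_ge0.
have mr0 : 0 < Num.min r2 r3 by rewrite lt_min r20.
exists (Num.min r1 (Num.min r2 r3 / N / 2)); first by rewrite lt_min r10 !divr_gt0.
move=> t; rewrite !subr0 le_min => /andP[t1 t2].
have near (s : R) : 0 <= s <= 1 -> nr (z + t%:C *: v + s%:C *: (t%:C *: w) - z) < Num.min r2 r3.
  move=> /andP[s0 s1]; rewrite -[z + _ + _]addrA [z + _]addrC addrK.
  apply: le_lt_trans (nrD _ _) _; rewrite !nrZ !normc_real (ger0_norm s0).
  have h1 : s * (`|t| * nr w) <= `|t| * nr w by rewrite ler_piMl // mulr_ge0 ?nr_ge0.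
  have h2 : `|t| * nr v + `|t| * nr w <= `|t| * N by rewrite -mulrDr; apply: ler_wpM2l => //; rewrite /N; lra.
  have h3 : `|t| * N < Num.min r2 r3.
    by rewrite -ltr_pdivlMr //; apply: le_lt_trans t2 _; have := divr_gt0 mr0 N0; lra.
  by move: h1 h2 h3; lra.
have t1' := H1 t; rewrite subr0 in t1'; have {t1'} := t1' t1.
pose y := z + t%:C *: v.
(* With the linear part removed, the derivative of [g] is t times the change of [dir_derive w f]
   from its value at [z], which continuity makes small. *)
pose g (s : R) := f (y + s%:C *: (t%:C *: w)) - s * (t * dir_derive w f z).
pose dg (s : R) := t * dir_derive w f (y + s%:C *: (t%:C *: w)) - t * dir_derive w f z.
have Dg (s : R) : 0 <= s <= 1 -> is_derive s (1 : R) g (dg s).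
  move=> /near; rewrite lt_min => /andP[_ /H3 Us]; rewrite /g /dg.
  have G1 : is_derive s (1 : R) (fun s : R => f (y + s%:C *: (t%:C *: w)))
      (t * dir_derive w f (y + s%:C *: (t%:C *: w))).
    have W := is_dir_scale t (dir_deriveP (dw _ Us)).
    have -> : t * dir_derive w f (y + s%:C *: (t%:C *: w)) =
        dir_derive (t%:C *: w) f (y + s%:C *: (t%:C *: w)) by rewrite (dir_derive_val W).
    by apply: is_dir_line; exact: (@ex_derive _ _ _ _ _ _ _ W).
  have G2 : is_derive s (1 : R) (fun s : R => s * (t * dir_derive w f z)) (t * dir_derive w f z).
    exact: is_derive_mulr.
  exact: is_deriveB G1 G2.
have := lip_of_derive (K := c / 2 * `|t|) ler01 Dg.
rewrite subr0 mulr1 => HK.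
have {}HK : `|g 1 - g 0| <= c / 2 * `|t|.
  apply: HK => s /near; rewrite lt_min => /andP[/H2 hs _].
  by rewrite /dg -mulrBr normrM mulrC; apply: ler_wpM2r => //; exact: ltW.
move: HK; rewrite /g scale1r mul1r mul0r scale0r addr0 subr0.
rewrite !scale0r !addr0 (_ : z + t%:C *: (v + w) = y + t%:C *: w); last first.
  by rewrite scalerDr addrA.
rewrite -/y => h1 h2.
rewrite (_ : _ - _ = (f (y + t%:C *: w) - t * dir_derive w f z - f y) +
  (f y - f z - dir_derive v f z * t)).
  by apply: le_trans (ler_normD _ _) _; rewrite [c in leRHS]splitr mulrDl; exact: lerD.
by move: (f (y + _)) (f y) (f z) (dir_derive w f z) (dir_derive v f z) => *; ring.
Qed.

Definition C1_on (U : set T) (f : T -> R) := forall v,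
  (forall z, U z -> dir_derivable v f z) /\ (forall z, U z -> {for z, continuous (dir_derive v f)}).

Lemma Ck_on_C1 k (U : set T) f : Ck_on k.+1 U f -> C1_on U f.
Proof. move=> [_ H] v; have [dv cv] := H v; split; first exact: dv.
case: k {H} cv => [|k] [cc _]; exact: cc. Qed.

Lemma dir_derive_linear (U : set T) f z : open U -> U z -> C1_on U f ->
  real_linear (fun v => dir_derive v f z).
Proof.
move=> oU Uz Cf; split=> [v w|a v].
  apply: dir_derive_val; exact: (is_dir_addv oU Uz (Cf v).1 (Cf w).1 ((Cf w).2 z Uz)).
by apply: dir_derive_val; apply: is_dir_scale; apply: dir_deriveP; exact: (Cf v).1.
Qed.

Definition hess (f : T -> R) z (v w : T) := dir_derive v (dir_derive w f) z.

Lemma hess_bilinear (U : set T) f z : open U -> U z -> C1_on U f ->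
  (forall w, C1_on U (dir_derive w f)) -> real_bilinear (hess f z).
Proof.
move=> oU Uz C1 C2; split=> [w|v]; first exact: dir_derive_linear (C2 w).
split=> [w w'|a w]; apply: dir_derive_val.
  apply: (is_dir_ext (f := fun y => dir_derive w f y + dir_derive w' f y) oU Uz).
    by move=> y Uy; rewrite (dir_derive_linear oU Uy C1).1.
  by apply: is_dir_add; apply: dir_deriveP; apply: (C2 _ _).1.
apply: (is_dir_ext (f := fun y => a * dir_derive w f y) oU Uz).
  by move=> y Uy; rewrite (dir_derive_linear oU Uy C1).2.
by apply: is_dir_mul; apply: dir_deriveP; apply: (C2 _ _).1.
Qed.

(** Uniformity in [v] comes from bilinearity: closeness is checked on the finitely many pairs of
    real basis vectors e_j and i e_j, at the price of the factor (2n)^2 hidden in [m]. *)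
Lemma hess_cont (U : set T) f z : open U -> U z -> C1_on U f ->
  (forall w, C1_on U (dir_derive w f)) -> forall c : R, 0 < c ->
  exists2 r : R, 0 < r & forall y, nr (y - z) < r ->
    U y /\ forall v, `|hess f y v v - hess f z v v| <= c * nr v ^+ 2.
Proof.
move=> oU Uz C1 C2 c c0.
have [r0 r00 Hr0] := (open_nrP U).1 oU z Uz.
pose m : R := c / ((2 * n%:R) ^+ 2 + 1).
have k0 : 0 < (2 * n%:R : R) ^+ 2 + 1 by rewrite ltr_wpDl // exprn_ge0 // mulr_ge0.
have m0 : 0 < m by rewrite divr_gt0.
pose b : seq T := [seq e j | j <- enum 'I_n] ++ [seq J (e j) | j <- enum 'I_n].
have bP x : (exists j, x = e j \/ x = J (e j)) -> x \in b.
  move=> [j [->|->]]; rewrite mem_cat; apply/orP; [left|right]; apply/mapP; exists j => //;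
  by rewrite mem_enum.
have [r r1 Hr] : exists2 r : R, 0 < r & forall y, nr (y - z) < r ->
    forall x w, x \in b -> w \in b -> `|hess f y x w - hess f z x w| < m.
  have H : exists2 r : R, 0 < r & forall y, nr (y - z) < r ->
      forall q, q \in [seq (x, w) | x <- b, w <- b] -> `|hess f y q.1 q.2 - hess f z q.1 q.2| < m.
    elim: [seq (x, w) | x <- b, w <- b] => [|q s [r r1 Hr]]; first by exists 1.
    have [r' r'0 Hr'] := (cont_nrP _ _).1 ((C2 q.2 q.1).2 z Uz) m m0.
    exists (Num.min r r'); first by rewrite lt_min r1.
    by move=> y; rewrite lt_min => /andP[/Hr h1 /Hr' h2] q'; rewrite inE => /predU1P[->|/h1].
  have [r r1 Hr] := H; exists r => // y /Hr hy x w xb wb.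
  by apply: (hy (x, w)); apply/allpairsP; exists (x, w).
exists (Num.min r0 r); first by rewrite lt_min r00.
move=> y; rewrite lt_min => /andP[/Hr0 Uy /Hr hy]; split=> // v.
have bB := real_bilinearB (hess_bilinear oU Uy C1 C2) (hess_bilinear oU Uz C1 C2).
apply: le_trans (real_bilinear_bound (m := m) v v bB _) _.
  by move=> x w /bP xb /bP wb; apply: ltW; exact: hy.
rewrite -expr2; apply: ler_wpM2r; first by rewrite exprn_ge0 // nr_ge0.
by rewrite /m mulrA ler_pdivrMr // mulrC; apply: ler_wpM2l; [exact: ltW|lra].
Qed.

Lemma taylor2_real (f f1 f2 : R -> R) (m K : R) :
  (forall t : R, 0 <= t <= 1 -> is_derive t (1 : R) f (f1 t)) ->
  (forall t : R, 0 <= t <= 1 -> is_derive t (1 : R) f1 (f2 t)) ->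
  (forall t : R, 0 <= t <= 1 -> `|f2 t - m| <= K) -> `|f 1 - f 0 - f1 0 - m / 2| <= K.
Proof.
move=> D1 D2 H2.
have K0 : 0 <= K by apply: le_trans (H2 0 _); rewrite ?normr_ge0 // lexx ler01.
have E1 (t : R) : 0 <= t <= 1 -> `|f1 t - f1 0 - t * m| <= K.
  move=> /andP[t0 t1].
  have H : `|(f1 t - t * m) - (f1 0 - 0 * m)| <= K * (t - 0).
    apply: (@lip_of_derive R (fun s => f1 s - s * m) (fun s => f2 s - m)) => // s /andP[s0 st].
      by apply: is_deriveB; [apply: D2; rewrite s0 (le_trans st)|exact: is_derive_mulr].
    by apply: H2; rewrite s0 (le_trans st).
  rewrite mul0r !subr0 in H; rewrite addrAC; apply: le_trans H _.
  by apply: ler_piMr.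
have H : `|(f 1 - 1 * f1 0 - 1 * 1 * (m / 2)) - (f 0 - 0 * f1 0 - 0 * 0 * (m / 2))| <= K * (1 - 0).
  apply: (@lip_of_derive R (fun s => f s - s * f1 0 - s * s * (m / 2))
    (fun s => f1 s - f1 0 - s * m)) => // s s1.
  have S : is_derive s (1 : R) (fun s : R => s * s * (m / 2)) (s * m).
    apply/is_deriveRP => c c0; exists (c / (`|m| + 1)); first by rewrite divr_gt0 // ltr_wpDl.
    move=> t; rewrite ler_pdivlMr ?ltr_wpDl // => ts.
    rewrite (_ : _ - _ = (t - s) * (m / 2) * (t - s)); last by field.
    rewrite normrM; apply: ler_wpM2r => //; apply: le_trans ts; rewrite normrM.
    by apply: ler_wpM2l => //; rewrite normrM [`|2^-1|]ger0_norm //; have := normr_ge0 m; lra.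
  by apply: is_deriveB S; apply: is_deriveB; [exact: D1|exact: is_derive_mulr].
rewrite subr0 mulr1 !mul0r !mul1r !subr0 in H.
rewrite mulr1 in H; rewrite (_ : f 1 - _ - _ - _ = f 1 - f1 0 - m / 2 - f 0); [exact: H|ring].
Qed.

Lemma taylor2 (U : set T) f z : open U -> U z -> C1_on U f ->
  (forall w, C1_on U (dir_derive w f)) -> forall c : R, 0 < c ->
  exists2 r : R, 0 < r & forall h, nr h < r -> U (z + h) /\
    `|f (z + h) - f z - dir_derive h f z - hess f z h h / 2| <= c * nr h ^+ 2.
Proof.
move=> oU Uz C1 C2 c c0; have [r r0 Hr] := hess_cont oU Uz C1 C2 c0.
exists r => // h hr.
have near (t : R) : 0 <= t <= 1 -> nr (z + t%:C *: h - z) < r.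
  move=> /andP[t0 t1]; rewrite addrC addKr nrZ normc_real ger0_norm //.
  by apply: le_lt_trans hr; rewrite ler_piMl // nr_ge0.
split; first by apply: (Hr _ _).1; rewrite addrC addKr.
pose d1 (t : R) := dir_derive h f (z + t%:C *: h).
have D1 (t : R) : 0 <= t <= 1 -> is_derive t (1 : R) (fun s : R => f (z + s%:C *: h)) (d1 t).
  by move=> /near/Hr[Ut _]; apply: is_dir_line; exact: (C1 h).1.
have D2 (t : R) : 0 <= t <= 1 -> is_derive t (1 : R) d1 (hess f (z + t%:C *: h) h h).
  by move=> /near/Hr[Ut _]; apply: is_dir_line; exact: (C2 h h).1.
have := @taylor2_real _ _ _ (hess f z h h) (c * nr h ^+ 2) D1 D2.
rewrite /d1 scale1r !scale0r !addr0; apply => t /near/Hr[_]; exact.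
Qed.

End DirectionalDerivatives.

(** * The Levi form and the holomorphic part of the Hessian *)

Section LeviForm.
Context {R : realType} {n : nat}.
Local Notation T := 'rV[R[i]]_n.
Local Notation e j := (delta_mx 0 j : T).
Local Notation J v := ('i *: (v : T)).

(* The complex Hessian and the holomorphic part of the real Hessian [B]:
   [B v v / 2 = Re (levi_of B v v) + Re (holo_of B v v)]. *)
Definition levi_of (B : T -> T -> R) (v w : T) : R[i] :=
  cplx (fun u => (B u w + B (J u) (J w)) / 4) v.

Definition holo_of (B : T -> T -> R) (v w : T) : R[i] :=
  cplx (fun u => (B u w - B (J u) (J w)) / 4) v.

Definition herm_re (B : T -> T -> R) (v w : T) : R := (B v w + B (J v) (J w)) / 4.

Section Bilinear.
Context (B : T -> T -> R) (bB : real_bilinear B).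

Lemma herm_re_bilinear : real_bilinear (herm_re B).
Proof.
have [l r] := bB; rewrite /herm_re; split=> w; split=> [u v|a u].
- by rewrite scalerDr (l w).1 (l (J w)).1; ring.
- by rewrite (l w).2 (real_linearJ (l (J w))).2; ring.
- by rewrite scalerDr (r w).1 (r (J w)).1; ring.
- by rewrite (r w).2 (real_linearJ (r (J w))).2; ring.
Qed.

Lemma anti_re_bilinear : real_bilinear (fun v w => (B v w - B (J v) (J w)) / 4).
Proof.
have [l r] := bB; split=> w; split=> [u v|a u].
- by rewrite scalerDr (l w).1 (l (J w)).1; ring.
- by rewrite (l w).2 (real_linearJ (l (J w))).2; ring.
- by rewrite scalerDr (r w).1 (r (J w)).1; ring.
- by rewrite (r w).2 (real_linearJ (r (J w))).2; ring.
Qed.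

Lemma levi_ofE v w : levi_of B v w =
  ((B v w + B (J v) (J w)) / 4) +i* ((B v (J w) - B (J v) w) / 4).
Proof.
rewrite /levi_of /cplx JJ (real_linearN _ (bB.1 (J w))).
by congr (_ +i* _); ring.
Qed.

Lemma holo_ofE v w : holo_of B v w =
  ((B v w - B (J v) (J w)) / 4) +i* (- (B v (J w) + B (J v) w) / 4).
Proof.
rewrite /holo_of /cplx JJ (real_linearN _ (bB.1 (J w))).
by congr (_ +i* _); ring.
Qed.

Lemma levi_of_linear w : complex_linear (levi_of B ^~ w).
Proof. exact: cplx_linear (herm_re_bilinear.1 w). Qed.

Lemma levi_of_conj_linear v : complex_linear (fun w => (levi_of B v w)^*%C).
Proof.
rewrite (_ : (fun w => _) = cplx (herm_re B v)); first exact: cplx_linear (herm_re_bilinear.2 v).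
apply/funext => w; rewrite levi_ofE /cplx /herm_re JJ (real_linearN _ (bB.2 (J v))) /=.
by congr (_ +i* _); ring.
Qed.

Lemma holo_of_linear w : complex_linear (holo_of B ^~ w).
Proof. exact: cplx_linear (anti_re_bilinear.1 w). Qed.

Lemma holo_of_linear_r v : complex_linear (holo_of B v).
Proof.
rewrite (_ : holo_of B v = cplx (fun w => (B v w - B (J v) (J w)) / 4)).
  exact: cplx_linear (anti_re_bilinear.2 v).
apply/funext => w; rewrite holo_ofE /cplx JJ (real_linearN _ (bB.2 (J v))).
by congr (_ +i* _); ring.
Qed.

Lemma conjc_swap (a b c : R[i]) : a * (b * c^*%C)^*%C = c * a * b^*%C.
Proof. by rewrite rmorphM /= conjcK mulrA mulrAC [a * c]mulrC. Qed.

Lemma levi_of_coord v : levi_of B v v =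
  \sum_j \sum_k levi_of B (e j) (e k) * v 0 j * (v 0 k)^*%C.
Proof.
rewrite (complex_linear_coord v (levi_of_linear v)); apply: eq_bigr => j _.
have := complex_linear_coord v (levi_of_conj_linear (e j)).
move/(congr1 (@conjc R)); rewrite conjcK => ->.
rewrite rmorph_sum mulr_sumr; apply: eq_bigr => k _; exact: conjc_swap.
Qed.

(** Since [holo_of B] is complex-linear in both arguments, its diagonal is a quadratic polynomial in
    the coordinates. *)
Lemma holo_of_diff z : differentiable (fun v : T => holo_of B v v : R[i]^o) z.
Proof.
rewrite (_ : (fun v => _) = \sum_k (fun v : T => v 0 k * holo_of B v (e k))); last first.
  by apply/funext => v; rewrite fct_sumE (complex_linear_coord v (holo_of_linear_r v)).
apply: differentiable_sum => k; apply: differentiableM; first exact: differentiable_coord.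
exact: complex_linear_holo (holo_of_linear (e k)).
Qed.

End Bilinear.

Lemma dir_derivec_real (rho : T -> R) v z :
  dir_derivec v (fun w => (rho w)%:C) z = (dir_derive v rho z)%:C.
Proof.
rewrite /dir_derivec; congr (_ +i* _).
by rewrite /dir_derive derive1_cst.
Qed.

Lemma dz_real (rho : T -> R) z (L := fun v => dir_derive v rho z) j :
  dz j (fun w => (rho w)%:C) z = cplx L (e j) / 2.
Proof.
rewrite /dz !dir_derivec_real /cplx; congr (_ / 2); rewrite /L.
move: (dir_derive _ _ _) (dir_derive _ _ _) => a b.
by apply/eqP; rewrite eq_complex /=; apply/andP; split; apply/eqP; ring.
Qed.

Lemma dzbar_real (rho : T -> R) k z : dzbar k (fun w => (rho w)%:C) z =
  (dir_derive (e k) rho z / 2) +i* (dir_derive (J (e k)) rho z / 2).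
Proof.
rewrite /dzbar !dir_derivec_real; move: (dir_derive _ _ _) (dir_derive _ _ _) => a b.
have -> : (2 : R[i])^-1 = (2^-1 : R)%:C by rewrite fmorphV rmorph_nat.
by apply/eqP; rewrite eq_complex /=; apply/andP; split; apply/eqP; ring.
Qed.

Section AtPoint.
Context (U : set T) (rho : T -> R) (p : T) (oU : open U) (Up : U p).
Context (C1 : C1_on U rho) (C2 : forall w, C1_on U (dir_derive w rho)).

Lemma complex_tangentE v :
  complex_tangent rho p v <-> cplx (fun v => dir_derive v rho p) v = 0.
Proof.
rewrite /complex_tangent; under eq_bigr do rewrite dz_real mulrAC.
rewrite -mulr_suml (complex_linear_coord v (cplx_linear (dir_derive_linear oU Up C1))).
under eq_bigr do rewrite mulrC.
split=> [/eqP|->]; last by rewrite mul0r.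
by rewrite mulf_eq0 invr_eq0 pnatr_eq0 orbF => /eqP.
Qed.

Lemma dir_derive_half v w : dir_derive v (fun z => dir_derive w rho z / 2) p = hess rho p v w / 2.
Proof.
rewrite (_ : (fun z => _) = (fun z => 2^-1 * dir_derive w rho z)); last first.
  by apply/funext => z; rewrite mulrC.
rewrite [RHS]mulrC; apply: dir_derive_val; apply: is_dir_mul; apply: dir_deriveP.
exact: (C2 w v).1.
Qed.

Lemma dir_derivec_half v w w' :
  dir_derivec v (fun z => (dir_derive w rho z / 2) +i* (dir_derive w' rho z / 2)) p =
  (hess rho p v w / 2) +i* (hess rho p v w' / 2).
Proof. exact: (f_equal2 (@Complex R) (dir_derive_half v w) (dir_derive_half v w')). Qed.

(** Both sides are expanded over the basis, where the iterated Wirtinger derivatives of [rho] are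
    combinations of four entries of the real Hessian. *)
Lemma levi_formE v : levi_form rho p v = levi_of (hess rho p) v v.
Proof.
rewrite (levi_of_coord (hess_bilinear oU Up C1 C2)) /levi_form.
apply: eq_bigr => j _; apply: eq_bigr => k _; congr (_ * _ * _).
rewrite (levi_ofE (hess_bilinear oU Up C1 C2)) /dz.
rewrite (_ : dzbar k _ = fun z => (dir_derive (e k) rho z / 2) +i* (dir_derive (J (e k)) rho z / 2)); last first.
  by apply/funext => z; exact: dzbar_real.
rewrite (dir_derivec_half (e j)) (dir_derivec_half (J (e j))).
move: (hess _ _ _ _) (hess _ _ _ _) (hess _ _ _ _) (hess _ _ _ _) => x y z w.
have -> : (2 : R[i])^-1 = (2^-1 : R)%:C by rewrite fmorphV rmorph_nat.
by apply/eqP; rewrite eq_complex /=; apply/andP; split; apply/eqP; field.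
Qed.

End AtPoint.

End LeviForm.

(** * The peak function at a strongly pseudoconvex point *)

Section LocalDefiningFunction.
Context {R : realType} {n : nat}.
Local Notation T := 'rV[R[i]]_n.
Local Notation J v := ('i *: (v : T)).

Lemma nrJ (v : T) : nr (J v) = nr v.
Proof. by rewrite nrZ normci mul1r. Qed.

Lemma normcD (a b : R[i]) : normc (a + b) <= normc a + normc b.
Proof. by rewrite -!nr_normc; exact: nrD. Qed.

Lemma normcN (a : R[i]) : normc (- a) = normc a.
Proof. by rewrite -!nr_normc nrN. Qed.

Lemma forms_bounded (B : T -> T -> R) : real_bilinear B -> exists2 K : R, 0 < K & forall v,
  [/\ `|herm_re B v v| <= K * nr v ^+ 2, `|complex.Re (holo_of B v v)| <= K * nr v ^+ 2,
      `|complex.Im (holo_of B v v)| <= K * nr v ^+ 2 & `|B v v / 2| <= K * nr v ^+ 2].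
Proof.
move=> bB; have [K K0 HK] := real_bilinear_bounded bB; exists K => // v.
have h1 := HK v v; have h2 := HK (J v) (J v); have h3 := HK v (J v); have h4 := HK (J v) v.
rewrite !nrJ -expr2 in h1 h2 h3 h4; rewrite holo_ofE // /herm_re /=.
move: h1 h2 h3 h4; set N := K * _; rewrite !ler_norml.
by move=> /andP[? ?] /andP[? ?] /andP[? ?] /andP[? ?]; split; apply/andP; split; lra.
Qed.

Lemma cplx_bounded (L : T -> R) : real_linear L -> exists2 K : R, 0 < K & forall v,
  `|L v| <= K * nr v /\ normc (cplx L v) <= 2 * K * nr v.
Proof.
move=> lL; have [K K0 HK] := real_linear_bounded lL; exists K => // v; split=> //.
apply: le_trans (normc_le_ReIm _) _; rewrite /cplx /= normrN.
have := HK (J v); rewrite nrJ; have := HK v; lra.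
Qed.

(* In the domain [L <= 5 K N^2]; either [L] is also at least [- 5 K N^2], and the
   correction [2 A L^2] is of fourth order, or [- L] alone dominates. *)
Lemma levi_arith (A K c N L Q M P : R) : 0 <= A -> 0 < K -> 0 < c -> c <= K -> 0 <= N ->
  N <= 1 -> N * (200 * A * K ^+ 2) <= c -> N * (4 * A * K) <= 1 ->
  `|L| <= K * N -> `|Q| <= K * N ^+ 2 -> `|M| <= K * N ^+ 2 -> 0 <= P ->
  c * N ^+ 2 <= M + A * P -> L + Q + M <= c / 2 * N ^+ 2 ->
  c / 4 * N ^+ 2 <= - L - Q - A * (2 * L ^+ 2 - P).
Proof.
move=> A0 K0 c0 cK N0 N1 s1 s2 hL hQ hM P0 hA hD.
have NN0 : 0 <= N ^+ 2 by rewrite exprn_ge0.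
move: hL hQ hM; rewrite !ler_norml => /andP[l1 l2] /andP[q1 q2] /andP[m1 m2].
have cKN : c * N ^+ 2 <= K * N ^+ 2 by apply: ler_wpM2r.
have AP0 : 0 <= A * P by rewrite mulr_ge0.
have [hl|hl] := leP (- (5 * K * N ^+ 2)) L.
  have L2 : L ^+ 2 <= (5 * K * N ^+ 2) ^+ 2.
    rewrite -[leLHS]real_normK ?num_real // ler_sqr ?nnegrE ?mulr_ge0 ?(ltW K0) //.
    rewrite ler_norml hl /=.
    by apply: (@le_trans _ _ (3 * K * N ^+ 2)); [lra|rewrite ler_wpM2r // ler_wpM2r ?ltW //; lra].
  have AL : A * L ^+ 2 <= c / 8 * N ^+ 2.
    apply: le_trans (ler_wpM2l A0 L2) _.
    rewrite (_ : A * _ = (N * (200 * A * K ^+ 2)) / 8 * (N * N ^+ 2)); last by field.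
    have h3 : N * N ^+ 2 <= N ^+ 2 by apply: ler_piMl.
    have h4 : 0 <= N * N ^+ 2 by rewrite mulr_ge0.
    apply: (@le_trans _ _ (c / 8 * (N * N ^+ 2))).
      by apply: ler_wpM2r => //; apply: ler_wpM2r.
    by apply: ler_wpM2l => //; rewrite divr_ge0 // ltW.
  lra.
have Lneg : L <= 0 by apply: (le_trans (ltW hl)); rewrite oppr_le0 !mulr_ge0 // ltW.
have AL : 2 * A * L ^+ 2 <= - L / 2.
  have h : 2 * A * - L <= 1 / 2.
    have : 2 * A * - L <= 2 * A * (K * N) by apply: ler_wpM2l; [rewrite mulr_ge0|lra].
    lra.
  rewrite (_ : 2 * A * L ^+ 2 = (2 * A * - L) * - L); last by ring.
  rewrite (_ : - L / 2 = 1 / 2 * - L); last by field.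
  by apply: ler_wpM2r => //; lra.
lra.
Qed.

Lemma levi_radius (A K c r : R) : 0 <= A -> 0 < K -> 0 < c -> 0 < r ->
  exists2 delta : R, 0 < delta & forall N, 0 <= N -> N < delta ->
    [/\ N < r, N <= 1, N * (200 * A * K ^+ 2) <= c & N * (4 * A * K) <= 1].
Proof.
move=> A0 K0 c0 r0; pose q := 200 * A * K ^+ 2; pose q' := 4 * A * K.
have q0 : 0 <= q by rewrite (mulr_ge0 (mulr_ge0 (ler0n _ 200) A0)) // sqr_ge0.
have q'0 : 0 <= q' by rewrite !mulr_ge0 ?(ltW K0).
exists (Num.min (Num.min r 1) (Num.min (c / (q + 1)) (q' + 1)^-1)).
  by rewrite !lt_min r0 ltr01 divr_gt0 ?invr_gt0 // ltr_wpDl.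
move=> N N0; rewrite !lt_min => /andP[/andP[h1 h2] /andP[h3 h4]].
rewrite ltr_pdivlMr ?ltr_wpDl // mulrDr mulr1 in h3.
rewrite -[ltRHS]mul1r ltr_pdivlMr ?ltr_wpDl // mulrDr mulr1 in h4.
split=> //; first exact: ltW.
  by apply: le_trans (ltW h3); rewrite lerDl.
by apply: le_trans (ltW h4); rewrite lerDl.
Qed.

(* The data of a strongly pseudoconvex boundary point used below: [l] is the
   complex gradient, [nu] a normal direction, and [H] a holomorphic peak function. *)
Definition peak_data (D : set T) (p : T) (l : T -> R[i]) (nu : T) (H : T -> 'rV[R[i]]_1)
    (C delta c : R) : Prop :=
  [/\ [/\ 0 < C, 0 < delta & 0 < c],
      [/\ complex_linear l, l nu = 1 & forall v, normc (l v) <= C * nr v],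
      (forall h, nr h < delta -> D (p + h) -> complex.Re (l h) <= C * nr h ^+ 2),
      (forall h, nr h < delta -> complex.Re (l h) + C * nr h ^+ 2 < 0 -> D (p + h))
    & [/\ holomorphic_on setT H,
        forall h, nr h < delta -> normc (H (p + h) 0 0) <= C * nr h
      & forall h, nr h < delta -> D (p + h) -> c * nr h ^+ 2 <= complex.Re (H (p + h) 0 0)]].

Lemma complex_linear0 (A : T -> R[i]) : complex_linear A -> A 0 = 0.
Proof. by move=> lA; have := lA (-1) 0 0; rewrite scaler0 addr0 mulN1r addNr. Qed.

Lemma complex_linearZ (A : T -> R[i]) a v : complex_linear A -> A (a *: v) = a * A v.
Proof. by move=> lA; have := lA a v 0; rewrite addr0 complex_linear0 // addr0. Qed.

Lemma differentiable_shift (V W : normedModType R[i]) (f : V -> W) (p z : V) :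
  differentiable f (z - p) -> differentiable (fun y => f (y - p)) z.
Proof.
by move=> df; apply: (@differentiable_comp _ V V W (fun y => y - p) f z).
Qed.

(** The polarisation of |l v|^2, the shape in which it can serve as the penalty in
    [quad_penalize]. *)
Definition sqnorm_form (l : T -> R[i]) (v w : T) : R :=
  complex.Re (l v) * complex.Re (l w) + complex.Im (l v) * complex.Im (l w).

Lemma sqnorm_form_bilinear l : complex_linear l -> real_bilinear (sqnorm_form l).
Proof.
move=> ll.
have lD v w : l (v + w) = l v + l w by have := ll 1 v w; rewrite scale1r mul1r.
have lZ (a : R) v : l (a%:C *: v) = a%:C * l v by exact: complex_linearZ.
split=> w; split=> [u v|a u]; rewrite /sqnorm_form /= ?lD ?lZ.
- by case: (l u) (l v) (l w) => [? ?] [? ?] [? ?] /=; ring.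
- by case: (l u) (l w) => [? ?] [? ?] /=; ring.
- by case: (l u) (l v) (l w) => [? ?] [? ?] [? ?] /=; ring.
- by case: (l u) (l w) => [? ?] [? ?] /=; ring.
Qed.

Lemma sqnorm_formE l v : sqnorm_form l v v = normc (l v) ^+ 2.
Proof. by rewrite normc_sqr /sqnorm_form !expr2. Qed.

(** By Taylor's formula, L + Re Q + M <= (c/2) |h|^2 in [D] near [p], where M is the Levi form and Q
    = [holo_of B]. So -(l + Q) has real part at least M - (c/2) |h|^2, which is good in complex
    tangent directions. Subtracting A l^2 supplies the missing A |l|^2 in the normal direction,
    because Re l^2 = 2 L^2 - |l|^2. *)
Lemma peak_data_of_taylor (D U : set T) (p : T) (rho L : T -> R) (B : T -> T -> R) :
  (forall z, U z -> D z <-> rho z < 0) -> rho p = 0 -> real_linear L -> real_bilinear B ->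
  (forall c : R, 0 < c -> exists2 r : R, 0 < r & forall h, nr h < r -> U (p + h) /\
    `|rho (p + h) - rho p - L h - B h h / 2| <= c * nr h ^+ 2) ->
  (exists v, L v <> 0) ->
  (forall v, v != 0 -> cplx L v = 0 -> 0 < herm_re B v v) ->
  exists l nu H C delta c, peak_data D p l nu H C delta c.
Proof.
move=> DrhoP rho_p lL bB taylor grad levi.
pose l := cplx L; have ll : complex_linear l := cplx_linear lL.
pose P := sqnorm_form l; have bP : real_bilinear P := sqnorm_form_bilinear ll.
have P0 v : 0 <= P v v by rewrite /P sqnorm_formE sqr_ge0.
have PP v : v != 0 -> P v v = 0 -> 0 < herm_re B v v.
  move=> v0; rewrite /P sqnorm_formE => /eqP; rewrite sqrf_eq0 normc_eq0 => /eqP.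
  exact: levi.
have [A [c [A0 c0 HA]]] := quad_penalize (herm_re_bilinear bB) bP P0 PP.
have [K1 K10 HK1] := forms_bounded bB.
have [K2 K20 HK2] := cplx_bounded lL.
have [K [K0 K1K K2K cK]] : exists K : R, [/\ 0 < K, K1 <= K, K2 <= K & c <= K].
  by exists (K1 + K2 + c + 1); split; lra.
have [r r0 Hr] := taylor _ (divr_gt0 c0 (ltr0Sn R 1)).
have [delta d0 small] := levi_radius A0 K0 c0 r0.
have [C CE CK] : exists2 C, C = 4 * K + 4 * A * K ^+ 2 & 4 * K <= C.
  by exists (4 * K + 4 * A * K ^+ 2) => //; rewrite lerDl mulr_ge0 ?mulr_ge0 ?exprn_ge0 // ltW.
have bL (h : T) : `|L h| <= K * nr h /\ normc (l h) <= 2 * K * nr h.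
  have [h1 h2] := HK2 h; have h0 := nr_ge0 h.
  have h3 : K2 * nr h <= K * nr h by apply: ler_wpM2r => //; lra.
  split; first lra.
  by apply: (le_trans h2); rewrite -!mulrA ler_pM2l.
have bF (h : T) : [/\ `|herm_re (B) h h| <= K * nr h ^+ 2,
    `|complex.Re (holo_of (B) h h)| <= K * nr h ^+ 2,
    `|complex.Im (holo_of (B) h h)| <= K * nr h ^+ 2
    & `|B h h / 2| <= K * nr h ^+ 2].
  have h3 : K1 * nr h ^+ 2 <= K * nr h ^+ 2.
    by apply: ler_wpM2r; [rewrite exprn_ge0 // nr_ge0|lra].
  by have [h1 h2 h4 h5] := HK1 h; split; apply: le_trans h3.
have side (h : T) : nr h < delta -> U (p + h) /\ `|rho (p + h) - L h| <= C * nr h ^+ 2.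
  move=> /(small _ (nr_ge0 h))[h1 _ _ _]; have [Uh Th] := Hr h h1; split=> //.
  have [_ _ _ b1] := bF h; rewrite rho_p subr0 in Th.
  have n2 : 0 <= nr h ^+ 2 by rewrite exprn_ge0 // nr_ge0.
  have cC : 4 * K * nr h ^+ 2 <= C * nr h ^+ 2 by apply: ler_wpM2r.
  have cK2 : c * nr h ^+ 2 <= K * nr h ^+ 2 by apply: ler_wpM2r.
  have K2' : 0 <= K * nr h ^+ 2 by rewrite mulr_ge0 // ltW.
  rewrite (_ : rho (p + h) - L h = rho (p + h) - L h - B h h / 2 + B h h / 2); last by rewrite subrK.
  by apply: le_trans (ler_normD _ _) _; apply: le_trans (lerD Th b1) _; lra.
have [v Lv] := grad.
have lv : l v != 0.
  by apply/eqP => lv; apply: Lv; exact: (congr1 (@complex.Re R) lv).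
(* Normalised by [l nu = 1], so that [- nu] points into [D]. *)
pose nu := (l v)^-1 *: v.
pose H0 (h : T) : R[i] := - (l h + holo_of (B) h h) - A%:C * (l h * l h).
(* Values in rows of length 1 make the lemmas on maps between row spaces applicable. *)
pose H (z : T) : 'rV[R[i]]_1 := H0 (z - p) *: const_mx 1.
have HE z : H z 0 0 = H0 (z - p) by rewrite /H !mxE mulr1.
exists l, nu, H, C, delta, (c / 4); split.
- by split=> //; [apply: lt_le_trans CK; rewrite mulr_gt0|rewrite divr_gt0].
- split=> //; first by rewrite /nu complex_linearZ // mulVf.
  move=> h; have [_ /le_trans] := bL h; apply; apply: ler_wpM2r; first exact: nr_ge0.
  by apply: le_trans CK; rewrite ler_pM2r // ler_nat.
- move=> h /side[Uh]; rewrite ler_norml => /andP[Th _] /(DrhoP _ Uh).1 rh.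
  by apply: ltW; move: Th; rewrite lerNl opprB lerBlDr => /le_lt_trans; apply; rewrite gtrDl.
- move=> h /side[Uh]; rewrite ler_norml => /andP[_ Th] lh; apply/(DrhoP _ Uh).
  by apply: le_lt_trans lh; rewrite -lerBlDl.
split.
- move=> z _; apply: differentiableZl.
  apply: (@differentiable_shift _ R[i]^o H0); apply: differentiableB.
    apply: differentiableN; apply: differentiableD; first exact: complex_linear_holo.
    exact: holo_of_diff.
  apply: differentiableM; first exact: differentiable_cst.
  by apply: differentiableM; exact: complex_linear_holo.
- move=> h /(small _ (nr_ge0 h))[_ h2 _ _]; rewrite HE addrC addKr /H0.
  have h0 := nr_ge0 h; have [_ b1] := bL h; have [_ b2 b3 _] := bF h.
  have b4 := le_trans (normc_le_ReIm (holo_of (B) h h)) (lerD b2 b3).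
  have N2 : nr h ^+ 2 <= nr h by rewrite expr2; apply: ler_piMl.
  have b5 := ler_wpM2l (ltW K0) N2.
  apply: le_trans (normcD _ _) _; rewrite !normcN normcM normc_real (ger0_norm A0) normcM.
  have b6 := normcD (l h) (holo_of (B) h h).
  have b7 : normc (l h) * normc (l h) <= 2 * K * nr h * (2 * K * nr h).
    by apply: ler_pM => //; exact: normc_ge0.
  have b8 : 2 * K * nr h * (2 * K * nr h) <= 4 * K ^+ 2 * nr h.
    rewrite (_ : _ * _ = 4 * K ^+ 2 * nr h ^+ 2); last by ring.
    by apply: ler_wpM2l => //; rewrite mulr_ge0 // exprn_ge0 // ltW.
  have b9 := ler_wpM2l A0 (le_trans b7 b8).
  rewrite (_ : C * nr h = 4 * K * nr h + A * (4 * K ^+ 2 * nr h)); last by rewrite CE; ring.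
  have b10 : 2 * K * nr h <= 2 * K * nr h by [].
  lra.
- move=> h /(small _ (nr_ge0 h))[h1 h2 h3 h4] Dh; rewrite HE addrC addKr; have [Uh Th] := Hr h h1.
  have rh := (DrhoP _ Uh).1 Dh; have [b0 b1 _ b3] := bF h; have [bl _] := bL h.
  have E : L h + complex.Re (holo_of (B) h h) + herm_re (B) h h <=
      c / 2 * nr h ^+ 2.
    have -> : L h + complex.Re (holo_of (B) h h) + herm_re (B) h h =
        L h + B h h / 2.
      by rewrite holo_ofE // /herm_re /=; move: (B _ _) (B _ _) => x y; field.
    by move: Th; rewrite rho_p ler_norml => /andP[? ?]; lra.
  have := levi_arith A0 K0 c0 cK (nr_ge0 h) h2 h3 h4 bl b1 b0 (P0 h) (HA h) E.
  suff -> : complex.Re (H0 h) = - L h - complex.Re (holo_of (B) h h) -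
    A * (2 * L h ^+ 2 - P h h) by [].
  have E2 (x y : R[i]) : complex.Re (- (x + y) - A%:C * (x * x)) = - complex.Re x - complex.Re y
      - A * (2 * complex.Re x ^+ 2 - (complex.Re x * complex.Re x + complex.Im x * complex.Im x)).
    by case: x y => [? ?] [? ?] /=; ring.
  exact: E2.
Qed.

Lemma peak_data_exists (D : set T) (p : T) : open D -> boundary D p ->
  C3_strongly_pseudoconvex_at D p ->
  exists l nu H C delta c, peak_data D p l nu H C delta c.
Proof.
move=> oD [clp nDp] [U [rho [[oU Up] Crho grad DU levi]]].
have C1 : C1_on U rho := Ck_on_C1 Crho.
have C2 w : C1_on U (dir_derive w rho) by have [_ /(_ w)[_ H]] := Crho; exact: (@Ck_on_C1 R n 1 U (dir_derive w rho) H).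
have cont : {for p, continuous rho} by have [H _] := Crho; exact: H.
have nD : ~ D p by move=> Dp; apply: nDp; exact: open_nbhs_nbhs.
have DrhoP z : U z -> D z <-> rho z < 0.
  move=> Uz; have E : (D `&` U) z = (U z /\ rho z < 0) by rewrite DU.
  by split=> [Dz|rz]; [have [] : U z /\ rho z < 0 by rewrite -E|have [] : (D `&` U) z by rewrite E].
clear DU; have rho_p : rho p = 0.
  apply/eqP; rewrite eq_le leNgt; apply/andP; split; last first.
    by rewrite leNgt; apply/negP => /(DrhoP p Up).2.
  apply/negP => rp; have [r r0 Hr] := (cont_nrP _ _).1 cont _ rp.
  have [s s0 Hs] := (open_nrP U).1 oU p Up.
  have [|w Dw wp] := (closure_nrP _ _).1 clp (Num.min r s); first by rewrite lt_min r0.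
  move: wp; rewrite lt_min => /andP[/Hr + /Hs Uw].
  by have := (DrhoP w Uw).1 Dw; rewrite ltr_norml => ? /andP[? ?]; lra.
apply: (@peak_data_of_taylor D U p rho (fun v => dir_derive v rho p) (hess rho p)) => //.
- exact: dir_derive_linear C1.
- exact: hess_bilinear C1 C2.
- exact: taylor2 C1 C2.
- exact: grad.
move=> v /eqP v0 lv0; have := levi v v0 ((complex_tangentE oU Up C1 v).2 lv0).
rewrite (levi_formE oU Up C1 C2) (levi_ofE (hess_bilinear oU Up C1 C2)) ltcE.
by move=> /andP[_]; exact.
Qed.

End LocalDefiningFunction.

(** * A truncated logarithmic potential *)

Section Truncation.
Context {R : realType}.
Implicit Types (al s : R).

(* [trunc al] is the C^1 function with derivative [- wgt al]; it equals
   [- s / 2 + O(1)] for negative [s] and vanishes for [s >= 0]. *)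
Definition wgt al s : R := if s < 0 then (1 - expR (al * s)) / 2 else 0.
Definition trunc0 al s : R := - s / 2 + (expR (al * s) - 1) / (2 * al).
Definition trunc al s : R := if s < 0 then trunc0 al s else 0.

Lemma trunc_ge al s : 0 < al -> - s / 2 - (2 * al)^-1 <= trunc al s.
Proof.
move=> al0; have a2 : 0 < (2 * al)^-1 by rewrite invr_gt0 mulr_gt0.
rewrite /trunc; case: ltP => s0; last lra.
rewrite /trunc0 mulrBl mul1r; have : 0 <= expR (al * s) / (2 * al).
  by rewrite divr_ge0 ?expR_ge0 // mulr_ge0 // ltW.
lra.
Qed.

Lemma trunc0_derive al s : 0 < al ->
  is_derive s (1 : R) (trunc0 al) (- ((1 - expR (al * s)) / 2)).
Proof.
move=> al0; rewrite /trunc0.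
have D1 : is_derive s (1 : R) (fun s : R => s * - (2^-1)) (- (2^-1)) by exact: is_derive_mulr.
have D2 : is_derive s (1 : R) (fun s : R => expR (s * al)) (expR (s * al) * al).
  by apply: (@is_derive1_comp R expR (fun s => s * al)); exact: is_derive_mulr.
have D3 := @is_derive1_comp R (fun s => s * (2 * al)^-1) _ s _ _ (is_derive_mulr _ _) D2.
have D4 := is_deriveB (is_deriveD D1 D3) (is_derive_cst ((2 * al)^-1) s (1 : R)).
have D5 : is_derive s (1 : R) (fun s => s * - 2^-1 + expR (s * al) * (2 * al)^-1 - (2 * al)^-1)
    (- 2^-1 + (2 * al)^-1 * (expR (s * al) * al) - 0) := D4.
rewrite (_ : - ((1 - expR (al * s)) / 2) = - 2^-1 + (2 * al)^-1 * (expR (s * al) * al) - 0); last first.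
  by rewrite (mulrC s al); field; rewrite gt_eqF.
rewrite (_ : (fun s => _) = (fun s => s * - 2^-1 + expR (s * al) * (2 * al)^-1 - (2 * al)^-1)) //.
by apply/funext => x; rewrite (mulrC x al); ring.
Qed.

Lemma trunc_derive al s : 0 < al -> is_derive s (1 : R) (trunc al) (- wgt al s).
Proof.
move=> al0; have /is_deriveRP D0 := trunc0_derive s al0.
have T0 : trunc0 al 0 = 0 by rewrite /trunc0 mulr0 expR0 subrr mul0r oppr0 mul0r addr0.
apply/is_deriveRP => e e0; have [r r0 Hr] := D0 e e0; rewrite /trunc /wgt.
case: (ltgtP s 0) => s0.
- exists (Num.min r (- s / 2)); first by rewrite lt_min r0 /=; lra.
  move=> t; rewrite le_min => /andP[/Hr + st].
  have -> // : t < 0 by move: st; rewrite ler_norml => /andP[? ?]; lra.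
- exists (s / 2); first by lra.
  move=> t; rewrite ler_norml => /andP[? ?].
  have -> : t < 0 = false by apply/negbTE; rewrite -leNgt; lra.
  by rewrite (_ : 0 - 0 - - 0 * (t - s) = 0); [rewrite normr0 mulr_ge0 // ltW|ring].
(* At 0 both branches have value 0 and derivative 0, so the pieces fit together to first order. *)
- exists r => // t /Hr; rewrite s0 T0 mulr0 expR0 subrr mul0r oppr0 mul0r !subr0.
  case: ltP => // _ _; by rewrite !addr0 normr0 mulr_ge0 // ltW.
Qed.

Lemma wgt_ge0 al s : 0 < al -> 0 <= wgt al s.
Proof.
move=> al0; rewrite /wgt; case: ltP => // s0; rewrite divr_ge0 // subr_ge0 ltW //.
by rewrite expR_lt1 pmulr_rlt0.
Qed.

Lemma wgt_le al s : wgt al s <= 2^-1.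
Proof.
rewrite /wgt; case: ltP => s0; last by rewrite invr_ge0.
have := expR_ge0 (al * s); lra.
Qed.

Lemma wgt_continuous al : 0 < al -> continuous (wgt al).
Proof.
move=> al0.
have E : wgt al = (fun s => (1 - expR (al * Num.min s 0)) / 2).
  apply/funext => s; rewrite /wgt /Num.min; case: ltP => // s0.
  by rewrite mulr0 expR0 subrr mul0r.
rewrite E => s; apply: cvgM; last exact: cvg_cst.
apply: cvgB; first exact: cvg_cst.
apply: (@continuous_comp _ _ _ (fun s => al * Num.min s 0) expR); last exact: continuous_expR.
apply: cvgM; first exact: cvg_cst.
by apply: continuous_min; [exact: cvg_id|exact: cvg_cst].
Qed.

End Truncation.

(** * Lower bounds for the distance from the peak function *)

Section LowerBound.
Context {R : realType} {n : nat}.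
Local Notation T := 'rV[R[i]]_n.
Local Notation kd := kobayashi_dist.
Local Notation KR := kobayashi_royden.
Context (D : set T) (p : T) (H : T -> 'rV[R[i]]_1) (delta c : R).
Context (oD : open D) (pD : ~ D p) (hH : holomorphic_on setT H) (delta0 : 0 < delta) (c0 : 0 < c).
Local Notation F z := (complex.Re (H z 0 0)).
Local Notation dF z v := ('d H z v 0 0).
Context (HD : forall z, D z -> nr (z - p) < delta -> c * nr (z - p) ^+ 2 <= F z).

Lemma peak_gt0 z : D z -> nr (z - p) < delta -> 0 < F z.
Proof.
move=> Dz zp; apply: lt_le_trans (HD Dz zp); rewrite mulr_gt0 // exprn_gt0 // nr_gt0 subr_eq0.
by apply/eqP => zE; apply: pD; rewrite -zE.
Qed.

(** At distance at least eta from [p] the real part of [H] is at least kappa, so the logarithm is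
    nonnegative and the truncation vanishes. *)
Lemma peak_far (al kappa eta : R) z : 0 < kappa -> kappa <= c * eta ^+ 2 -> 0 < eta -> D z ->
  eta <= nr (z - p) -> nr (z - p) < delta ->
  trunc al (ln (F z / kappa)) = 0 /\ wgt al (ln (F z / kappa)) = 0.
Proof.
move=> k0 ke eta0 Dz ez zd; rewrite /trunc /wgt.
suff -> : ln (F z / kappa) < 0 = false by [].
apply/negbTE; rewrite -leNgt; apply: ln_ge0; rewrite ler_pdivlMr // mul1r.
apply: (le_trans ke); apply: le_trans (HD Dz zd); rewrite ler_pM2l //.
by rewrite ler_sqr ?nnegrE ?nr_ge0 // ltW.
Qed.

Lemma peak_rderiv h t v : rderiv h t v ->
  is_derive t (1 : R) (fun s => F (h s)) (complex.Re (dF (h t) v)).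
Proof.
move=> hv; have H1 := rderiv_comp (hH (I : setT (h t))) hv.
exact: rderiv_Re (rderiv_coord 0 H1).
Qed.

(** The potential for [kd_lower]. By [peak_far] it already vanishes for eta <= |z - p| < delta, so
    the cut at delta creates no jump. *)
Definition lower_fun (rho al kappa : R) z : R :=
  if nr (z - p) < delta then rho * trunc al (ln (F z / kappa)) else 0.

Definition lower_dfun (rho al kappa : R) z v : R :=
  if nr (z - p) < delta then
    - (rho * wgt al (ln (F z / kappa)) / F z) * complex.Re (dF z v) else 0.

Lemma lower_fun_derive (rho al kappa eta : R) h t v : 0 < al -> 0 < kappa ->
  kappa <= c * eta ^+ 2 -> 0 < eta -> eta < delta -> D (h t) -> rderiv h t v ->
  is_derive t (1 : R) (lower_fun rho al kappa \o h) (lower_dfun rho al kappa (h t) v).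
Proof.
move=> al0 k0 ke eta0 ed Dt hv.
have ext (f g : R -> R) (d r : R) : 0 < r -> (forall s, `|s - t| <= r -> f s = g s) ->
    is_derive t (1 : R) f d -> is_derive t (1 : R) g d.
  move=> r0 fg /is_deriveRP Hf.
  have tt : f t = g t by apply: fg; rewrite subrr normr0 ltW.
  apply/is_deriveRP => e /Hf[r1 r10 H1].
  exists (Num.min r r1); first by rewrite lt_min r0.
  by move=> s; rewrite le_min -tt => /andP[/fg <- /H1].
have near (e : R) : 0 < e -> exists2 r : R, 0 < r & forall s, `|s - t| <= r -> nr (h s - h t) < e.
  move=> e0; have e2 : 0 < e / 2 by rewrite divr_gt0.
  have [r r0 Hr] := rderiv_cont hv e2; exists r => // s /Hr; lra.
rewrite /lower_dfun; case: ltP => td.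
  have [r r0 Hr] := near (delta - nr (h t - p)) ltac:(lra).
  have Ft := peak_gt0 Dt td.
  apply: (ext (fun s => rho * trunc al (ln (F (h s) / kappa))) _ _ r r0).
    move=> s /Hr sr; rewrite /lower_fun /=; have -> // : nr (h s - p) < delta.
    by have := nr_triangle (h t) (h s) p; lra.
  have D1 := @is_derive1_comp R (fun x => x * kappa^-1) _ t _ _ (is_derive_mulr _ _) (peak_rderiv hv).
  have q0 : 0 < F (h t) / kappa by rewrite divr_gt0.
  have D2 := @is_derive1_comp R (@ln R) _ t _ _ (is_derive1_ln q0) D1.
  have D3 := @is_derive1_comp R (trunc al) _ t _ _ (trunc_derive _ al0) D2.
  have D4 := is_deriveZ rho D3.
  rewrite (_ : - _ * _ = rho *: (- wgt al (ln (F (h t) / kappa)) *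
    ((F (h t) / kappa)^-1 * (kappa^-1 * complex.Re (dF (h t) v))))); first exact: D4.
  by rewrite /GRing.scale /=; field; rewrite !gt_eqF.
(* The point is at distance at least delta from [p]; nearby points of the curve stay at distance at
   least eta, where the potential is 0 on either branch. *)
have [r r0 Hr] := near (delta - eta) ltac:(lra).
have [r' r'0 Hr'] := (open_nrP D).1 oD _ Dt; have [r2 r20 Hr2] := near _ r'0.
have C0 : is_derive t (1 : R) (fun=> 0 : R) (0 : R) := is_derive_cst (0 : R) t (1 : R).
apply: (ext (fun=> 0) _ _ (Num.min r r2) _ _ C0).
  by rewrite lt_min r0.
move=> s; rewrite le_min => /andP[/Hr h1 /Hr2/Hr' Ds]; rewrite /lower_fun /=.
case: ltP => // sd; have [|-> _] := @peak_far al kappa eta _ k0 ke eta0 Ds _ sd.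
  by have := nr_triangle (h s) (h t) p; rewrite nrB in h1; lra.
by rewrite mulr0.
Qed.

Lemma lower_dfun_continuous (rho al kappa eta : R) h t : 0 < al -> 0 < kappa ->
  kappa <= c * eta ^+ 2 -> 0 < eta -> eta < delta -> D (h t) ->
  (forall t, rderiv h t (velocity h t)) -> continuous (velocity h) ->
  {for t, continuous (fun s => lower_dfun rho al kappa (h s) (velocity h s))}.
Proof.
move=> al0 k0 ke eta0 ed Dt hv vc.
have ext (f g : R -> R) (r : R) : 0 < r -> (forall s, `|s - t| <= r -> f s = g s) ->
    {for t, continuous f} -> {for t, continuous g}.
  move=> r0 fg Hf A; rewrite -fg ?subrr ?normr0 ?ltW // => /Hf /nbhsRP[r1 r10 H1].
  apply/nbhsRP; exists (Num.min r r1); first by rewrite lt_min r0.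
  by move=> s; rewrite lt_min /preimage /= => /andP[/ltW/fg <- /H1].
have near (e : R) : 0 < e -> exists2 r : R, 0 < r & forall s, `|s - t| <= r -> nr (h s - h t) < e.
  move=> e0; have e2 : 0 < e / 2 by rewrite divr_gt0.
  have [r r0 Hr] := rderiv_cont (hv t) e2; exists r => // s /Hr; lra.
have [td|td] := ltP (nr (h t - p)) delta.
  have [r r0 Hr] := near (delta - nr (h t - p)) ltac:(lra).
  have Ft := peak_gt0 Dt td.
  apply: (ext (fun s => - (rho * wgt al (ln (F (h s) / kappa)) / F (h s)) *
      complex.Re (dF (h s) (velocity h s))) _ r r0).
    move=> s /Hr sr; rewrite /lower_dfun /=; have -> // : nr (h s - p) < delta.
    by have := nr_triangle (h t) (h s) p; lra.
  have Fc : {for t, continuous (fun s => F (h s))}.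
    apply: differentiable_continuous; apply/derivable1_diffP.
    exact: (@ex_derive _ _ _ _ _ _ _ (peak_rderiv (hv t))).
  have oT : open (setT : set T) by exact: openT.
  have Dc := diff_along_continuous oT hH (I : setT (h t)) (hv t) (vc t).
  apply: cvgM; last first.
    apply: (@cvg_comp _ _ _ (fun s => dF (h s) (velocity h s)) (@complex.Re R)); last exact: Re_continuous.
    exact: (@cvg_comp _ _ _ (fun s => 'd H (h s) (velocity h s)) (fun A : 'rV[R[i]]_1 => A 0 0) _ _ _ Dc (@coord_continuous _ _ _ 0 0 _)).
  apply: cvgN; apply: cvgM; last by apply: cvgV => //; rewrite gt_eqF.
  apply: cvgM; first exact: cvg_cst.
  apply: (@cvg_comp _ _ _ (fun s => ln (F (h s) / kappa)) (wgt al)); last exact: wgt_continuous.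
  apply: (@cvg_comp _ _ _ (fun s => F (h s) / kappa) (@ln R)).
    by apply: cvgM; [exact: Fc|exact: cvg_cst].
  by apply: continuous_ln; rewrite divr_gt0.
have [r r0 Hr] := near (delta - eta) ltac:(lra).
have [r' r'0 Hr'] := (open_nrP D).1 oD _ Dt; have [r2 r20 Hr2] := near _ r'0.
apply: (ext (fun=> 0) _ (Num.min r r2)); last exact: cst_continuous.
  by rewrite lt_min r0.
move=> s; rewrite le_min => /andP[/Hr h1 /Hr2/Hr' Ds]; rewrite /lower_dfun /=.
case: ltP => // sd; have [|_ ->] := @peak_far al kappa eta _ k0 ke eta0 Ds _ sd.
  by have := nr_triangle (h s) (h t) p; rewrite nrB in h1; lra.
by rewrite mulr0 mul0r oppr0 mul0r.
Qed.

(** Used twice: with [rho = r0] and [al = 1] for the crude bound, and with [rho = 1] and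
    [al = r0 / 2] for the sharp one. The metric has to be estimated only within eta of [p], since
    the weight vanishes elsewhere. *)
Lemma lower_general (rho al kappa eta : R) : 0 <= rho -> 0 < al -> 0 < kappa ->
  kappa <= c * eta ^+ 2 -> 0 < eta -> eta < delta ->
  (forall z v, D z -> nr (z - p) < eta ->
    ((rho * wgt al (ln (F z / kappa)) / F z * normc (dF z v))%:E <= KR D z v)%E) ->
  forall z y, D z -> D y -> nr (z - p) < eta -> eta <= nr (y - p) ->
    ((rho * trunc al (ln (F z / kappa)))%:E <= kd D z y)%E.
Proof.
move=> rho0 al0 k0 ke eta0 ed HK z y Dz Dy zp yp.
have := @kd_lower R n D (lower_fun rho al kappa) (lower_dfun rho al kappa) z y.
have -> : lower_fun rho al kappa y = 0.
  rewrite /lower_fun; case: ltP => // yd.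
  by have [-> _] := @peak_far al kappa eta _ k0 ke eta0 Dy yp yd; rewrite mulr0.
have -> : lower_fun rho al kappa z = rho * trunc al (ln (F z / kappa)).
  by rewrite /lower_fun (lt_trans zp ed).
rewrite sub0r normrN => HL; apply: (@le_trans _ _ `|rho * trunc al (ln (F z / kappa))|%:E).
  by rewrite lee_fin ler_norm.
apply: HL.
- by move=> h t v Dt hv; exact: (lower_fun_derive _ al0 k0 ke eta0 ed Dt hv).
- by move=> h hv vc t Dt; exact: (lower_dfun_continuous al0 k0 ke eta0 ed Dt hv vc).
move=> x v Dx; rewrite /lower_dfun; case: ltP => xd; last by rewrite normr0; exact: KR_ge0.
have Fx := peak_gt0 Dx xd.
have [xe|ex] := ltP (nr (x - p)) eta; last first.
  have [_ ->] := @peak_far al kappa eta _ k0 ke eta0 Dx ex xd.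
  by rewrite mulr0 mul0r oppr0 mul0r normr0; exact: KR_ge0.
apply: le_trans (HK x v Dx xe); rewrite lee_fin normrM normrN.
have q0 : 0 <= rho * wgt al (ln (F x / kappa)) / F x.
  by rewrite divr_ge0 ?mulr_ge0 ?wgt_ge0 // ltW.
by rewrite (ger0_norm q0); apply: ler_wpM2l => //; exact: normc_Re.
Qed.

(** On the part of radius [r] where a disc stays near [p], composition with [H] gives a map into the
    right half-plane, and [halfplane_derive] bounds its derivative at 0 by 2 Re H(z) / r. *)
Lemma KR_peak (r : R) z v : D z -> 0 < r -> r <= 1 ->
  (forall phi, holomorphic_on unit_disc phi -> (forall x, unit_disc x -> D (phi x)) -> phi 0 = z ->
    forall x, normc x < r -> nr (phi x - p) < delta) ->
  ((r / 2 / F z * normc (dF z v))%:E <= KR D z v)%E.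
Proof.
move=> Dz r0 r1 Hr; apply: KR_lb => phi xi hphi phiD p0 pv.
have near := Hr phi hphi phiD p0.
have dphi x : normc x < r -> differentiable phi x.
  by move=> xr; apply: hphi; exact: lt_le_trans xr r1.
have dHp x : normc x < r -> differentiable (H \o phi) x.
  move=> xr; apply: differentiable_comp; first exact: dphi.
  exact: hH.
have n0 : normc (0 : R[i]) < r by rewrite normc_real normr0.
have zd : nr (z - p) < delta by rewrite -p0; exact: near.
have Fz := peak_gt0 Dz zd.
have := @halfplane_derive R (fun x => H (phi x) 0 0) ('d (H \o phi) 0 1 0 0) r r0.
rewrite p0 => hp.
have {}hp : normc ('d (H \o phi) 0 1 0 0) <= 2 * F z / r.
  apply: hp.
  - move=> x xr; exact: (@ex_derive _ _ _ _ _ _ _ (diff_coord 0 (dHp x xr))).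
  - move=> x xr; apply: peak_gt0; last exact: near.
    by apply: phiD; exact: lt_le_trans xr r1.
  - exact: (diff_coord 0 (dHp 0 n0)).
have E : dF z v = xi * 'd (H \o phi) 0 1 0 0.
  rewrite -pv -p0 -[in RHS](mulr1 xi).
  have -> : 'd H (phi 0) ('d phi 0 xi) = 'd (H \o phi) 0 xi.
    by rewrite (diff_comp (dphi 0 n0) (hH (I : setT (phi 0)))).
  by rewrite mulr1 diff_line mxE.
rewrite E normcM.
have := ler_wpM2l (normc_ge0 xi) hp.
move=> h2; apply: le_trans (ler_wpM2l _ h2) _; first by rewrite !divr_ge0 // ltW.
by rewrite le_eqVlt; apply/orP; left; apply/eqP; field; rewrite !gt_eqF.
Qed.

End LowerBound.

(** * Upper bounds from affine paths, and distances along discs *)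

Section UpperBound.
Context {R : realType} {n : nat}.
Local Notation T := 'rV[R[i]]_n.
Local Notation kd := kobayashi_dist.
Local Notation KR := kobayashi_royden.

Lemma C1_affine (a v : T) (s t : R) : C1_curve s t (fun x : R => a + x%:C *: v).
Proof.
exists (fun x : R => a + x%:C *: v); split=> //.
  by move=> t' j; have [+ _] := (rderivP _ _ _).1 (rderiv_affine a v t'); exact.
rewrite (_ : velocity _ = fun=> v); first exact: cst_continuous.
by apply/funext => t'; exact: rderiv_velocity (rderiv_affine a v t').
Qed.

Lemma integral_derive (G dG : R -> R) (s t : R) : s < t ->
  (forall x, s <= x <= t -> is_derive x (1 : R) G (dG x)) ->
  (forall x, s <= x <= t -> {for x, continuous dG}) ->
  (\int[lebesgue_measure]_(x in `[s, t]) (dG x)%:E = (G t - G s)%:E)%E.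
Proof.
move=> st dGG cG; rewrite EFinB; apply: continuous_FTC2 => //.
- apply: continuous_in_subspaceT => x; rewrite inE /= in_itv /=; exact: cG.
- have Gc x : s <= x <= t -> {for x, continuous G}.
    move=> sxt; apply: differentiable_continuous; apply/derivable1_diffP.
    exact: (@ex_derive _ _ _ _ _ _ _ (dGG x sxt)).
  split.
  + move=> x; rewrite in_itv /= => /andP[sx xt].
    by apply: (@ex_derive _ _ _ _ _ _ _ (dGG x _)); rewrite !ltW.
  + by apply: cvg_at_right_filter; apply: Gc; rewrite lexx ltW.
  + by apply: cvg_at_left_filter; apply: Gc; rewrite lexx ltW.
- move=> x; rewrite in_itv /= => /andP[sx xt]; rewrite derive1E.
  by rewrite (@derive_val _ _ _ _ _ _ _ (dGG x _)) // !ltW.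
Qed.

Lemma kd_upper (D : set T) (a v : T) (G dG : R -> R) (s t : R) : s < t ->
  (forall x, s <= x <= t -> D (a + x%:C *: v)) ->
  (forall x, s <= x <= t -> (KR D (a + x%:C *: v) v <= (dG x)%:E)%E) ->
  (forall x, s <= x <= t -> is_derive x (1 : R) G (dG x)) ->
  (forall x, s <= x <= t -> {for x, continuous dG}) ->
  (kd D (a + s%:C *: v) (a + t%:C *: v) <= (G t - G s)%:E)%E.
Proof.
move=> st gD gK dGG cG.
apply: le_trans (kd_le_length (pw_one st (C1_affine a v s t)) gD) _.
rewrite -(integral_derive st dGG cG) /curve_length.
rewrite (_ : (fun x => KR D _ _) = (fun x : R => KR D (a + x%:C *: v) v)); last first.
  by apply/funext => x; rewrite (rderiv_velocity (rderiv_affine a v x)).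
rewrite -integral_oo_cc; last by move=> x; exact: KR_ge0.
apply: le_integral_nomeas => x; first by move=> _; exact: KR_ge0.
by rewrite /= in_itv /=; exact: gK.
Qed.

End UpperBound.

Section Discs.
Context {R : realType} {n : nat}.
Local Notation T := 'rV[R[i]]_n.
Local Notation kd := kobayashi_dist.
Local Notation KR := kobayashi_royden.

Lemma nr_rV1 (w : 'rV[R[i]]_1) : nr w = normc (w 0 0).
Proof.
apply/eqP; rewrite eq_le normc_le_nr andbT; apply: nr_le; first exact: normc_ge0.
by move=> j; rewrite ord1.
Qed.

(** The unit disc as a set of rows, so that the lemmas on Kobayashi distances apply to it. *)
Definition disc1 : set 'rV[R[i]]_1 := [set w | nr w < 1].

Definition disc_lift (phi : R[i] -> T) (w : 'rV[R[i]]_1) : T := phi (w 0 0).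

Lemma disc_lift_holo phi : holomorphic_on unit_disc phi -> holomorphic_on disc1 (disc_lift phi).
Proof.
move=> hphi w; rewrite /disc1 /= nr_rV1 => w1; apply: differentiable_comp; last exact: hphi.
exact: differentiable_coord.
Qed.

Lemma open_disc1 : open disc1.
Proof.
apply/open_nrP => v v1; exists (1 - nr v); first by rewrite subr_gt0.
by move=> w wv; rewrite /disc1 /=; have := le_nrB w v; lra.
Qed.

(** The metric is compared with that of the largest disc about each point. The resulting factor 1 in
    front of the logarithm is not sharp, but it affects only the exponent [al] in the bootstrap. *)
Lemma kd_disc1 (b : 'rV[R[i]]_1) : disc1 b -> (kd disc1 0 b <= (- ln (1 - nr b))%:E)%E.
Proof.
rewrite /disc1 /= => b1.
pose G (x : R) := - ln (1 - x * nr b); pose dG (x : R) := nr b / (1 - x * nr b).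
have b0 := nr_ge0 b.
have pos (x : R) : 0 <= x <= 1 -> 0 < 1 - x * nr b.
  by move=> /andP[x0 x1]; have h : x * nr b <= nr b; [exact: ler_piMl|lra].
have := @kd_upper R 1 disc1 0 b G dG 0 1 ltr01.
have G0 : G 0 = 0 by rewrite /G mul0r subr0 ln1 oppr0.
have G1 : G 1 = - ln (1 - nr b) by rewrite /G mul1r.
rewrite scale0r scale1r !add0r G0 G1 subr0; apply.
- move=> x x01; rewrite add0r /disc1 /= nrZ normc_real ger0_norm; last by case/andP: x01.
  by have := pos x x01; lra.
- move=> x x01; rewrite add0r; apply: KR_ball; first exact: pos.
  move=> w wx; rewrite /disc1 /=; have := le_nrB w (x%:C *: b).
  rewrite nrZ normc_real ger0_norm; last by case/andP: x01.
  by lra.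
- move=> x x01; have p0 := pos x x01.
  have D1 : is_derive x (1 : R) (fun x : R => 1 - x * nr b) (0 - nr b).
    by apply: is_deriveB; exact: is_derive_mulr.
  have D2 := is_deriveN (@is_derive1_comp R (@ln R) _ x _ _ (is_derive1_ln p0) D1).
  rewrite /dG (_ : _ / _ = - ((1 - x * nr b)^-1 * (0 - nr b))); first exact: D2.
  by rewrite sub0r mulrN opprK mulrC.
- move=> x x01; have p0 := pos x x01.
  apply: cvgM; first exact: cvg_cst.
  apply: cvgV; first by rewrite gt_eqF.
  apply: cvgB; first exact: cvg_cst.
  by apply: cvgM; [exact: cvg_id|exact: cvg_cst].
Qed.

Lemma kd_disc (D : set T) phi x : holomorphic_on unit_disc phi ->
  (forall y, unit_disc y -> D (phi y)) -> unit_disc x ->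
  (kd D (phi 0%R) (phi x) <= (- ln (1 - normc x))%:E)%E.
Proof.
move=> hphi phiD x1; pose b : 'rV[R[i]]_1 := const_mx x.
have nb : nr b = normc x by rewrite nr_rV1 mxE.
have := @kd_holo R 1 n disc1 D (disc_lift phi) 0 b open_disc1 (disc_lift_holo hphi).
rewrite /disc_lift !mxE => H; apply: le_trans (H _) _.
  by move=> w; rewrite /disc1 /= nr_rV1 => w1; exact: phiD.
by rewrite -nb; apply: kd_disc1; rewrite /disc1 /= nb.
Qed.

Lemma disc_lip (D : set T) (M : R) phi x : 0 < M -> (forall w, D w -> nr w <= M) ->
  holomorphic_on unit_disc phi -> (forall y, unit_disc y -> D (phi y)) -> normc x < 2^-1 ->
  nr (phi x - phi 0) <= 4 * cauchy_constant R * M * normc x.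
Proof.
move=> M0 DM hphi phiD x2; pose b : 'rV[R[i]]_1 := const_mx x.
have nb : nr b = normc x by rewrite nr_rV1 mxE.
have h2 : 0 < 2^-1 :> R by rewrite invr_gt0.
have := @holo_lip R 1 n (disc_lift phi) 0 2^-1 M h2 (ltW M0).
rewrite mulfV ?pnatr_eq0 // => H.
have {}H : nr (disc_lift phi b - disc_lift phi 0) <=
    2 * (cauchy_constant R * M / 2^-1) * nr (b - 0).
  apply: H.
  - by move=> z; rewrite subr0; exact: disc_lift_holo.
  - by move=> z; rewrite subr0 nr_rV1 => z1; apply: DM; exact: phiD.
  - by rewrite subrr nr0.
  - by rewrite subr0 nb.
move: H; rewrite /disc_lift !mxE subr0 nb invrK.
by rewrite (_ : 2 * _ = 4 * cauchy_constant R * M); [|ring].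
Qed.

End Discs.

(** * The lower bound with the sharp factor 1/2 *)

Section LowerBoundGlobal.
Context {R : realType} {n : nat}.
Local Notation T := 'rV[R[i]]_n.
Local Notation kd := kobayashi_dist.
Local Notation KR := kobayashi_royden.
Context (D : set T) (p : T) (H : T -> 'rV[R[i]]_1) (delta c C eta M : R).
Context (dD : domain D) (pD : ~ D p) (hH : holomorphic_on setT H) (delta0 : 0 < delta) (c0 : 0 < c).
Local Notation F z := (complex.Re (H z 0 0)).
Local Notation dF z v := ('d H z v 0 0).
Context (HD : forall z, D z -> nr (z - p) < delta -> c * nr (z - p) ^+ 2 <= F z).
Context (C0 : 0 < C) (HC : forall z, nr (z - p) < delta -> normc (H z 0 0) <= C * nr (z - p)).
Context (eta0 : 0 < eta) (etad : 2 * eta <= delta).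
Context (M0 : 0 < M) (DM : forall w, D w -> nr w <= M).
Local Notation kappa := (c * eta ^+ 2).

Let oD : open D. Proof. by case: dD. Qed.
Let ed : eta < delta. Proof. by apply: lt_le_trans etad; rewrite mulr_natl mulr2n ltrDl. Qed.
Let k0 : 0 < kappa. Proof. by rewrite mulr_gt0 // exprn_gt0. Qed.

(** By [disc_lip], a disc through a point within eta of [p] stays within 2 eta <= delta of [p] on
    the fixed radius [r0], so [KR_peak] applies with this radius. *)
Lemma lower_bound_crude : exists2 r0 : R, 0 < r0 <= 1 & forall z y, D z -> D y ->
  nr (z - p) < eta -> eta <= nr (y - p) -> r0 * trunc 1 (ln (F z / kappa)) <= dk D z y.
Proof.
pose L := 4 * cauchy_constant R * M.
have L0 : 0 < L by rewrite !mulr_gt0 // cauchy_constant_gt0.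
pose r0 := Num.min 2^-1 (eta / L).
have r00 : 0 < r0 by rewrite lt_min invr_gt0 ltr0Sn divr_gt0.
have r01 : r0 <= 1 by rewrite ge_min; apply/orP; left; rewrite invf_le1 // ler1n.
exists r0; first by rewrite r00.
move=> z y Dz Dy zp yp; rewrite -lee_fin -(dkE dD Dz Dy).
apply: (lower_general oD pD hH c0 HD (ltW r00) ltr01 k0 (lexx _) eta0 ed) => // {zp yp y Dy} {}z v {}Dz zp.
apply: le_trans (KR_peak pD hH c0 HD v Dz r00 r01 _); last first.
  move=> phi hphi phiD p0 x; rewrite lt_min => /andP[x2]; rewrite ltr_pdivlMr // mulrC => xL.
  have := disc_lip M0 DM hphi phiD x2; rewrite p0 -/L => xz.
  have := nr_triangle z (phi x) p; have := etad; lra.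
have Fz : 0 < F z by exact: (peak_gt0 pD c0 HD Dz (lt_trans zp ed)).
rewrite lee_fin; apply: ler_wpM2r; first exact: normc_ge0.
apply: ler_wpM2r; first by rewrite invr_ge0 ltW.
by apply: ler_wpM2l; [exact: ltW|exact: wgt_le].
Qed.

(* The crude bound shows that a disc through [z] stays near [p] on all but a
   small fraction of its radius, and this improves the constant to the sharp 1/2. *)
Lemma lower_bound_trunc : exists al k : R, [/\ 0 < al, 0 < k & forall z y, D z -> D y ->
  nr (z - p) < eta -> eta <= nr (y - p) -> trunc al (ln (F z / k)) <= dk D z y].
Proof.
have [r0 /andP[r00 r01] Hr0] := lower_bound_crude.
have al0 : 0 < r0 / 2 by rewrite divr_gt0.
have e0 : 0 < expR 1 :> R by exact: expR_gt0.
(* Dividing by e shifts the logarithm by 1, which exactly absorbs the constant 1/2 lost in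
   [trunc_ge] when the crude bound is applied below. *)
have k1 : 0 < kappa / expR 1 by rewrite divr_gt0.
have kk : kappa / expR 1 <= kappa.
  rewrite ler_pdivrMr // ler_peMr ?(ltW k0) //.
  by apply: le_trans (expR_ge1Dx 1); rewrite lerDl.
exists (r0 / 2), (kappa / expR 1); split => // z y Dz Dy zp yp; rewrite -lee_fin -(dkE dD Dz Dy) -[trunc _ _]mul1r.
apply: (lower_general oD pD hH c0 HD ler01 al0 k1 kk eta0 ed) => // {zp yp y Dy} {}z v {}Dz zp.
have Fz : 0 < F z by exact: (peak_gt0 pD c0 HD Dz (lt_trans zp ed)).
set s := ln _; rewrite mul1r.
have Es : ln (F z / kappa) = s - 1.
  rewrite /s !ln_div ?posrE ?divr_gt0 // expRK; lra.
rewrite /wgt; case: ltP => s0; last by rewrite mul0r mul0r; exact: KR_ge0.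
(* This radius is twice the weight [wgt (r0 / 2) s], as [KR_peak] asks. If the disc were at distance
   at least delta from [p] at some x within it, the crude bound and [kd_disc] would give - r0 s / 2
   <= - log (1 - |x|), which contradicts |x| < 1 - exp (r0 s / 2). *)
have r1 : 0 < 1 - expR (r0 / 2 * s) by rewrite subr_gt0 expR_lt1 pmulr_rlt0.
apply: (KR_peak pD hH c0 HD v Dz r1); first by rewrite gerBl expR_ge0.
move=> phi hphi phiD p0 x xr; rewrite ltNge; apply/negP => dx.
have e1 := expR_gt0 (r0 / 2 * s).
have x1 : normc x < 1 by lra.
have Dx : D (phi x) by exact: phiD.
have := Hr0 z (phi x) Dz Dx zp (le_trans (ltW ed) dx); rewrite Es => h1.
have := kd_disc hphi phiD x1; rewrite p0 dkE // lee_fin => h2.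
have h3 : r0 / 2 * s < ln (1 - normc x).
  by rewrite -[ltLHS]expRK ltr_ln ?posrE ?expR_gt0 //; lra.
have := ler_wpM2l (ltW r00) (trunc_ge (s - 1) (@ltr01 R)).
rewrite mulr1 (_ : r0 * _ = - (r0 / 2 * s)); last by field.
lra.
Qed.

(** The estimate |H(z)| <= C |z - p| converts the logarithm of the peak function into that of |z -
    p|, up to an additive constant. *)
Lemma lower_bound : exists K : R, forall z y, D z -> D y ->
  nr (z - p) < eta -> eta <= nr (y - p) -> - ln (nr (z - p)) / 2 - K <= dk D z y.
Proof.
have [al [k1 [al0 k10 Hal]]] := lower_bound_trunc.
exists ((2 * al)^-1 + ln (C / k1) / 2) => z y Dz Dy zp yp.
apply: le_trans (Hal z y Dz Dy zp yp); apply: le_trans (trunc_ge _ al0).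
have zd := lt_trans zp ed.
have Fz : 0 < F z by exact: (peak_gt0 pD c0 HD Dz zd).
have z0 : 0 < nr (z - p).
  by rewrite nr_gt0 subr_eq0; apply/eqP => zE; apply: pD; rewrite -zE.
have : ln (F z / k1) <= ln (C / k1 * nr (z - p)).
  rewrite ler_ln ?posrE ?mulr_gt0 ?invr_gt0 // mulrAC; apply: ler_wpM2r.
    by rewrite invr_ge0 ltW.
  exact: le_trans (le_trans (ler_norm _) (normc_Re _)) (HC zd).
have -> : ln (C / k1 * nr (z - p)) = ln (C / k1) + ln (nr (z - p)).
  by rewrite lnM ?posrE ?divr_gt0.
move: (ln (C / k1)) (ln (nr (z - p))) (ln (F z / k1)) (2 * al)^-1 => x1 x2 x3 x4.
lra.
Qed.

End LowerBoundGlobal.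

(** * Upper bounds along the inner normal *)

Section Radial.
Context {R : realType} {n : nat}.
Local Notation T := 'rV[R[i]]_n.
Local Notation kd := kobayashi_dist.
Local Notation KR := kobayashi_royden.

Lemma moebius_derive (a z : R[i]) : 1 + a * z != 0 ->
  is_derive z 1 (fun y : R[i] => (1 - y) / (1 + a * y)) (- (1 + a) / (1 + a * z) ^+ 2).
Proof.
move=> az.
have i1 : is_derive z 1 (fun y : R[i] => 1 - y) (0 - 1) by apply: is_deriveB.
have i2 : is_derive z 1 (fun y : R[i] => 1 + a * y) (0 + a).
  by apply: is_deriveD; exact: is_derive_scale.
have i3 : is_derive z 1 (fun y : R[i] => (1 + a * y)^-1) (- (1 + a * z) ^- 2 *: (0 + a)).
  apply: DeriveDef; first by apply: derivableV => //; case: i2.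
  by rewrite (@deriveV _ _ (fun y => 1 + a * y)) //; case: i2 => // _ ->.
have i4 := is_deriveM i1 i3.
apply: is_derive_eq i4 _; rewrite -![_ *: _]/(_ * _) /=.
by field.
Qed.

Lemma is_derive_differentiable (f : R[i] -> R[i]) (z d : R[i]) :
  is_derive z 1 f d -> differentiable f z.
Proof. by move=> [/derivable1_diffP]. Qed.

Lemma is_derive_diff (f : R[i] -> R[i]) (z d : R[i]) : is_derive z 1 f d -> 'd f z 1 = d.
Proof. by move=> [/derivable1_diffP df <-]; rewrite deriveE. Qed.

Lemma moebius_disc (a : R) (z : R[i]) : 0 <= a -> a < 1 -> normc z < 1 ->
  1 + a%:C * z != 0 /\ normc (z + a%:C) < normc (1 + a%:C * z).
Proof.
move=> a0 a1 z1.
have E : normc (1 + a%:C * z) ^+ 2 - normc (z + a%:C) ^+ 2 = (1 - a ^+ 2) * (1 - normc z ^+ 2).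
  rewrite !normc_sqr; case: z {z1} => x y /=; ring.
have a2 : 0 < 1 - a ^+ 2 by rewrite subr_gt0 expr_lt1.
have z2 : 0 < 1 - normc z ^+ 2 by rewrite subr_gt0 expr_lt1 // normc_ge0.
have L : normc (z + a%:C) < normc (1 + a%:C * z).
  rewrite -(@ltr_pXn2r _ 2) ?nnegrE ?normc_ge0 // -subr_gt0 E; exact: mulr_gt0.
by split=> //; rewrite -normc_gt0; apply: le_lt_trans L; exact: normc_ge0.
Qed.

(* The Moebius map [x |-> tau (1 - x) / (1 + a x)] sends the unit disc onto the
   disc of radius [r] and centre [r], and 0 to [tau] when [a = 1 - tau / r]. *)
Lemma KR_radial (D : set T) (p nu : T) (r tau : R) :
  (forall w, normc (w - r%:C) < r -> D (p + w *: - nu)) -> 0 < tau -> tau <= r ->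
  (KR D (p + tau%:C *: - nu) (- nu) <= ((tau^-1 + (2 * r - tau)^-1) / 2)%:E)%E.
Proof.
move=> rD t0 tr; have r0 : 0 < r by exact: lt_le_trans tr.
pose a := 1 - tau / r.
have a0 : 0 <= a by rewrite subr_ge0 ler_pdivrMr // mul1r.
have a1 : a < 1 by rewrite /a gtrBl divr_gt0.
pose w (y : R[i]) := tau%:C * ((1 - y) / (1 + a%:C * y)).
have dw (y : R[i]) : normc y < 1 ->
    is_derive y 1 w (tau%:C * (- (1 + a%:C) / (1 + a%:C * y) ^+ 2)).
  move=> y1; have [ny _] := moebius_disc a0 a1 y1.
  exact: (is_derive_compC (moebius_derive ny) (is_derive_scale tau%:C _)).
pose phi (y : R[i]) : T := p + w y *: - nu.
have w0 : w 0 = tau%:C by rewrite /w mulr0 subr0 addr0 divr1 mulr1.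
have n0 : normc (0 : R[i]) < 1 by rewrite normc0.
have dphi (y : R[i]) : normc y < 1 -> differentiable phi y.
  move=> /dw/is_derive_differentiable wd; have [d1 _] := affine_disc p (- nu) (w y).
  exact: (differentiable_comp wd d1).
have t2 : 0 < 2 * r - tau by lra.
pose xi : R[i] := (- (r / (tau * (2 * r - tau))))%:C.
have -> : (tau^-1 + (2 * r - tau)^-1) / 2 = normc xi.
  rewrite /xi normc_real normrN gtr0_norm ?divr_gt0 ?mulr_gt0 //.
  by field; rewrite !gt_eqF.
apply: (@KR_ub _ _ _ _ _ phi).
- by move=> y; exact: dphi.
- move=> y y1; apply: rD; have [ny lt] := moebius_disc a0 a1 y1.
  have -> : w y - r%:C = - (r%:C * (y + a%:C)) / (1 + a%:C * y).
    have tE : tau%:C = r%:C * (1 - a%:C).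
      by rewrite /a rmorphB rmorph1 opprB addrCA subrr addr0 -rmorphM mulrC divfK // gt_eqF.
    by rewrite /w tE; field.
  rewrite normcM normcV -!nr_normc nrN !nr_normc normcM normc_real gtr0_norm //.
  rewrite ltr_pdivrMr ?normc_gt0 // ltr_pM2l //.
- by rewrite /phi w0.
have dw0 := dw 0 n0.
have wd := is_derive_differentiable dw0.
have [d1 E1] := affine_disc p (- nu) (w 0).
have E : 'd phi 0 xi = 'd w 0 xi *: - nu.
  rewrite (_ : phi = (fun y : R[i] => p + y *: - nu) \o w) // (diff_comp wd d1) /=.
  by rewrite [LHS](congr1 (fun f : _ -> _ => f ('d w 0 xi)) E1).
rewrite E.
have -> : 'd w 0 xi = xi * (tau%:C * (- (1 + a%:C) / (1 + a%:C * 0) ^+ 2)).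
  rewrite diff_line -[RHS]/(_ *: _); congr (_ *: _).
  exact: is_derive_diff dw0.
rewrite mulr0 addr0 expr1n divr1.
rewrite (_ : xi * _ = 1) ?scale1r //.
have real_id (x y z : R) : x * (y * - (1 + z)) = 1 -> x%:C * (y%:C * - (1 + z%:C)) = 1 :> R[i].
  have -> : x%:C * (y%:C * - (1 + z%:C)) = (x * (y * - (1 + z)))%:C.
    by rewrite !rmorphM rmorphN rmorphD rmorph1.
  by move=> ->.
by apply: real_id; rewrite /a; field; rewrite !gt_eqF.
Qed.

(** The bound of [KR_radial] is the derivative of (log x - log (2 r - x))/2. For s < t <= r one has
    2 r - s <= 2 (2 r - t), so the second logarithm costs at most (log 2)/2. *)
Lemma kd_radial (D : set T) (p nu : T) (r s t : R) :
  (forall w, normc (w - r%:C) < r -> D (p + w *: - nu)) -> 0 < s -> s < t -> t <= r ->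
  (kd D (p + s%:C *: - nu) (p + t%:C *: - nu) <= ((ln t - ln s) / 2 + ln 2 / 2)%:E)%E.
Proof.
move=> rD s0 st tr; have r0 : 0 < r by lra.
pose G (x : R) := (ln x - ln (2 * r - x)) / 2.
pose dG (x : R) := (x^-1 + (2 * r - x)^-1) / 2.
have pos (x : R) : s <= x <= t -> [/\ 0 < x, x <= r & 0 < 2 * r - x].
  by move=> /andP[? ?]; split; lra.
have H : (kd D (p + s%:C *: - nu) (p + t%:C *: - nu) <= (G t - G s)%:E)%E.
  apply: (kd_upper (dG := dG)) => //.
  - move=> x /pos[x0 xr x2]; apply: rD.
    by rewrite -rmorphB normc_real ltr_norml; apply/andP; split; lra.
  - by move=> x /pos[x0 xr x2]; exact: KR_radial.
  - move=> x /pos[x0 xr x2].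
    have D1 : is_derive x (1 : R) (fun y : R => 2 * r - y) (0 - 1) by apply: is_deriveB.
    have D2 := @is_derive1_comp R (@ln R) _ x _ _ (is_derive1_ln x2) D1.
    have D3 := is_deriveB (is_derive1_ln x0) D2.
    have D4 := @is_derive1_comp R (fun y => y * 2^-1) _ x _ _ (is_derive_mulr _ _) D3.
    rewrite (_ : dG x = 2^-1 * (x^-1 - (2 * r - x)^-1 * (0 - 1))); first exact: D4.
    by rewrite /dG; ring.
  - move=> x /pos[x0 xr x2]; apply: cvgM; last exact: cvg_cst.
    apply: cvgD; first by apply: cvgV; [rewrite gt_eqF|exact: cvg_id].
    apply: cvgV; first by rewrite gt_eqF.
    by apply: cvgB; [exact: cvg_cst|exact: cvg_id].
apply: (le_trans H); rewrite lee_fin /G.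
have : ln (2 * r - s) <= ln (2 * (2 * r - t)) by rewrite ler_ln ?posrE ?mulr_gt0 //; lra.
rewrite lnM ?posrE //; lra.
Qed.

End Radial.

(** * The upper bound for non-tangential points *)

Section UpperBoundCone.
Context {R : realType} {n : nat}.
Local Notation T := 'rV[R[i]]_n.
Context (D : set T) (p : T) (l : T -> R[i]) (nu : T) (C delta : R).
Context (dD : domain D) (C0 : 0 < C) (delta0 : 0 < delta).
Context (ll : complex_linear l) (lnu : l nu = 1) (lC : forall v, normc (l v) <= C * nr v).
Context (outer : forall h, nr h < delta -> D (p + h) -> complex.Re (l h) <= C * nr h ^+ 2).
Context (inner : forall h, nr h < delta -> complex.Re (l h) + C * nr h ^+ 2 < 0 -> D (p + h)).

Lemma nr_nu_gt0 : 0 < nr nu.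
Proof.
rewrite nr_gt0; apply/eqP => nu0; have := lnu; rewrite nu0 complex_linear0 // => /eqP.
by rewrite eq_sym oner_eq0.
Qed.

Lemma Re_l_add (u v : T) : complex.Re (l (u + v)) = complex.Re (l u) + complex.Re (l v).
Proof. by rewrite -[u]scale1r ll mul1r ReD scale1r. Qed.

Lemma Re_l_scale (a : R) (v : T) : complex.Re (l (a%:C *: v)) = a * complex.Re (l v).
Proof. by rewrite complex_linearZ //; case: (l v) => x y /=; ring. Qed.

Lemma Re_l_le (v : T) : `|complex.Re (l v)| <= C * nr v.
Proof. exact: le_trans (normc_Re _) (lC v). Qed.

(** For |w - r| < r one has |w|^2 < 2 r Re w, so the quadratic error C |w|^2 |nu|^2 stays below Re w
    as soon as 2 C r |nu|^2 <= 1. *)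
Lemma inner_disc : exists2 r : R, 0 < r & forall w, normc (w - r%:C) < r -> D (p + w *: - nu).
Proof.
have N0 := nr_nu_gt0.
pose r := Num.min (delta / (2 * nr nu)) (2 * C * nr nu ^+ 2)^-1.
have r0 : 0 < r by rewrite lt_min divr_gt0 ?invr_gt0 ?mulr_gt0 ?exprn_gt0.
have r1 : r * (2 * nr nu) <= delta by rewrite -ler_pdivlMr ?mulr_gt0 // /r ge_min lexx.
have r2 : r * (2 * C * nr nu ^+ 2) <= 1.
  rewrite -ler_pdivlMr ?mulr_gt0 ?exprn_gt0 // mul1r /r ge_min lexx orbT //.
exists r => // w wr.
have w2 : normc w ^+ 2 < 2 * r * complex.Re w.
  have : normc (w - r%:C) ^+ 2 < r ^+ 2 by rewrite ltr_pXn2r ?nnegrE ?normc_ge0 // ltW.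
  rewrite !normc_sqr; case: w {wr} => x y /=; rewrite !expr2; nra.
have Rw : 0 < complex.Re w.
  have : 0 < 2 * r * complex.Re w by apply: le_lt_trans w2; exact: sqr_ge0.
  by rewrite pmulr_rgt0 // mulr_gt0.
have nw : normc w < 2 * r.
  have h1 := normc_Re w; rewrite ger0_norm ?(ltW Rw) // in h1.
  have w0 : 0 < normc w by exact: lt_le_trans h1.
  rewrite -(ltr_pM2r w0) -expr2; apply: (lt_le_trans w2).
  by apply: ler_wpM2l => //; rewrite mulr_ge0 // ltW.
apply: inner; rewrite nrZ nrN.
  by apply: lt_le_trans r1; rewrite mulrA ltr_pM2r // mulrC.
have -> : complex.Re (l (w *: - nu)) = - complex.Re w.
  rewrite -scaleN1r scalerA complex_linearZ // lnu mulr1 mulrN1 ReN //.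
rewrite exprMn.
have h1 : C * (normc w ^+ 2 * nr nu ^+ 2) < C * (2 * r * complex.Re w * nr nu ^+ 2).
  by rewrite ltr_pM2l // ltr_pM2r // exprn_gt0.
have h2 : C * (2 * r * complex.Re w * nr nu ^+ 2) <= complex.Re w.
  rewrite (_ : C * _ = r * (2 * C * nr nu ^+ 2) * complex.Re w); last by ring.
  by apply: ler_piMl => //; exact: ltW.
lra.
Qed.

(** Non-tangential position in terms of [nr]: a ball about [z] of radius comparable with |z - p|
    lies in [D]. *)
Definition cone_point (k : R) (z : T) := D z /\ forall w, nr (w - z) < k * nr (z - p) -> D w.

(** The segment from [z] to the axis point with parameter |z - p| has length of order |z - p|, and
    balls of comparable radius about its points lie in [D]. Its Kobayashi length is therefore
    bounded independently of [z]. *)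
Lemma cone_to_axis (k : R) : 0 < k -> k <= 1 -> exists eta K : R, 0 < eta /\
  forall z, cone_point k z -> 0 < nr (z - p) -> nr (z - p) < eta ->
  D (p + (nr (z - p))%:C *: - nu) /\ dk D z (p + (nr (z - p))%:C *: - nu) <= K.
Proof.
move=> k0 k1; have N0 := nr_nu_gt0; set m := nr nu in N0.
pose k2 := k / (4 * m); have k20 : 0 < k2 by rewrite divr_gt0 // mulr_gt0.
pose k3 := Num.min k2 1; have k30 : 0 < k3 by rewrite lt_min k20 ltr01.
have k32 : k3 <= k2 by rewrite ge_min lexx.
have k31 : k3 <= 1 by rewrite ge_min lexx orbT.
(* With N = |z - p|, a perturbation of size e N changes Re l by at most k3 N / 4; [eta] below makes
   the quadratic errors at most k3 N / 4 as well. Both fit into the depth k3 N of the segment. *)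
pose e := Num.min 1 (k3 / (4 * C)).
have e0 : 0 < e by rewrite lt_min ltr01 divr_gt0 // mulr_gt0.
have e1 : e <= 1 by rewrite ge_min lexx.
have eC : C * e <= k3 / 4.
  have : e <= k3 / (4 * C) by rewrite ge_min lexx orbT.
  by rewrite ler_pdivlMr ?mulr_gt0 // => h; lra.
pose q := 4 * C + C * (2 + m) ^+ 2.
have q0 : 0 < q by rewrite addr_gt0 ?mulr_gt0 ?exprn_gt0 ?addr_gt0.
pose eta := Num.min (delta / (2 + m)) (k3 / 4 / q).
have eta0 : 0 < eta by rewrite lt_min !divr_gt0 // addr_gt0.
exists eta, ((1 + m) / e); split => // z [Dz zD] z0; rewrite lt_min => /andP[].
set N := nr (z - p) in z0 zD *.
rewrite ltr_pdivlMr ?addr_gt0 // => hd; rewrite ltr_pdivlMr // => hq.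
have h0 : 0 < N * (4 * C) by rewrite mulr_gt0 // mulr_gt0.
have h0' : 0 < N * (C * (2 + m) ^+ 2) by rewrite mulr_gt0 // mulr_gt0 // exprn_gt0 // addr_gt0.
have hq1 : N * (4 * C) < k3 / 4 by rewrite /q mulrDr in hq; lra.
have hq2 : N * (C * (2 + m) ^+ 2) < k3 / 4 by rewrite /q mulrDr in hq; lra.
pose u := z - p; have zu : p + u = z by rewrite addrC subrK.
have nuN : nr u = N by [].
clearbody N u k3 e.
(* Moving [z] along the outward direction [nu] by half the radius of its ball keeps it in [D]; the
   condition [outer] at the moved point shows how deep [z] itself lies. *)
have lu : complex.Re (l u) <= - (k3 * N).
  pose s := k * N / (2 * m); have s0 : 0 < s by rewrite divr_gt0 ?mulr_gt0.
  have ns : nr (s%:C *: nu) = k * N / 2.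
    by rewrite nrZ normc_real gtr0_norm // /s -/m; field; rewrite gt_eqF.
  have kN : k * N <= N by rewrite ler_piMl // ltW.
  have kN0 : 0 < k * N by rewrite mulr_gt0.
  have Dp : D (p + (u + s%:C *: nu)).
    by apply: zD; rewrite addrA zu [z + _]addrC addrK ns; lra.
  have nus : nr (u + s%:C *: nu) <= 2 * N.
    by apply: le_trans (nrD _ _) _; rewrite ns nuN; lra.
  have mN : 0 < m * N by rewrite mulr_gt0.
  have := outer _ Dp; rewrite Re_l_add Re_l_scale lnu mulr1 => /(_ ltac:(lra)) H.
  have h5 : C * nr (u + s%:C *: nu) ^+ 2 <= C * (2 * N) ^+ 2.
    by rewrite ler_pM2l // ler_sqr ?nnegrE ?nr_ge0 // mulr_ge0 // ltW.
  have h6 : C * (2 * N) ^+ 2 <= k3 / 4 * N.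
    by rewrite (_ : C * _ = N * (4 * C) * N); [rewrite ler_pM2r // ltW|ring].
  have sE : s = 2 * (k2 * N) by rewrite /s /k2; field; rewrite gt_eqF.
  have h7 : k3 * N <= k2 * N by rewrite ler_pM2r.
  have fin (a b c x y : R) : a + 2 * x <= b -> b <= c -> c <= y / 4 -> y <= x -> 0 <= y -> a <= - y.
    by move=> *; lra.
  apply: (fin _ _ _ (k2 * N) (k3 * N) _ h5 _ h7).
  - by rewrite -sE.
  - by rewrite mulrAC.
  - by rewrite mulr_ge0 // ltW.
have key y : nr y <= (2 + m) * N -> complex.Re (l y) < - (k3 * N / 2) -> D (p + y).
  move=> ny ly; apply: inner; first by lra.
  have h5 : C * nr y ^+ 2 <= C * ((2 + m) * N) ^+ 2.
    by rewrite ler_pM2l // ler_sqr ?nnegrE ?nr_ge0 // mulr_ge0 ?addr_ge0 // ltW.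
  have h6 : C * ((2 + m) * N) ^+ 2 <= k3 / 4 * N.
    by rewrite (_ : C * _ = N * (C * (2 + m) ^+ 2) * N); [rewrite ler_pM2r // ltW|ring].
  have h7 : 0 < k3 * N by rewrite mulr_gt0.
  lra.
pose b := p + N%:C *: - nu; have bE : b - z = N%:C *: - nu - u.
  by rewrite /b -zu opprD addrA [p + _]addrC addrK.
have bD : p + N%:C *: - nu = b by []; rewrite bD; clearbody b.
have nN : nr (N%:C *: - nu) = m * N by rewrite nrZ normc_real gtr0_norm // nrN mulrC.
have nb : nr (b - z) <= (1 + m) * N.
  by rewrite bE; apply: le_trans (nrD _ _) _; rewrite nrN nN nuN; lra.
have lN : complex.Re (l (N%:C *: - nu)) = - N.
  by rewrite Re_l_scale -scaleN1r complex_linearZ // lnu mulr1 ReN /= mulrN1.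
have seg (t : R) : 0 <= t <= 1 -> forall y, nr (y - (z + t%:C *: (b - z))) < e * N -> D y.
  move=> /andP[t0 t1] y; set x := z + _ => yx.
  have xE : x - p = (1 - t)%:C *: u + t%:C *: (N%:C *: - nu).
    by rewrite /x bE -{1}zu segment_shift rmorphB rmorph1.
  clearbody x.
  have nx : nr (x - p) <= (1 + m) * N.
    rewrite xE; apply: le_trans (nrD _ _) _; rewrite nrZ nrZ nN nuN !normc_real !ger0_norm ?subr_ge0 //.
    have h1 : (1 - t) * N <= N by apply: ler_piMl; [exact: ltW|lra].
    have h2 : t * (m * N) <= m * N by rewrite ler_piMl // mulr_ge0 // ltW.
    lra.
  have lx : complex.Re (l (x - p)) <= - (k3 * N).
    rewrite xE Re_l_add (Re_l_scale _ u) (Re_l_scale t) lN.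
    have h1 : (1 - t) * complex.Re (l u) <= (1 - t) * - (k3 * N) by apply: ler_wpM2l; rewrite ?subr_ge0.
    have h2 : t * (k3 * N) <= t * N by apply: ler_wpM2l => //; rewrite ler_piMl // ltW.
    lra.
  have yE : y - p = (x - p) + (y - x) by rewrite [RHS]addrC addrA subrK.
  have -> : y = p + (y - p) by rewrite addrC subrK.
  have eN : e * N <= N by rewrite ler_piMl // ltW.
  apply: key.
    by rewrite yE; apply: le_trans (nrD _ _) _; lra.
  rewrite yE Re_l_add.
  have h1 : complex.Re (l (y - x)) <= C * (e * N).
    apply: le_trans (ler_norm _) _; apply: le_trans (Re_l_le _) _.
    by rewrite ler_pM2l // ltW.
  have h2 : C * (e * N) <= k3 / 4 * N by rewrite mulrA ler_pM2r.
  have h3 : 0 < k3 * N by rewrite mulr_gt0.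
  lra.
have eN0 : 0 < e * N by rewrite mulr_gt0.
have Db : D b.
  apply: (seg 1); first by rewrite ler01 lexx.
  by rewrite scale1r [z + _]addrC subrK subrr nr0.
split=> //; rewrite -lee_fin -(dkE dD Dz Db); apply: kd_segment => t t01; split.
  by apply: (seg t t01); rewrite subrr nr0.
apply: le_trans (KR_ball (r := e * N) (b - z) eN0 (seg t t01)) _.
rewrite lee_fin ler_pdivrMr //; apply: (le_trans nb).
by rewrite mulrA divfK // gt_eqF.
Qed.

(** Both points are joined to the axis at bounded cost, and between the two axis points [kd_radial]
    gives half the difference of the logarithms. *)
Lemma upper_bound (k : R) : 0 < k -> k <= 1 -> exists eta K : R, 0 < eta /\
  forall z w, cone_point k z -> cone_point k w -> 0 < nr (z - p) -> nr (z - p) < eta ->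
    0 < nr (w - p) -> nr (w - p) < eta ->
    dk D z w <= `|ln (nr (z - p)) - ln (nr (w - p))| / 2 + K.
Proof.
move=> k0 k1; have [eta [K [eta0 HK]]] := cone_to_axis k0 k1.
have [r r0 rD] := inner_disc; have [oD _ _] := dD.
exists (Num.min eta r), (2 * K + ln 2 / 2); split; first by rewrite lt_min eta0.
move=> z w cz cw z0; rewrite lt_min => /andP[ze zr] w0; rewrite lt_min => /andP[we wr].
have [Dz' Hz] := HK z cz z0 ze; have [Dw' Hw] := HK w cw w0 we.
have [Dz _] := cz; have [Dw _] := cw.
have l2 : 0 <= ln 2 :> R by apply: ln_ge0; rewrite ler1n.
set z' := p + _ in Dz' Hz; set w' := p + _ in Dw' Hw.
have mid : dk D z' w' <= `|ln (nr (z - p)) - ln (nr (w - p))| / 2 + ln 2 / 2.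
  have rad s t : 0 < s -> s < t -> t < r -> D (p + s%:C *: - nu) -> D (p + t%:C *: - nu) ->
      dk D (p + s%:C *: - nu) (p + t%:C *: - nu) <= `|ln s - ln t| / 2 + ln 2 / 2.
    move=> s0 st tr Ds Dt; have := kd_radial rD s0 st (ltW tr).
    rewrite (dkE dD Ds Dt) lee_fin => /le_trans; apply; rewrite lerD2r ler_pM2r ?invr_gt0 //.
    by rewrite distrC ler_norm.
  have [E|zw|wz] := ltgtP (nr (z - p)) (nr (w - p)).
  - exact: (rad _ _ z0 E wr Dz' Dw').
  - by rewrite dk_sym distrC; exact: (rad _ _ w0 zw zr Dw' Dz').
  - by rewrite /z' /w' wz dk_self // addr_ge0 // divr_ge0.
have t1 := dk_triangle dD Dz Dz' Dw; have t2 := dk_triangle dD Dz' Dw' Dw.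
have {}Hw : dk D w' w <= K := eq_ind_r (fun x => x <= K) Hw (dk_sym D w' w).
apply: (le_trans t1); apply: le_trans (lerD Hz t2) _.
have -> (X Y : R) : X + (2 * K + Y) = K + (X + Y + K) by ring.
by rewrite lerD2l; apply: lerD.
Qed.

End UpperBoundCone.

(** * Cluster values of sequences and non-tangential approach *)

Section Accumulation.
Context {R : realType} {n : nat}.
Local Notation T := 'rV[R[i]]_n.

Definition clusters_at (u : nat -> T) (q : T) :=
  forall e : R, 0 < e -> forall N : nat, exists2 k, (N <= k)%N & nr (u k - q) < e.

Lemma compact_clusters_at (K : set T) (u : nat -> T) : compact K -> (forall k, K (u k)) ->
  exists q, clusters_at u q.
Proof.
move=> cK uK; have [|q [_ clq]] := cK (u @ \oo) _.
  by exists 0%N => // k _; exact: uK.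
exists q => e e0 N.
have [|_ [[k /= Nk <-] kq]] := clq (u @` [set k | (N <= k)%N]) _ _ (nr_near q e0).
  by exists N => // k Nk; exists k.
by exists k.
Qed.

Lemma cvg_unique_clusters_at (K : set T) (u : nat -> T) q : compact K -> (forall k, K (u k)) ->
  (forall q', clusters_at u q' -> q' = q) -> u @ \oo --> q.
Proof.
move=> cK uK Hq; apply/cvg_nrP => e e0; apply: contrapT => nH.
have Hfar N : exists k, (N <= k)%N /\ e <= nr (u k - q).
  apply: contrapT => nk; apply: nH; exists N => // k /= Nk; rewrite ltNge; apply/negP => ek.
  by apply: nk; exists k.
have [f Hf] := choice Hfar.
have [q' aq'] := compact_clusters_at cK (fun k => uK (f k)).
have E : q' = q.
  apply: Hq => c c0 N; have [k Nk kq] := aq' c c0 N; exists (f k) => //.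
  by have [fk _] := Hf k; exact: leq_trans fk.
have [k _] := aq' e e0 0%N; rewrite E; have [_] := Hf k; lra.
Qed.

Lemma closure_compact (D : set T) : bounded_set D -> compact (closure D).
Proof.
move=> /bounded_nrP[M M0 DM]; apply: closed_bounded_compact; last exact: closed_closure.
apply/bounded_nrP; exists (M + 1); first by rewrite addr_gt0.
move=> v cv; have [w Dw wv] := (closure_nrP _ _).1 cv 1 ltr01.
by have := DM w Dw; have := le_nrB v w; rewrite (nrB v w); lra.
Qed.

End Accumulation.

Section NonTangential.
Context {R : realType} {n : nat}.
Local Notation T := 'rV[R[i]]_n.

Lemma cone_point_mono (D : set T) p (k k' : R) z : k' <= k -> cone_point D p k z ->
  cone_point D p k' z.
Proof.
move=> kk [Dz H]; split=> // w wz; apply: H; apply: (lt_le_trans wz).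
by apply: ler_wpM2r => //; exact: nr_ge0.
Qed.

Lemma nontangential_cone (D : set T) p (z : nat -> T) : cvg_nontangential D z p ->
  exists k : R, [/\ 0 < k, k <= 1 & forall j, cone_point D p k (z j)].
Proof.
move=> [Dz _ [c c0 Hc]].
(* The factor [n.+1] dominates the ratio of [enorm] to [nr] and is positive also for [n = 0]. *)
pose m : R := c * n.+1%:R; have m0 : 0 < m by rewrite mulr_gt0.
exists (Num.min 1 m^-1); split; [by rewrite lt_min ltr01 invr_gt0|by rewrite ge_min lexx|].
move=> j; split=> // w wz; apply: contrapT => nDw.
have h1 : dist_compl D (z j) <= enorm (z j - w).
  apply: ge_inf; last by exists w.
  by exists 0 => _ [v _ <-]; apply: le_trans (nr_ge0 _) (nr_le_enorm _).
have h2 := ler_wpM2l (ltW c0) (le_trans h1 (enorm_le_nr _)).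
have h3 := le_trans (nr_le_enorm _) (le_trans (Hc j) h2).
have h4 : c * (n%:R * nr (z j - w)) <= m * nr (z j - w).
  rewrite /m -mulrA ler_pM2l //; apply: ler_wpM2r; first exact: nr_ge0.
  by rewrite ler_nat.
have h5 : m * nr (z j - w) < nr (z j - p).
  rewrite mulrC -ltr_pdivlMr // mulrC nrB; apply: (lt_le_trans wz).
  by apply: ler_wpM2r; rewrite ?nr_ge0 // ge_min lexx orbT.
lra.
Qed.

End NonTangential.

(** Here [a] and [b] are logarithms of distances to [p]. Adding the lower bounds and using (a + b)/2
    + |a - b|/2 = max(a, b) leaves - max(a, b) <= 2 K2 + K3, against the two thresholds. *)
Lemma visible_arith (R : realFieldType) (a b K2 K3 L t : R) :
  a < - (2 * K2 + K3) -> b < - (2 * K2 + K3) -> L <= `|a - b| / 2 + K3 ->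
  - a / 2 - K2 <= t -> - b / 2 - K2 <= L - t -> False.
Proof.
by have [ab|ab] := leP a b; [rewrite ler0_norm ?subr_le0|rewrite gtr0_norm ?subr_gt0]; lra.
Qed.

(** * Uniqueness of the cluster value, and the theorem *)

Section Main.
Context {R : realType} {n : nat}.
Local Notation T := 'rV[R[i]]_n.
Context (D D' : set T) (p : T) (F G : T -> T).
Context (dD : domain D) (bD : bounded_set D).
Context (dD' : domain D') (bD' : bounded_set D') (cD' : complete_hyperbolic D').
Context (visD' : visibility D').
Context (pD : ~ D p).
Context (hF : holomorphic_on D F) (hG : holomorphic_on D' G).
Context (DF : forall z, D z -> D' (F z)) (GF : forall z, D z -> G (F z) = z).
Context (D'G : forall w, D' w -> D (G w)).
Context (delta : R) (delta0 : 0 < delta).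
Context (lower : forall eta : R, 0 < eta -> 2 * eta <= delta -> exists K : R,
  forall z y, D z -> D y -> nr (z - p) < eta -> eta <= nr (y - p) ->
    - ln (nr (z - p)) / 2 - K <= dk D z y).
Context (upper : forall k : R, 0 < k -> k <= 1 -> exists eta K : R, 0 < eta /\
  forall z w, cone_point D p k z -> cone_point D p k w -> 0 < nr (z - p) -> nr (z - p) < eta ->
    0 < nr (w - p) -> nr (w - p) < eta ->
    dk D z w <= `|ln (nr (z - p)) - ln (nr (w - p))| / 2 + K).

Lemma dist_gt0 z : D z -> 0 < nr (z - p).
Proof. by move=> Dz; rewrite nr_gt0 subr_eq0; apply/eqP => zp; apply: pD; rewrite -zp. Qed.

Lemma dk_contract_F z w : D z -> D w -> dk D' (F z) (F w) <= dk D z w.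
Proof.
move=> Dz Dw; have [oD _ _] := dD; have := kd_holo z w oD hF DF.
by rewrite !dkE ?lee_fin //; exact: DF.
Qed.

Lemma dk_contract_G z w : D' z -> D' w -> dk D (G z) (G w) <= dk D' z w.
Proof.
move=> Dz Dw; have [oD _ _] := dD'; have := kd_holo z w oD hG D'G.
by rewrite !dkE ?lee_fin //; exact: D'G.
Qed.

Lemma min_half_delta (a : R) : 0 < a ->
  [/\ 0 < Num.min (delta / 2) a, 2 * Num.min (delta / 2) a <= delta & Num.min (delta / 2) a <= a].
Proof.
move=> a0; split; [by rewrite lt_min a0 divr_gt0| |by rewrite ge_min lexx orbT].
have : Num.min (delta / 2) a <= delta / 2 by rewrite ge_min lexx.
by move: (Num.min _ _) => x; move: (delta) => y; lra.
Qed.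

(** If [q] were inside [D'], the distance-decreasing map [G] would keep infinitely many z_k at
    bounded distance from G q, although the lower bound tends to infinity as z_k approaches [p]. *)
Lemma clusters_at_boundary (z : nat -> T) q : (forall k, D (z k)) -> z @ \oo --> p ->
  clusters_at (F \o z) q -> boundary D' q.
Proof.
move=> Dz /cvg_nrP zp aq; split.
  apply/closure_nrP => e e0; have [k _ kq] := aq e e0 0%N.
  by exists (F (z k)) => //; exact: DF.
move=> /interior_subset Dq.
have [r r0 Hr] := dk_small dD' Dq (@ltr01 R).
have [eta0 etad etaq] := min_half_delta (dist_gt0 (D'G Dq)).
set eta := Num.min _ _ in eta0 etad etaq.
have [K HK] := lower eta0 etad.
(* Below this radius - ln |z_k - p| / 2 - K exceeds 1, the bound on the distance from z_k to G q. *)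
pose s := Num.min eta (expR (- (2 * (1 + K)))).
have s0 : 0 < s by rewrite lt_min eta0 expR_gt0.
have [N _ HN] := zp s s0; have [k Nk kq] := aq r r0 N.
have [DFk qk] := Hr _ kq.
have : dk D (z k) (G q) < 1.
  by rewrite dk_sym -(GF (Dz k)); apply: le_lt_trans (dk_contract_G Dq DFk) qk.
have := HN k Nk; rewrite lt_min => /andP[k1 k2].
have := HK (z k) (G q) (Dz k) (D'G Dq) k1 etaq.
have : ln (nr (z k - p)) < - (2 * (1 + K)).
  by rewrite -[ltRHS]expRK ltr_ln ?posrE ?expR_gt0 //; exact: dist_gt0.
move: (ln _) (dk _ _ _) => x y; lra.
Qed.

(** Provides one radius eta for which the lower bound holds between points near [p] and every point
    of G(K), wherever the geodesic meets [K]. *)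
Lemma image_away (K : set T) : compact K -> K `<=` D' ->
  exists2 e : R, 0 < e & forall m, K m -> e <= nr (G m - p).
Proof.
move=> cK KD'.
have loc m : exists r : R * R, K m -> [/\ 0 < r.1, 0 < r.2 &
    forall y, nr (y - m) < r.1 -> r.2 <= nr (G y - p)].
  have [Km|nKm] := pselect (K m); last by exists (0, 0).
  have g0 := dist_gt0 (D'G (KD' _ Km)).
  have g2 : 0 < nr (G m - p) / 2 by rewrite divr_gt0.
  have cG : {for m, continuous G} by apply: differentiable_continuous; exact: hG (KD' _ Km).
  have /nbhs_nrP[r r0 Hr] := cG _ (nr_near (G m) g2).
  exists (r, nr (G m - p) / 2) => _; split => //= y /Hr /= h.
  by have := nr_triangle (G y) (G m) p; rewrite (nrB (G m) (G y)); lra.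
have [r Hr] := choice loc.
have [|s [sK sc]] := @finite_cover R n K (fun m => (r m).1) cK; first by move=> m /Hr[].
have [e e0 He] : exists2 e : R, 0 < e & forall m, m \in s -> e <= (r m).2.
  have q0 m : m \in s -> 0 < (r m).2 by move=> /sK/Hr[].
  elim: (s) q0 => [|m s' IH] q0; first by exists 1.
  have [|e e0 He] := IH; first by move=> w ws; apply: q0; rewrite inE ws orbT.
  exists (Num.min e (r m).2); first by rewrite lt_min e0 q0 // mem_head.
  move=> w; rewrite inE ge_min => /predU1P[->|/He ->//]; by rewrite lexx orbT.
exists e => // m Km; have [w ws mw] := sc m Km.
by apply: (le_trans (He w ws)); have [_ _] := Hr w (sK w ws); exact.
Qed.

(* If the cluster points differ, visibility sends a geodesic from [F z_k] to [F w_l]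
   through a fixed compact set, so its length is about
   [(log 1/|z_k - p| + log 1/|w_l - p|) / 2], more than the upper bound allows. *)
Lemma clusters_at_unique (z w : nat -> T) q q' : cvg_nontangential D z p ->
  cvg_nontangential D w p -> clusters_at (F \o z) q -> clusters_at (F \o w) q' -> q = q'.
Proof.
move=> nz nw az aw; apply: contrapT => qq'.
have [Dz zp _] := nz; have [Dw wp _] := nw.
have [U [V [K [nU nV _ [cK KD'] vis]]]] :=
  visD' (clusters_at_boundary Dz zp az) (clusters_at_boundary Dw wp aw) qq'.
have [c c0 Hc] := image_away cK KD'.
have [eta0 etad etac] := min_half_delta c0; set eta := Num.min _ _ in eta0 etad etac.
clearbody eta.
have [K2 HK2] := lower eta0 etad.
have [kz [kz0 kz1 cz]] := nontangential_cone nz; have [kw [kw0 kw1 cw]] := nontangential_cone nw.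
pose k := Num.min kz kw; have k0 : 0 < k by rewrite lt_min kz0.
have k1 : k <= 1 by rewrite ge_min kz1.
have [eta3 [K3 [eta30 HK3]]] := upper k0 k1.
(* The exponential is the threshold that [visible_arith] demands of both logarithms. *)
pose s := Num.min (Num.min eta eta3) (expR (- (2 * K2 + K3))).
have s0 : 0 < s by rewrite !lt_min eta0 eta30 expR_gt0.
have pick (v : nat -> T) (q0 : T) (W : set T) : (forall j, D (v j)) -> v @ \oo --> p ->
    clusters_at (F \o v) q0 -> nbhs q0 W -> exists j, [/\ W (F (v j)), nr (v j - p) < eta,
      nr (v j - p) < eta3 & ln (nr (v j - p)) < - (2 * K2 + K3)].
  move=> Dv /cvg_nrP/(_ s s0)[N _ HN] av /nbhs_nrP[e e0 eW].
  have [j Nj jq] := av e e0 N; exists j.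
  have := HN j Nj; rewrite !lt_min => /andP[/andP[h1 h2] h3]; split => //; first exact: eW.
  by rewrite -[ltRHS]expRK ltr_ln ?posrE ?expR_gt0 //; exact: dist_gt0.
have [i [Ui i1 i2 i3]] := pick z q U Dz zp az nU.
have [j [Vj j1 j2 j3]] := pick w q' V Dw wp aw nV.
have DFi := DF (Dz i); have DFj := DF (Dw j).
have [g [g0 gL geo]] := kobayashi_geodesic dD' bD' cD' DFi DFj.
set L := dk D' (F (z i)) (F (w j)) in g0 gL geo.
have L0 : 0 <= L by exact: dk_ge0.
have [t tL Kt] : exists2 t, 0 <= t <= L & K (g t).
  by apply: vis => //; [rewrite g0|rewrite gL].
have [gD gd] := geo; have Dt := KD' _ Kt.
have d1 : dk D' (F (z i)) (g t) = t.
  rewrite -g0 /dk gd /= ?in_itv /= ?lexx ?L0 // sub0r normrN ger0_norm //.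
  by case/andP: tL.
have d2 : dk D' (F (w j)) (g t) = L - t.
  rewrite -gL /dk gd /= ?in_itv /= ?lexx ?L0 // ger0_norm // subr_ge0.
  by case/andP: tL.
have e1 := HK2 _ _ (Dz i) (D'G Dt) i1 (le_trans etac (Hc _ Kt)).
have e2 := HK2 _ _ (Dw j) (D'G Dt) j1 (le_trans etac (Hc _ Kt)).
have f1 := dk_contract_G DFi Dt; have f2 := dk_contract_G DFj Dt.
rewrite (GF (Dz i)) d1 in f1; rewrite (GF (Dw j)) d2 in f2.
have mz : k <= kz by rewrite ge_min lexx.
have mw : k <= kw by rewrite ge_min lexx orbT.
have e3 := HK3 _ _ (cone_point_mono mz (cz i)) (cone_point_mono mw (cw j))
  (dist_gt0 (Dz i)) i2 (dist_gt0 (Dw j)) j2.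
have f3 := dk_contract_F (Dz i) (Dw j).
have {e1}f1 := le_trans e1 f1; have {e2}f2 := le_trans e2 f2.
have {f3}e3 : L <= _ := le_trans f3 e3.
exact: visible_arith i3 j3 e3 f1 f2.
Qed.

Lemma nontangential_limit : exists q : T, forall z : nat -> T,
  cvg_nontangential D z p -> (fun k => F (z k)) @ \oo --> q.
Proof.
have cK := closure_compact bD'.
have inK (z : nat -> T) : cvg_nontangential D z p -> forall k, closure D' (F (z k)).
  by move=> [Dz _ _] k; apply: subset_closure; exact: DF.
(* The limit is read off from a single non-tangential sequence; if there is none, any value, here 0,
   satisfies the claim vacuously. *)
have [[z0 nz0]|none] := pselect (exists z, cvg_nontangential D z p); last first.
  by exists 0 => z nz; case: none; exists z.
have [q aq] := compact_clusters_at cK (inK z0 nz0).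
exists q => z nz; apply: (cvg_unique_clusters_at cK (inK z nz)) => q' aq'.
exact: (clusters_at_unique nz nz0 aq' aq).
Qed.

End Main.

Theorem theorem1p2 (R : realType) (n : nat) (D D' : set 'rV[R[i]]_n)
    (p : 'rV[R[i]]_n) (F : 'rV[R[i]]_n -> 'rV[R[i]]_n) :
  domain D -> bounded_set D -> complete_hyperbolic D ->
  domain D' -> bounded_set D' -> complete_hyperbolic D' ->
  stein_neighborhood_basis (closure D) ->
  visibility D' ->
  boundary D p -> C3_strongly_pseudoconvex_at D p ->
  biholomorphism D D' F ->
  exists q : 'rV[R[i]]_n, forall z : nat -> 'rV[R[i]]_n,
    cvg_nontangential D z p -> (fun k => F (z k)) @ \oo --> q.
Proof.
move=> dD bD _ dD' bD' cD' _ visD' bp spc [G [hF hG FP GP]].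
have [oD _ _] := dD; have [M M0 DM] := (bounded_nrP D).1 bD.
have pD : ~ D p by case: bp => _ nDp Dp; apply: nDp; exact: open_nbhs_nbhs.
have [l [nu [H [C [delta [c [[C0 delta0 c0] [ll lnu lC] outer inner [hH HC HD]]]]]]]] :=
  peak_data_exists oD bp spc.
have shift z : p + (z - p) = z by rewrite addrC subrK.
apply: (@nontangential_limit R n D D' p F G dD dD' bD' cD' visD' pD hF hG _ _ _ delta delta0).
- by move=> z /FP[].
- by move=> z /FP[].
- by move=> w /GP[].
- move=> eta eta0 etad.
  apply: (@lower_bound R n D p H delta c C eta M) => //.
  + by move=> z Dz zd; have := HD (z - p) zd; rewrite shift; exact.
  + by move=> z zd; have := HC (z - p) zd; rewrite shift.
- exact: (upper_bound dD C0 delta0 ll lnu lC outer inner).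
Qed.
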